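(* Let $n\ge1$, let $\nu>0$, let $\Gamma$ be a full-rank lattice in $\mathbb{C}^n$, and let $\chi:\Gamma\to U(1)$ be a map such that $\chi(\gamma_1+\gamma_2)=\chi(\gamma_1)\chi(\gamma_2)e^{i\nu\omega(\gamma_1,\gamma_2)}$ for all $\gamma_1,\gamma_2\in\Gamma$. Let $\mathcal{O}^\nu_{\Gamma,\chi}(\mathbb{C}^n)$ be the space of holomorphic functions $g$ on $\mathbb{C}^n$ with $g(z+\gamma)=\chi(\gamma)e^{\frac{\nu}{2}|\gamma|^2+\nu\langle z,\gamma\rangle}g(z)$ for all $z\in\mathbb{C}^n$, $\gamma\in\Gamma$, endowed with the scalar product $$\langle\langle g_1,g_2\rangle\rangle_\Gamma=\int_{\Lambda(\Gamma)}g_1(z)\overline{g_2(z)}\,e^{-\nu|z|^2}\,dm(z).$$ Then: (i) $\mathcal{O}^\nu_{\Gamma,\chi}(\mathbb{C}^n)$ is a nonzero space. (ii) $\mathcal{O}^\nu_{\Gamma,\chi}(\mathbb{C}^n)$ is a reproducing kernel Hilbert space whose reproducing kernel is $$K^\nu_{\Gamma,\chi}(z,w)=\Big(\frac{\nu}{\pi}\Big)^{n}e^{\nu\langle z,w\rangle}\sum_{\gamma\in\Gamma}\chi(\gamma)e^{-\frac{\nu}{2}|\gamma|^2+\nu(\langle z,\gamma\rangle-\overline{\langle w,\gamma\rangle})}.$$ (iii) $\mathcal{O}^\nu_{\Gamma,\chi}(\mathbb{C}^n)$ is finite dimensional, with $\dim\mathcal{O}^\nu_{\Gamma,\chi}(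\mathbb{C}^n)=(\nu/\pi)^n\,\mathrm{vol}(\Lambda(\Gamma))$.
   Context: $\mathbb{C}^n$ carries the Hermitian form $\langle z,w\rangle=z_1\bar w_1+\cdots+z_n\bar w_n$, with $|z|^2=\langle z,z\rangle$ and $\omega(z,w)=\mathrm{Im}\langle z,w\rangle$; $dm$ is Lebesgue measure on $\mathbb{C}^n$. A full-rank lattice $\Gamma$ is a discrete subgroup of rank $2n$ of $(\mathbb{C}^n,+)$. $U(1)=\{\lambda\in\mathbb{C}:|\lambda|=1\}$. $\Lambda(\Gamma)$ is a (measurable) fundamental domain of $\Gamma$, so that $\mathbb{C}^n$ is the disjoint union of the translates $\gamma+\Lambda(\Gamma)$, $\gamma\in\Gamma$, and $\mathrm{vol}(\Lambda(\Gamma))$ is its Lebesgue volume. *)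

(* Defs.v *)
From HB Require Import structures.
From mathcomp Require Import all_boot all_order all_algebra.
From mathcomp Require Import all_classical all_reals all_analysis.
From mathcomp Require Import complex.
From mathcomp Require summability.

Set Implicit Arguments.
Unset Strict Implicit.
Unset Printing Implicit Defensive.

Import Order.TTheory GRing.Theory Num.Theory.
Import numFieldNormedType.Exports.

Local Open Scope classical_set_scope.
Local Open Scope ring_scope.
Local Open Scope complex_scope.

Definition cexp (R : realType) (z : R[i]) : R[i] :=
  (expR (complex.Re z))%:C * (cos (complex.Im z) +i* sin (complex.Im z)).

(* Limit of the finite partial sums along the directed set of finite subsets;
   [csum] is meaningful when [csummable] holds. *)
Definition csummable (R : realType) (T : choiceType) (D : set T)
    (f : T -> R[i]^o) : Prop :=
  cvg (summability.partial_sum (f \_ D) @ summability.totally).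

Definition csum (R : realType) (T : choiceType) (D : set T)
    (f : T -> R[i]^o) : R[i] :=
  summability.sum (f \_ D).

Section hermitian_form.
Context {R : realType} {n : nat}.
Implicit Types z w : 'rV[R[i]]_n.

Definition hdot z w : R[i] := \sum_(i < n) z 0 i * conjc (w 0 i).

Definition omega z w : R := complex.Im (hdot z w).

(* The scalars of both normed modules are R[i], so this is complex
   differentiability. *)
Definition holomorphic (g : 'rV[R[i]]_n -> R[i]^o) : Prop :=
  forall x, differentiable g x.

End hermitian_form.

Section sigma_finite_product.
Local Open Scope ereal_scope.
Context d1 d2 (T1 : measurableType d1) (T2 : measurableType d2) (R : realType).
Variables (m1 : {measure set T1 -> \bar R}).
Variables (m2 : {sigma_finite_measure set T2 -> \bar R}).

Lemma sigma_finite_product_measure1 :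
  sigma_finite [set: T1] m1 -> sigma_finite [set: T1 * T2] (m1 \x m2).
Proof.
move=> /sigma_finiteP[F [TF ndF Foo]].
have /sigma_finiteP[G [TG ndG Goo]] := sigma_finiteT m2.
exists (fun n => F n `*` G n).
  rewrite -setXTT TF TG predeqE => -[x y]; split.
    move=> [/= [n _ Fnx] [k _ Gky]]; exists (maxn n k) => //; split.
    - by move: x Fnx; exact/subsetPset/ndF/leq_maxl.
    - by move: y Gky; exact/subsetPset/ndG/leq_maxr.
  by move=> [n _ []/= ? ?]; split; exists n.
move=> k; have [? ?] := Foo k; have [? ?] := Goo k.
split; first exact: measurableX.
by rewrite product_measure1E// lte_mul_pinfty// ge0_fin_numE.
Qed.

End sigma_finite_product.

Section lebesgue_cons.
Context {R : realType} {n : nat}.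
Local Notation plane := (measurableTypeR R * measurableTypeR R)%type.
Local Open Scope ereal_scope.
Variable mu : {sigma_finite_measure set (n.-tuple plane) -> \bar R}.

Let cons (p : plane * n.-tuple plane) : n.+1.-tuple plane :=
  [the n.+1.-tuple plane of p.1 :: p.2].

Let measurable_consp : measurable_fun [set: plane * n.-tuple plane] cons.
Proof. exact: measurable_cons. Qed.

Definition lebesgue_cons : set (n.+1.-tuple plane) -> \bar R :=
  pushforward ((lebesgue_measure \x lebesgue_measure) \x mu) cons.

Let lebesgue_cons0 : lebesgue_cons set0 = 0.
Proof. by rewrite /lebesgue_cons /pushforward preimage_set0 measure0. Qed.

Let lebesgue_cons_ge0 A : 0 <= lebesgue_cons A.
Proof. exact: measure_ge0. Qed.

Let lebesgue_cons_sigma_additive : semi_sigma_additive lebesgue_cons.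
Proof. exact: measure_semi_sigma_additive. Qed.

HB.instance Definition _ := isMeasure.Build _ _ _ lebesgue_cons
  lebesgue_cons0 lebesgue_cons_ge0 lebesgue_cons_sigma_additive.

Let lebesgue_cons_sigma_finite :
  sigma_finite [set: n.+1.-tuple plane] lebesgue_cons.
Proof.
have [F FT mF] : sigma_finite setT
    ((lebesgue_measure \x lebesgue_measure) \x mu).
  do 2 apply: sigma_finite_product_measure1.
  exact: (sigma_finiteT (@lebesgue_measure R)).
pose uncons (t : n.+1.-tuple plane) := (thead t, [tuple of behead t]).
have consK : cancel cons uncons.
  move=> [x t]; rewrite /uncons /cons theadE; congr (_, _).
  exact/val_inj.
have unconsK : cancel uncons cons.
  by move=> t; rewrite [RHS]tuple_eta; exact/val_inj.
have muncons : measurable_fun setT uncons.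
  apply: measurable_fun_pair; last exact: measurable_behead.
  exact: measurable_tnth.
exists (fun k => uncons @^-1` (F k)).
  apply/seteqP; split=> // t _.
  have : [set: plane * n.-tuple plane] (uncons t) by [].
  by rewrite FT => -[k _ Fk]; exists k.
move=> k; have [mFk Fkoo] := mF k; split.
  by rewrite -[X in measurable X]setTI; exact: muncons.
rewrite /lebesgue_cons /pushforward -comp_preimage.
rewrite (_ : (uncons \o cons) @^-1` F k = F k)//.
by apply/seteqP; split=> p /=; rewrite consK.
Qed.

HB.instance Definition _ := Measure_isSigmaFinite.Build _ _ _ lebesgue_cons
  lebesgue_cons_sigma_finite.

End lebesgue_cons.

Section lebesgue_measure_Cn.
Context {R : realType}.
Local Notation plane := (measurableTypeR R * measurableTypeR R)%type.

Let dirac_tuple0 : {sigma_finite_measure set (0.-tuple plane) -> \bar R} :=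
  [the {sigma_finite_measure set _ -> \bar R} of dirac [tuple]].

(* The iterated product of planar Lebesgue measures, on the Borel
   sigma-algebra of (R^2)^n. *)
Fixpoint lebesgue_tuple n :
    {sigma_finite_measure set (n.-tuple plane) -> \bar R} :=
  match n with
  | 0 => dirac_tuple0
  | m.+1 => [the {sigma_finite_measure set _ -> \bar R} of
               lebesgue_cons (lebesgue_tuple m)]
  end.

(* Its completion, whose measurable sets are the Lebesgue measurable ones. *)
Definition lebesgue_Cn n :=
  [the {measure set (caratheodory_type (lebesgue_tuple n)^*%mu) -> \bar R} of
     @completed_measure_extension _ _ _ (lebesgue_tuple n)].

Definition tuple_Cn n (x : n.-tuple plane) : 'rV[R[i]]_n :=
  \row_i ((tnth x i).1 +i* (tnth x i).2).

Variable n : nat.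
Implicit Types (A : set 'rV[R[i]]_n) (f : 'rV[R[i]]_n -> R[i]).

Definition measurable_Cn A : Prop :=
  measurable (@tuple_Cn n @^-1` A
                : set (caratheodory_type (lebesgue_tuple n)^*%mu)).

Definition vol A : \bar R := lebesgue_Cn n (@tuple_Cn n @^-1` A).

Definition integrable_Cn A f : Prop :=
  (lebesgue_Cn n).-integrable (@tuple_Cn n @^-1` A)
    (fun x => (complex.Re (f (tuple_Cn x)))%:E) /\
  (lebesgue_Cn n).-integrable (@tuple_Cn n @^-1` A)
    (fun x => (complex.Im (f (tuple_Cn x)))%:E).

Definition integral_Cn A f : R[i] :=
  (\int[lebesgue_Cn n]_(x in @tuple_Cn n @^-1` A)
     complex.Re (f (tuple_Cn x))) +i*
  (\int[lebesgue_Cn n]_(x in @tuple_Cn n @^-1` A)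
     complex.Im (f (tuple_Cn x))).

End lebesgue_measure_Cn.

Section lattices.
Context {R : realType} {n : nat}.
Implicit Types G L : set 'rV[R[i]]_n.

Definition additive_subgroup G : Prop :=
  G 0 /\ forall x y, G x -> G y -> G (x - y).

Definition Z_independent r (v : 'I_r -> 'rV[R[i]]_n) : Prop :=
  forall c : 'I_r -> int, \sum_(i < r) v i *~ c i = 0 -> forall i, c i = 0.

(* The rank of an abelian group: the largest size of a Z-independent family. *)
Definition has_rank G r : Prop :=
  (exists v : 'I_r -> 'rV[R[i]]_n, (forall i, G (v i)) /\ Z_independent v) /\
  ~ (exists v : 'I_r.+1 -> 'rV[R[i]]_n,
       (forall i, G (v i)) /\ Z_independent v).

Definition full_rank_lattice G : Prop :=
  [/\ additive_subgroup G,
      G `<=` @isolated ('rV[R[i]]_n : normedModType R[i]) G &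
      has_rank G (2 * n)%N].

Definition translate L (g : 'rV[R[i]]_n) : set 'rV[R[i]]_n :=
  [set g + x | x in L].

Definition fundamental_domain G L : Prop :=
  [/\ measurable_Cn L,
      \bigcup_(g in G) translate L g = setT &
      trivIset G (translate L)].

End lattices.

Section function_spaces.
Context {R : realType} {X : Type}.
Implicit Types (H : set (X -> R[i])) (K : X -> X -> R[i]).
Implicit Types ip : (X -> R[i]) -> (X -> R[i]) -> R[i].

Definition linear_subspace H : Prop :=
  H (fun=> 0) /\
  forall (a : R[i]) f g, H f -> H g -> H (fun x => a * f x + g x).

Definition has_dim H d : Prop :=
  exists b : 'I_d -> X -> R[i],
  [/\ forall i, H (b i),
      forall c : 'I_d -> R[i],
        (forall x, \sum_(i < d) c i * b i x = 0) -> forall i, c i = 0 &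
      forall f, H f ->
        exists c : 'I_d -> R[i], forall x, f x = \sum_(i < d) c i * b i x].

Definition inner_product H ip : Prop :=
  [/\ forall (a : R[i]) f g h, H f -> H g -> H h ->
        ip (fun x => a * f x + g x) h = a * ip f h + ip g h,
      forall f g, H f -> H g -> ip g f = conjc (ip f g),
      forall f, H f -> 0 <= ip f f &
      forall f, H f -> ip f f = 0 -> f = fun=> 0].

Definition ip_norm ip (f : X -> R[i]) : R := Num.sqrt (complex.Re (ip f f)).

Definition ip_complete H ip : Prop :=
  forall u : nat -> X -> R[i], (forall k, H (u k)) ->
    (forall e : R, 0 < e -> exists N : nat, forall k l : nat,
       (N <= k)%N -> (N <= l)%N -> ip_norm ip (fun x => u k x - u l x) < e) ->
    exists2 f, H f &
      forall e : R, 0 < e -> exists N : nat, forall k : nat,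
        (N <= k)%N -> ip_norm ip (fun x => u k x - f x) < e.

Definition hilbert_space H ip : Prop :=
  [/\ linear_subspace H, inner_product H ip & ip_complete H ip].

(* A Hilbert space of functions on which point evaluations are bounded. *)
Definition rkhs H ip : Prop :=
  hilbert_space H ip /\
  forall x, exists M : R, forall f, H f -> `|f x| <= (M * ip_norm ip f)%:C.

Definition reproducing_kernel H ip K : Prop :=
  forall w, H (K^~ w) /\ forall f, H f -> ip f (K^~ w) = f w.

End function_spaces.

Section theta_functions.
Context {R : realType} {n : nat}.
Variables (nu : R) (G : set 'rV[R[i]]_n) (chi : 'rV[R[i]]_n -> R[i]).

(* The values of [chi] outside [G] are irrelevant. *)
Definition pseudocharacter : Prop :=
  (forall g, G g -> `|chi g| = 1) /\
  (forall g1 g2, G g1 -> G g2 ->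
     chi (g1 + g2) = chi g1 * chi g2 * cexp ('i * (nu * omega g1 g2)%:C)).

Definition theta_space : set ('rV[R[i]]_n -> R[i]) :=
  [set g | holomorphic g /\
     forall z gam, G gam ->
       g (z + gam) =
         chi gam * cexp ((nu / 2)%:C * hdot gam gam + nu%:C * hdot z gam)
         * g z].

Definition theta_integrand (g1 g2 : 'rV[R[i]]_n -> R[i]) (z : 'rV[R[i]]_n) :=
  g1 z * conjc (g2 z) * cexp (- (nu%:C * hdot z z)).

Definition theta_product (L : set 'rV[R[i]]_n) (g1 g2 : 'rV[R[i]]_n -> R[i]) :=
  integral_Cn L (theta_integrand g1 g2).

Definition kernel_term (z w gam : 'rV[R[i]]_n) : R[i] :=
  chi gam * cexp (- ((nu / 2)%:C * hdot gam gam)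
                  + nu%:C * (hdot z gam - conjc (hdot w gam))).

Definition theta_kernel (z w : 'rV[R[i]]_n) : R[i] :=
  ((nu / pi) ^+ n)%:C * cexp (nu%:C * hdot z w) * csum G (kernel_term z w).

End theta_functions.

(* Main.v *)
Require Import Defs.
From HB Require Import structures.
From mathcomp Require Import all_boot all_order all_algebra.
From mathcomp Require Import all_classical all_reals all_analysis.
From mathcomp Require Import measurable_realfun complex ring lra.
From mathcomp Require summability finmap.

Set Implicit Arguments.
Unset Strict Implicit.
Unset Printing Implicit Defensive.

Import Order.TTheory GRing.Theory Num.Theory.
Import numFieldNormedType.Exports.

Local Open Scope classical_set_scope.
Local Open Scope ring_scope.
Local Open Scope complex_scope.

(** Why the theorem holds.

The lattice enters only through its Gaussian sums.  Unfolding the integral of a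
Gaussian over C^n along the translates of the fundamental domain L shows that
L has positive volume, that the volume is finite (a full-rank lattice is
cobounded, [lattice_cobounded], so the periodized Gaussian is bounded below) and
that the sum of exp(-b |g|^2) over the lattice converges for every b > 0
([lattice_gauss_summable]).  Hence the series defining the kernel is an
absolutely convergent series of exponentials; it is holomorphic by
[cderivn_expseries], and the pseudocharacter relation turns a translation of the
summation index into the transformation law ([theta_space_kernel]).

For f in the space, |f(z)| exp(-nu |z|^2 / 2) is periodic, hence bounded.  The
integral over L of f times the conjugate of the kernel is therefore absolutely
convergent and unfolds to the integral over C^n of
f(z) exp(nu <w, z> - nu |z|^2).  A translation by w reduces its value to the mean
of a holomorphic function against a centred Gaussian ([gaussian_mean_Re]), which
follows from the invariance under the rotations z |-> e^{i t} z and the one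
variable mean value property; the latter rests on Goursat's theorem for
rectangles, in logarithmic coordinates.  This is [theta_reproducing].

A reproducing kernel makes the form definite and evaluations bounded by
Cauchy-Schwarz alone.  For an orthonormal family f_1, ..., f_m Bessel's
inequality for the function K(., z) reads |f_1(z)|^2 + ... + |f_m(z)|^2 <= K(z, z),
and integrating it against exp(-nu |z|^2) over L bounds m by the trace of the
kernel.  So there is a maximal orthonormal family; it is a basis, the space is
complete because it has finite dimension, Bessel's inequality is an equality and
the dimension equals the trace.

The trace is (nu / pi)^n vol L ([integral_kernel_density]): in
K(z, z) exp(-nu |z|^2) the lattice point g contributes a constant times
exp(2 i nu omega(z, g)), which is a character of the torus because
exp(2 i nu omega) = 1 on the lattice, and the integral of a nontrivial character
over L vanishes.  As this number is positive, the space is nonzero. *)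

Notation cRe := complex.Re.
Notation cIm := complex.Im.
Notation normc := Normc.normc.

(** * Modulus and exponential of a complex number *)

Section complex_modulus.
Context {R : realType}.
Implicit Types (z w : R[i]) (x y : R).

(** The norm of the complex numbers takes complex values; every estimate below is
carried out with the real modulus [normc] instead. *)
Lemma normrcE z : `|z| = (normc z)%:C.
Proof. by case: z => a b; rewrite normc_def. Qed.

Lemma normc_ge0 z : 0 <= normc z.
Proof. by rewrite -ler0c -normrcE normr_ge0. Qed.

Lemma sqr_normcE z : normc z ^+ 2 = cRe z ^+ 2 + cIm z ^+ 2.
Proof. by case: z => a b /=; rewrite sqr_sqrtr // addr_ge0 ?sqr_ge0. Qed.

Lemma cReD z w : cRe (z + w) = cRe z + cRe w. Proof. by case: z w => [? ?] []. Qed.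
Lemma cImD z w : cIm (z + w) = cIm z + cIm w. Proof. by case: z w => [? ?] []. Qed.
Lemma cReN z : cRe (- z) = - cRe z. Proof. by case: z. Qed.
Lemma cImN z : cIm (- z) = - cIm z. Proof. by case: z. Qed.
Lemma cReB z w : cRe (z - w) = cRe z - cRe w. Proof. by rewrite cReD cReN. Qed.
Lemma cImB z w : cIm (z - w) = cIm z - cIm w. Proof. by rewrite cImD cImN. Qed.
Lemma cReM z w : cRe (z * w) = cRe z * cRe w - cIm z * cIm w.
Proof. by case: z w => [? ?] []. Qed.
Lemma cImM z w : cIm (z * w) = cRe z * cIm w + cIm z * cRe w.
Proof. by case: z w => [? ?] []. Qed.
Lemma cReJ z : cRe (conjc z) = cRe z. Proof. by case: z. Qed.
Lemma cImJ z : cIm (conjc z) = - cIm z. Proof. by case: z. Qed.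
Lemma cReZ x z : cRe (x%:C * z) = x * cRe z.
Proof. by rewrite cReM /= mul0r subr0. Qed.
Lemma cImZ x z : cIm (x%:C * z) = x * cIm z.
Proof. by rewrite cImM /= mul0r addr0. Qed.

Lemma conjcM z w : conjc (z * w) = conjc z * conjc w.
Proof. exact: rmorphM. Qed.

(** Splits an identity between complex numbers into two real ones. *)
Definition cReIm := (cReD, cImD, cReN, cImN, cReM, cImM, cReJ, cImJ).

Lemma eqcP z w : cRe z = cRe w -> cIm z = cIm w -> z = w.
Proof. by case: z w => [a b] [c d] /= -> ->. Qed.

Lemma cRe_sum I (r : seq I) (P : pred I) (f : I -> R[i]) :
  cRe (\sum_(i <- r | P i) f i) = \sum_(i <- r | P i) cRe (f i).
Proof. exact: (big_morph _ cReD erefl). Qed.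

Lemma cIm_sum I (r : seq I) (P : pred I) (f : I -> R[i]) :
  cIm (\sum_(i <- r | P i) f i) = \sum_(i <- r | P i) cIm (f i).
Proof. exact: (big_morph _ cImD erefl). Qed.

Lemma ler_normc_sum I (r : seq I) (P : pred I) (f : I -> R[i]) :
  normc (\sum_(i <- r | P i) f i) <= \sum_(i <- r | P i) normc (f i).
Proof.
elim/big_rec2: _ => [|i x z _ h]; first by rewrite Normc.normc0.
by apply: (le_trans (le_normcD _ _)); rewrite lerD2l.
Qed.

Lemma normcJE z : normc (conjc z) = normc z.
Proof. by case: z => a b /=; rewrite sqrrN. Qed.

Lemma normcCE x : normc x%:C = `|x|.
Proof. by rewrite /= expr0n /= addr0 sqrtr_sqr. Qed.

Lemma normc_Re z : `|cRe z| <= normc z.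
Proof.
by rewrite -(@ler_pXn2r _ 2) ?nnegrE ?normc_ge0// sqr_normcE real_normK ?num_real //
  lerDl sqr_ge0.
Qed.

Lemma normc_Im z : `|cIm z| <= normc z.
Proof.
by rewrite -(@ler_pXn2r _ 2) ?nnegrE ?normc_ge0// sqr_normcE real_normK ?num_real //
  lerDr sqr_ge0.
Qed.

Lemma normc_leD z : normc z <= `|cRe z| + `|cIm z|.
Proof.
rewrite -(@ler_pXn2r _ 2) ?nnegrE ?normc_ge0 ?addr_ge0// sqr_normcE sqrrD.
rewrite !real_normK ?num_real // lerD2r lerDl.
by rewrite mulrn_wge0// mulr_ge0.
Qed.

Lemma normcBC z w : normc (z - w) = normc (w - z).
Proof. by rewrite -normcN opprB. Qed.

Lemma mulcJ_normc z : z * conjc z = (normc z ^+ 2)%:C.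
Proof.
rewrite sqr_normcE; apply: eqcP; rewrite cReIm; case: z => a b /=; ring.
Qed.

Lemma mulcJ_unit z : normc z = 1 -> z * conjc z = 1.
Proof. by move=> z1; rewrite mulcJ_normc z1 expr1n. Qed.

End complex_modulus.

Section complex_exponential.
Context {R : realType}.
Implicit Types (z w : R[i]) (x y : R).

Lemma cexpD z w : cexp (z + w) = cexp z * cexp w.
Proof.
rewrite /cexp !cReIm expRD cosD sinD; apply: eqcP; rewrite !cReIm /=; ring.
Qed.

Lemma cexp0 : cexp 0 = 1 :> R[i].
Proof. by rewrite /cexp /= expR0 cos0 sin0 mul1r. Qed.

Lemma cexpNK z : cexp (- z) * cexp z = 1.
Proof. by rewrite -cexpD addNr cexp0. Qed.

Lemma cexpJ z : cexp (conjc z) = conjc (cexp z).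
Proof.
rewrite /cexp cReJ cImJ cosN sinN; apply: eqcP; rewrite !cReIm /=; ring.
Qed.

Lemma cexp_real x : cexp x%:C = (expR x)%:C.
Proof. by rewrite /cexp /= cos0 sin0 mulr1. Qed.

Lemma normc_cexp z : normc (cexp z) = expR (cRe z).
Proof.
rewrite /cexp Normc.normcM normcCE (ger0_norm (expR_ge0 _)) /= cos2Dsin2 sqrtr1.
by rewrite mulr1.
Qed.

Lemma sin_le_id y : `|sin y| <= `|y|.
Proof.
wlog y0 : y / 0 <= y => [wl|].
  have [|/ltW y0] := leP 0 y; first exact: wl.
  by have := wl (- y); rewrite sinN !normrN oppr_ge0; apply.
have [c cy ceq] : exists2 c, c \in `[0, y] & sin y = cos c * y.
  have := @MVT_segment R sin cos 0 y y0; rewrite sin0 !subr0; apply.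
  by apply: continuous_subspaceT; exact: continuous_sin.
by rewrite ceq normrM ler_piMl ?cos_max.
Qed.

Lemma cosB1 y : cos y - 1 = - 2 * sin (y / 2) ^+ 2.
Proof. by rewrite {1}(_ : y = (y / 2) *+ 2) ?cos_mulr2n ?cos2sin2; lra. Qed.

Lemma cosB1_le y : `|cos y - 1| <= y ^+ 2.
Proof.
rewrite cosB1 normrM normrN normrX.
have := sin_le_id (y / 2); rewrite normrM (@ger0_norm _ 2^-1) // => h.
rewrite (@ger0_norm _ 2) // -[y ^+ 2]real_normK ?num_real //.
have := normr_ge0 (sin (y/2)); nra.
Qed.

Lemma cosB1_le1 y : `|cos y - 1| <= `|y|.
Proof.
rewrite cosB1 normrM normrN normrX.
have := sin_le_id (y / 2); rewrite normrM (@ger0_norm _ 2^-1) // => h.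
rewrite (@ger0_norm _ 2) //.
have := normr_ge0 (sin (y/2)); have := sin_max (y / 2); nra.
Qed.

Lemma sinB_le y : `|sin y - y| <= y ^+ 2.
Proof.
wlog y0 : y / 0 <= y => [wl|].
  have [|/ltW y0] := leP 0 y; first exact: wl.
  by have := wl (- y); rewrite sinN sqrrN -opprD normrN oppr_ge0; apply.
have [c cy ceq] : exists2 c, c \in `[0, y] & sin y = cos c * y.
  have := @MVT_segment R sin cos 0 y y0; rewrite sin0 !subr0; apply.
  by apply: continuous_subspaceT; exact: continuous_sin.
move: cy; rewrite in_itv /= => /andP[c0 cy].
rewrite ceq; have -> : cos c * y - y = (cos c - 1) * y by ring.
rewrite normrM (ger0_norm y0) expr2 ler_wpM2r //.
by apply: (le_trans (cosB1_le1 c)); rewrite ger0_norm.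
Qed.

Lemma expRB1_le x : `|expR x - 1| <= `|x| * expR `|x|.
Proof.
have h1 := expR_ge1Dx x; have h2 := expR_ge1Dx (- x).
have e0 := expR_gt0 x.
have h3 : expR x - 1 <= x * expR x.
  have : expR x * (1 + - x) <= expR x * expR (- x) by rewrite ler_pM2l.
  rewrite -expRD subrr expR0; lra.
have [x0|x0] := leP 0 x.
  rewrite !ger0_norm //; lra.
rewrite !ltr0_norm //; last by rewrite subr_lt0 -expR0 ltr_expR.
have : 1 <= expR (- x) by rewrite -[leLHS]expR0 ler_expR; lra.
have := expR_gt0 (- x); nra.
Qed.

Lemma expRB1B_le x : `|expR x - 1 - x| <= x ^+ 2 * expR `|x|.
Proof.
have h1 := expR_ge1Dx x; have h2 := expR_ge1Dx (- x).
have e0 := expR_gt0 x.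
have h3 : expR x - 1 <= x * expR x.
  have : expR x * (1 + - x) <= expR x * expR (- x) by rewrite ler_pM2l.
  rewrite -expRD subrr expR0; lra.
rewrite ger0_norm; last lra.
apply: (@le_trans _ _ (x * (expR x - 1))); first lra.
apply: (le_trans (ler_norm _)); rewrite normrM -[x ^+ 2]real_normK ?num_real //.
by rewrite expr2 -mulrA ler_wpM2l // expRB1_le.
Qed.

(** Every complex derivative of an exponential below comes from this bound on
the second order remainder. *)
Lemma cexp_taylor z :
  normc (cexp z - 1 - z) <= 4 * normc z ^+ 2 * expR (normc z).
Proof.
case: z => x y; set z := x +i* y; set N := normc z.
have hx : `|x| <= N := normc_Re z.
have hy : `|y| <= N := normc_Im z.
have N0 : 0 <= N := normc_ge0 z.
have eN : expR `|x| <= expR N by rewrite ler_expR.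
have eN1 : 1 <= expR N by rewrite -[leLHS]expR0 ler_expR.
have ex : expR x <= expR N by rewrite ler_expR (le_trans (ler_norm x)).
have -> : cexp z - 1 - z = (expR x * (cos y - 1) + (expR x - 1 - x))
    +i* ((expR x - 1) * sin y + (sin y - y)).
  by rewrite /cexp; apply: eqcP; rewrite !cReIm /=; ring.
apply: (le_trans (normc_leD _)) => /=.
have y2 : y ^+ 2 <= N ^+ 2.
  by rewrite -[y ^+ 2]real_normK ?num_real // ler_pXn2r ?nnegrE.
have x2 : x ^+ 2 <= N ^+ 2.
  by rewrite -[x ^+ 2]real_normK ?num_real // ler_pXn2r ?nnegrE.
have A1 : `|expR x * (cos y - 1)| <= N ^+ 2 * expR N.
  rewrite normrM (ger0_norm (expR_ge0 _)) mulrC.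
  by rewrite ler_pM // ?expR_ge0 // (le_trans (cosB1_le y)).
have A2 : `|expR x - 1 - x| <= N ^+ 2 * expR N.
  by apply: (le_trans (expRB1B_le x)); rewrite ler_pM ?sqr_ge0 ?expR_ge0.
have A3 : `|(expR x - 1) * sin y| <= N ^+ 2 * expR N.
  rewrite normrM expr2 -mulrA mulrCA mulrC [leRHS]mulrC.
  rewrite -mulrA [leRHS]mulrC -mulrA.
  rewrite [leRHS](_ : _ = N * (N * expR N)); last by ring.
  apply: ler_pM => //; first exact: (le_trans (sin_le_id y)).
  by apply: (le_trans (expRB1_le x)); rewrite ler_pM ?expR_ge0.
have A4 : `|sin y - y| <= N ^+ 2 * expR N.
  apply: (le_trans (sinB_le y)); apply: (le_trans y2).
  by rewrite ler_peMr // sqr_ge0.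
have B1 := ler_normD (expR x * (cos y - 1)) (expR x - 1 - x).
have B2 := ler_normD ((expR x - 1) * sin y) (sin y - y).
lra.
Qed.

End complex_exponential.

(** * Measure-preserving maps of C^n *)

Section preserving.
Local Open Scope ereal_scope.
Context {R : realType}.

Definition preserving d (T : measurableType d)
    (m : {measure set T -> \bar R}) (f : T -> T) : Prop :=
  measurable_fun setT f /\ forall A, measurable A -> m (f @^-1` A) = m A.

Lemma preserving_comp d (T : measurableType d) (m : {measure set T -> \bar R})
  (f g : T -> T) : preserving m f -> preserving m g -> preserving m (f \o g).
Proof.
move=> [mf pf] [mg pg]; split; first exact: measurableT_comp.
move=> A mA; rewrite comp_preimage pg ?pf //.
by rewrite -[X in measurable X]setTI; exact: mf.
Qed.

Lemma ge0_integral_preserving d (T : measurableType d)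
    (m : {measure set T -> \bar R}) (f : T -> T) (D : set T) (h : T -> \bar R) :
  preserving m f -> measurable D -> measurable_fun D h ->
  {in D, forall y, 0 <= h y} ->
  \int[m]_(x in f @^-1` D) h (f x) = \int[m]_(x in D) h x.
Proof.
move=> [mf pf] mD mh h0.
rewrite -(ge0_integral_pushforward mf m mD mh h0).
by apply: eq_measure_integral => A mA _; rewrite /= /pushforward pf.
Qed.

Lemma integral_preserving d (T : measurableType d)
    (m : {measure set T -> \bar R}) (f : T -> T) (D : set T) (h : T -> \bar R) :
  preserving m f -> measurable D -> measurable_fun D h ->
  \int[m]_(x in f @^-1` D) h (f x) = \int[m]_(x in D) h x.
Proof.
move=> pf mD mh; rewrite integralE [RHS]integralE; congr (_ - _).
  rewrite -(ge0_integral_preserving pf mD (measurable_funepos mh)) //.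
  by apply: eq_integral => x _; rewrite !unlock.
rewrite -(ge0_integral_preserving pf mD (measurable_funeneg mh)) //.
by apply: eq_integral => x _; rewrite !unlock.
Qed.

Lemma preserving_prod d1 d2 (T1 : measurableType d1) (T2 : measurableType d2)
    (m1 : {measure set T1 -> \bar R})
    (m2 : {sigma_finite_measure set T2 -> \bar R}) (f1 : T1 -> T1) (f2 : T2 -> T2) :
  preserving m1 f1 -> preserving m2 f2 ->
  preserving (m1 \x m2) (fun p => (f1 p.1, f2 p.2)).
Proof.
move=> [mf1 pf1] [mf2 pf2]; set f := fun p => _.
have mf : measurable_fun setT f.
  by apply: measurable_fun_pair; apply: measurableT_comp.
split=> // A mA.
rewrite /= /product_measure1.
rewrite -[RHS](ge0_integral_preserving (conj mf1 pf1)) //; last first.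
  exact: measurable_fun_xsection.
rewrite preimage_setT; apply: eq_integral => x _ /=.
rewrite -(pf2 _ (measurable_xsection _ mA)) /=.
by congr (m2 _); apply/seteqP; split=> y; rewrite /xsection /= !inE.
Qed.

End preserving.

Section plane.
Local Open Scope ereal_scope.
Context {R : realType}.
Local Notation mR := (measurableTypeR R).
Local Notation plane := (mR * mR)%type.
Local Notation leb := (@lebesgue_measure R).

Lemma preserving_shift (c : R) : preserving leb (fun x : mR => (x + c)%R : mR).
Proof.
have mf : measurable_fun setT (fun x : mR => (x + c)%R : mR).
  by apply: measurable_funD => //; exact: measurable_cst.
split=> // A mA; apply/esym.
apply: (@lebesgue_measure_unique _ [the measure _ _ of pushforward leb (fun x : mR => (x + c)%R : mR)]) => //.
move=> _ [[a b]] _ <-.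
rewrite /= /pushforward.
rewrite (_ : _ @^-1` _ = `](a - c)%R, (b - c)%R]%classic).
  rewrite !lebesgue_measure_itv /= !lte_fin ltrD2r.
  by case: ifP => // _; rewrite -!EFinB; congr (_%:E); ring.
by apply/seteqP; split => x /=; rewrite !in_itv /= ltrBlDr lerBrDr.
Qed.

Lemma preserving_shear2 (h : R -> R) : measurable_fun [set: mR] (h : mR -> mR) ->
  preserving (leb \x leb) (fun p : plane => (p.1, (p.2 + h p.1)%R : mR)).
Proof.
move=> mh; set f := fun p => _.
have mf : measurable_fun setT f.
  apply: measurable_fun_pair => //; apply: measurable_funD => //.
  exact: measurableT_comp.
split=> // A mA; rewrite /product_measure1; apply: eq_integral => x _ /=.
rewrite -((preserving_shift (h x)).2 _ (measurable_xsection x mA)) /=.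
by congr (leb _); apply/seteqP; split=> y; rewrite /xsection /= !inE.
Qed.

(** Lets a planar set be measured by its horizontal sections, as needed for the
shears along the first axis. *)
Lemma lebesgue2E A : measurable A -> (leb \x leb) A = (leb \x^ leb) A.
Proof.
apply: (@product_measure_unique _ _ _ _ _ leb leb
  [the measure _ _ of (leb \x^ leb)]) => B C mB mC.
exact: product_measure2E.
Qed.

Lemma preserving_shear1 (h : R -> R) : measurable_fun [set: mR] (h : mR -> mR) ->
  preserving (leb \x leb) (fun p : plane => ((p.1 + h p.2)%R : mR, p.2)).
Proof.
move=> mh; set f := fun p => _.
have mf : measurable_fun setT f.
  apply: measurable_fun_pair => //; apply: measurable_funD => //.
  exact: measurableT_comp.
split=> // A mA.
have mfA : measurable (f @^-1` A).
  by rewrite -[X in measurable X]setTI; exact: mf.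
rewrite [LHS](lebesgue2E mfA) [RHS](lebesgue2E mA) /product_measure2; apply: eq_integral => x _ /=.
rewrite -((preserving_shift (h x)).2 _ (measurable_ysection x mA)) /=.
by congr (leb _); apply/seteqP; split=> y; rewrite /ysection /= !inE.
Qed.

(** Away from the half turn a rotation is a product of three shears, and the
half turn is the square of a quarter turn. *)
Lemma preserving_rotation (a b : R) : (a ^+ 2 + b ^+ 2 = 1)%R ->
  preserving (leb \x leb)
    (fun p : plane => ((a * p.1 - b * p.2)%R : mR, (b * p.1 + a * p.2)%R : mR)).
Proof.
wlog a1 : a b / (a != -1)%R => [wl ab1|ab1].
  have [/eqP aN1|] := eqVneq a (-1)%R; last by move=> ?; exact: wl.
  have q : preserving (leb \x leb)
    (fun p : plane => ((0 * p.1 - 1 * p.2)%R : mR, (1 * p.1 + 0 * p.2)%R : mR)).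
    apply: wl; last by rewrite expr0n expr1n add0r.
    by rewrite eq_sym oppr_eq0 oner_eq0.
  have -> : (fun p : plane => ((a * p.1 - b * p.2)%R : mR, (b * p.1 + a * p.2)%R : mR))
     = (fun p : plane => ((0 * p.1 - 1 * p.2)%R : mR, (1 * p.1 + 0 * p.2)%R : mR)) \o
      (fun p : plane => ((0 * p.1 - 1 * p.2)%R : mR, (1 * p.1 + 0 * p.2)%R : mR)).
    have b0 : b = 0%R.
      by apply/eqP; rewrite -sqrf_eq0; apply/eqP; move: ab1; rewrite (eqP aN1) => ?; lra.
    apply/funext => p /=; rewrite (eqP aN1) b0; congr (_, _); ring.
  exact: preserving_comp.
have a10 : (1 + a != 0)%R by rewrite addrC addr_eq0.
(* If [a] and [b] are the cosine and the sine of an angle, [t] is minus the tangent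
of its half. *)
pose t := (- b / (1 + a))%R.
have -> : (fun p : plane => ((a * p.1 - b * p.2)%R : mR, (b * p.1 + a * p.2)%R : mR))
   = (fun p : plane => ((p.1 + t * p.2)%R : mR, p.2)) \o
    ((fun p : plane => (p.1, (p.2 + b * p.1)%R : mR)) \o
     (fun p : plane => ((p.1 + t * p.2)%R : mR, p.2))).
  have e1 : (t * b = a - 1)%R.
    rewrite /t mulrAC; apply/(mulIf a10); rewrite divfK //.
    by move: ab1 => ?; lra.
  have e2 : (t + t * (1 + t * b) = - b)%R.
    by rewrite e1 (_ : _ + _ = t * (1 + a))%R; [rewrite divfK|ring].
  apply/funext => -[x y] /=; congr (_, _).
    transitivity (x * (1 + t * b) + y * (t + t * (1 + t * b)))%R; last by ring.
    by rewrite e1 -e1 e2 e1; ring.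
  transitivity (b * x + (1 + t * b) * y)%R; last by ring.
  by rewrite e1; ring.
apply: preserving_comp; first exact: preserving_shear1.
by apply: preserving_comp; [exact: preserving_shear2|exact: preserving_shear1].
Qed.

End plane.

(** * Lebesgue measure on C^n *)

Section tuples.
Local Open Scope ereal_scope.
Context {R : realType}.
Local Notation mR := (measurableTypeR R).
Local Notation plane := (mR * mR)%type.
Local Notation leb := (@lebesgue_measure R).

(** By induction along the iterated product that defines the measure. *)
Lemma preserving_tuple n (f : 'I_n -> plane -> plane) :
  (forall i, preserving (leb \x leb) (f i)) ->
  preserving (@lebesgue_tuple R n)
    (fun t : n.-tuple plane => [tuple f i (tnth t i) | i < n]).
Proof.
elim: n f => [|n IH] f pf.
  split; first by apply/measurable_fun_tnthP => -[].
  move=> A mA; rewrite (_ : (fun t => _) = id) ?preimage_id //.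
  by apply/funext => t; apply: eq_from_tnth => -[].
set F := fun t => _; have mF : measurable_fun setT F.
  apply/measurable_fun_tnthP => i.
  rewrite (_ : _ \o _ = f i \o (fun t => tnth t i)).
    apply: (measurableT_comp (pf i).1).
    exact: measurable_tnth.
  by apply/funext => t /=; rewrite tnth_mktuple.
split=> // A mA; rewrite /= /lebesgue_cons /pushforward.
have p := preserving_prod (pf ord0) (IH (fun i => f (lift ord0 i)) (fun i => pf _)).
pose c (p : plane * n.-tuple plane) : n.+1.-tuple plane :=
  [the n.+1.-tuple plane of p.1 :: p.2].
rewrite -[LHS]/(((leb \x leb) \x lebesgue_tuple n) (c @^-1` (F @^-1` A))).
rewrite -[RHS]/(((leb \x leb) \x lebesgue_tuple n) (c @^-1` A)).
have mc : measurable_fun setT c by exact: measurable_cons.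
have mcA : measurable (c @^-1` A).
  by rewrite -[X in measurable X]setTI; exact: mc.
rewrite -(p.2 _ mcA); congr (_ _); apply/seteqP.
have e x : F (c x) = c (f ord0 x.1, [tuple f (lift ord0 i) (tnth x.2 i) | i < n]).
  apply: eq_from_tnth => i; rewrite tnth_mktuple.
  case: (unliftP ord0 i) => [j ->|->] /=; last by rewrite !tnth0.
  by rewrite !tnthS tnth_mktuple.
by split=> x /=; rewrite e.
Qed.

End tuples.

Section completion.
Local Open Scope ereal_scope.
Context {R : realType} d (T : measurableType d) (m : {measure set T -> \bar R}).
Local Notation cT := (caratheodory_type (m^*)%mu).
Local Notation cm := (@completed_measure_extension _ _ _ m).

(** Sets that need not be measurable are covered, as the completion requires: a
cover of [X] pulls back to a cover of its preimage, and the inverse map gives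
the other inequality. *)
Lemma mu_ext_preserving (f g : T -> T) (X : set T) :
  preserving m f -> preserving m g -> cancel f g -> cancel g f ->
  (m^*)%mu (f @^-1` X) = (m^*)%mu X.
Proof.
have le (h : T -> T) (Y : set T) : preserving m h -> (m^*)%mu (h @^-1` Y) <= (m^*)%mu Y.
  move=> [mh ph]; apply: le_ereal_inf_tmp => _ [A [mA YA] <-].
  apply: ereal_inf_lbound; exists (fun k => h @^-1` A k).
    split=> [i|x /YA [k _ Ak]]; last by exists k.
    by rewrite -[X in measurable X]setTI; exact: mh.
  by apply: eq_eseriesr => k _; rewrite ph.
move=> pf pg fK gK; apply/eqP; rewrite eq_le le //=.
rewrite {1}(_ : X = g @^-1` (f @^-1` X)) ?le //.
by apply/seteqP; split => x /=; rewrite gK.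
Qed.

(** Measurability for the completion means splitting every set additively, a
condition carried over by a bijection that preserves the outer measure. *)
Lemma preserving_completion (f g : T -> T) :
  preserving m f -> preserving m g -> cancel f g -> cancel g f ->
  preserving cm (f : cT -> cT).
Proof.
move=> pf pg fK gK; split; last by move=> A _; exact: (mu_ext_preserving A pf pg fK gK).
move=> _ A mA; rewrite setTI.
have mA' : (m^*)%mu.-caratheodory A := mA.
suff: (m^*)%mu.-caratheodory (f @^-1` A) by [].
move=> X.
have e Y := mu_ext_preserving Y pg pf gK fK.
have gf : g @^-1` (f @^-1` A) = A by apply/seteqP; split => x /=; rewrite gK.
have gfC : g @^-1` (~` (f @^-1` A)) = ~` A by apply/seteqP; split => x /=; rewrite gK.
rewrite -(e X) -(e (X `&` _)) -(e (X `&` ~` _)) !preimage_setI gf gfC; exact: mA'.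
Qed.

Lemma measurable_completion : measurable_fun [set: cT] (id : cT -> T).
Proof.
by move=> _ A mA; rewrite setTI preimage_id; exact: caratheodory_measurable_mu_ext.
Qed.

Lemma measurable_fun_completion d' (U : measurableType d') (D : set T) (f : T -> U) :
  measurable_fun D f -> measurable D -> measurable_fun (D : set cT) (f : cT -> U).
Proof.
move=> mf mD _ A mA; apply: caratheodory_measurable_mu_ext; exact: mf.
Qed.

Lemma ge0_integral_completion (f : T -> \bar R) :
  measurable_fun setT f -> (forall x, 0 <= f x) ->
  \int[cm]_x f x = \int[m]_x f x.
Proof.
move=> mf f0.
have := @ge0_integral_pushforward _ _ cT T R id measurable_completion cm setT f
  measurableT mf (fun x _ => f0 x).
rewrite preimage_setT /= => <-.
apply: eq_measure_integral; first exact: measurable_completion.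
by move=> mid A mA _; exact: (measurable_mu_extE m mA).
Qed.

End completion.

(** * Coordinates on C^n *)

Section coordinates.
Context {R : realType}.
Local Notation mR := (measurableTypeR R).
Local Notation plane := (mR * mR)%type.
Local Notation C := R[i].
Implicit Types (n : nat).

Definition Cn_tuple n (z : 'rV[C]_n) : n.-tuple plane :=
  [tuple (cRe (z 0 i) : mR, cIm (z 0 i) : mR) | i < n].

Lemma tuple_CnK n : cancel (@tuple_Cn R n) (@Cn_tuple n).
Proof.
by move=> t; apply: eq_from_tnth => i; rewrite tnth_mktuple mxE /=; case: (tnth t i).
Qed.

Definition shiftT n (a : 'rV[C]_n) (t : n.-tuple plane) : n.-tuple plane :=
  [tuple ((tnth t i).1 + cRe (a 0 i) : mR, (tnth t i).2 + cIm (a 0 i) : mR) | i < n].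

Definition rotT n (c : C) (t : n.-tuple plane) : n.-tuple plane :=
  [tuple (cRe c * (tnth t i).1 - cIm c * (tnth t i).2 : mR,
          cIm c * (tnth t i).1 + cRe c * (tnth t i).2 : mR) | i < n].

Lemma tuple_Cn_shift n a t : tuple_Cn (@shiftT n a t) = tuple_Cn t + a.
Proof.
apply/rowP => i; rewrite !mxE tnth_mktuple /=.
by apply: eqcP; rewrite !cReIm.
Qed.

Lemma tuple_Cn_rot n c t : tuple_Cn (@rotT n c t) = c *: tuple_Cn t.
Proof.
apply/rowP => i; rewrite !mxE tnth_mktuple /=.
by apply: eqcP; rewrite !cReIm /=; ring.
Qed.

Lemma shiftTK n (a : 'rV_n) : cancel (shiftT a) (shiftT (- a)).
Proof.
by move=> t; apply: (can_inj (@tuple_CnK n)); rewrite !tuple_Cn_shift addrK.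
Qed.

Lemma preserving_shiftT n (a : 'rV_n) : preserving (@lebesgue_tuple R n) (shiftT a).
Proof.
apply: (preserving_tuple (f := fun i p => (p.1 + cRe (a 0 i) : mR, p.2 + cIm (a 0 i) : mR))).
by move=> i; exact: (preserving_prod (preserving_shift _) (preserving_shift _)).
Qed.

Lemma preserving_rotT n (c : C) : normc c = 1 ->
  preserving (@lebesgue_tuple R n) (@rotT n c).
Proof.
move=> c1; apply: (preserving_tuple (f := fun i p => (cRe c * p.1 - cIm c * p.2 : mR,
          cIm c * p.1 + cRe c * p.2 : mR))) => i.
by apply: preserving_rotation; rewrite -sqr_normcE c1 expr1n.
Qed.

Lemma preserving_shift_Cn n (a : 'rV_n) : preserving (@lebesgue_Cn R n) (shiftT a).
Proof.
apply: (preserving_completion (g := shiftT (- a))); try exact: preserving_shiftT.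
  exact: shiftTK.
by rewrite -{2}(opprK a); exact: shiftTK.
Qed.

End coordinates.

Section continuity_measurability.
Context {R : realType}.
Local Notation C := R[i].

(** Continuity for the sup distance of C^n, with real radii. *)
Definition ccont n (f : 'rV[C]_n -> R) : Prop :=
  forall (z : 'rV[C]_n) (e : R), 0 < e -> exists2 d : R, 0 < d &
    forall w : 'rV[C]_n, (forall i, normc (w 0 i - z 0 i) < d) -> `|f w - f z| < e.

Let grid (N : nat) (x : R) : R := (Num.floor (x * N.+1%:R))%:~R / N.+1%:R.

Let gridP N x : `|grid N x - x| <= N.+1%:R^-1.
Proof.
have N0 : 0 < N.+1%:R :> R by rewrite ltr0n.
have h1 := floor_le (x * N.+1%:R); have h2 := floorD1_gt (x * N.+1%:R).
have -> : grid N x - x = ((Num.floor (x * N.+1%:R))%:~R - x * N.+1%:R) / N.+1%:R.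
  by rewrite mulrBl mulfK ?gt_eqF.
have NV : 0 <= N.+1%:R^-1 :> R by rewrite invr_ge0 ltW.
rewrite normrM (ger0_norm NV); apply: ler_piMl => //.
by rewrite ler_norml; rewrite intrD1 in h2; apply/andP; split; lra.
Qed.

(** A continuous function of finitely many measurable coordinates is the limit
of its values at grid points, which take countably many values. *)
Lemma measurable_fun_ccont d (T : measurableType d) n (f : 'rV[C]_n -> R)
    (u v : 'I_n -> T -> R) :
  ccont f -> (forall i, measurable_fun setT (u i)) ->
  (forall i, measurable_fun setT (v i)) ->
  measurable_fun setT (fun t => f (\row_i (u i t +i* v i t))).
Proof.
move=> cf mu mv.
apply: (@measurable_fun_cvg _ _ _ setT
  (fun N t => f (\row_i (grid N (u i t) +i* grid N (v i t))))); last first.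
  move=> t _; apply/cvgrPdist_lt => e e0.
  have [d0 d0p H] := cf (\row_i (u i t +i* v i t)) _ e0.
  have [M _ HM] := near_infty_natSinv_lt (PosNum (divr_gt0 d0p (@ltr0n R 2))).
  exists M => // N /= MN; rewrite distrC; apply: H => i; rewrite !mxE.
  apply: (le_lt_trans (normc_leD _)) => /=.
  have h1 := gridP N (u i t); have h2 := gridP N (v i t).
  have h3 := HM _ MN; rewrite /= in h3.
  by rewrite (splitr d0); apply: (le_lt_trans (lerD h1 h2)); rewrite ltrD.
move=> N _ B mB; rewrite setTI.
pose pt (a b : {ffun 'I_n -> int}) : 'rV[C]_n :=
  \row_i (((a i)%:~R / N.+1%:R) +i* ((b i)%:~R / N.+1%:R)).
pose fl (w : 'I_n -> T -> R) t : {ffun 'I_n -> int} :=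
  [ffun i => Num.floor (w i t * N.+1%:R)].
have -> : (fun t => f (\row_i (grid N (u i t) +i* grid N (v i t)))) @^-1` B =
  \bigcup_(ab in [set ab | f (pt ab.1 ab.2) \in B])
     ([set t | fl u t = ab.1] `&` [set t | fl v t = ab.2]).
  have e t : \row_i (grid N (u i t) +i* grid N (v i t)) = pt (fl u t) (fl v t).
    by apply/rowP => i; rewrite !mxE !ffunE.
  apply/seteqP; split=> t /=; rewrite e.
    by move=> Bt; exists (fl u t, fl v t) => //=; exact: mem_set.
  by move=> [[a b] /=] /set_mem Bab [-> ->].
have mfl w (a : {ffun 'I_n -> int}) : (forall i, measurable_fun setT (w i)) ->
    measurable [set t | fl w t = a].
  move=> mw.
  have -> : [set t | fl w t = a] = \bigcap_(i in [set: 'I_n])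
     ((fun t => w i t * N.+1%:R) @^-1` `[(a i)%:~R, (a i + 1)%:~R[%classic).
    apply/seteqP; split=> t /=.
      by move=> <- i _ /=; rewrite in_itv /= ffunE floor_le floorD1_gt.
    move=> h; apply/ffunP => i; rewrite ffunE.
    by apply: floor_def; have := h i I; rewrite /= in_itv.
  apply: fin_bigcap_measurable => // i _.
  rewrite -[X in measurable X]setTI; apply: measurable_funM => //.
rewrite bigcup_mkcond; apply: countable_bigcupT_measurable => // ab.
case: ifP => // _.
by apply: measurableI; exact: mfl.
Qed.

End continuity_measurability.

(** * Unfolding along the lattice, and Gaussian integrals *)

Section unfolding.
Local Open Scope ereal_scope.
Context {R : realType} (n : nat).
Local Notation C := R[i].
Local Notation cT := (caratheodory_type (lebesgue_tuple n)^*%mu).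
Variables (G L : set 'rV[C]_n) (e : nat -> 'rV[C]_n).
Hypotheses (fd : fundamental_domain G L) (einj : injective e)
  (eG : forall g, G g <-> exists k, e k = g).
Let Lam : set cT := @tuple_Cn R n @^-1` L.

Lemma measurable_domain : measurable Lam. Proof. by case: fd. Qed.

(** The space is the disjoint union of the translates of the domain. *)
Lemma integral_unfold (F : cT -> \bar R) :
  measurable_fun setT F -> (forall x, 0 <= F x) ->
  \int[lebesgue_Cn n]_x F x =
  \int[lebesgue_Cn n]_(x in Lam) \sum_(k <oo) F (shiftT (e k) x).
Proof.
move=> mF F0; case: fd => mL covL trivL.
pose D k : set cT := (shiftT (- e k)%R : cT -> cT) @^-1` Lam.
have DE k t : D k t <-> translate L (e k) (tuple_Cn t).
  rewrite /D /Lam /= tuple_Cn_shift; split=> [?|[x Lx <-]].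
    by exists (tuple_Cn t - e k)%R => //; rewrite addrC subrK.
  by rewrite addrC addKr.
have mD k : measurable (D k).
  rewrite -[X in measurable X]setTI.
  exact: (preserving_shift_Cn (- e k)).1.
have UD : \bigcup_k D k = setT.
  apply/seteqP; split=> // t _.
  have : setT (tuple_Cn t) by [].
  by rewrite -covL => -[g /eG[k <-] ?]; exists k => //; apply/DE.
have tD : trivIset setT D.
  move=> i j _ _ [t [/DE ti /DE tj]]; apply: einj; apply: trivL.
  - by apply/eG; exists i.
  - by apply/eG; exists j.
  - by exists (tuple_Cn t).
have pS k := preserving_shift_Cn (e k).
have mFS k : measurable_fun setT (fun x : cT => F (shiftT (e k) x)).
  exact: (measurableT_comp mF (pS k).1).
rewrite -UD ge0_integral_bigcup //; last by rewrite UD.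
have := @integral_nneseries _ _ R (lebesgue_Cn n) Lam (measurable_domain)
  (fun k x => F (shiftT (e k) x)) (fun k => measurable_funTS (mFS k)) (fun k x _ => F0 _).
move=> ->.
apply: eq_eseriesr => k _.
rewrite -(ge0_integral_preserving (pS k) (mD k)) //; last exact: measurable_funTS.
congr (integral _ _ _); apply/seteqP; split => t; rewrite /D /Lam /= !tuple_Cn_shift addrK //.
Qed.

End unfolding.

Section gauss.
Local Open Scope ereal_scope.
Context {R : realType}.
Local Notation mR := (measurableTypeR R).
Local Notation plane := (mR * mR)%type.
Local Notation leb := (@lebesgue_measure R).
Implicit Types b : R.

(** The product of the two Lebesgue measures with its sigma-finite structure, which
Tonelli's theorem needs. *)
Definition leb2 : set plane -> \bar R := leb \x leb.

HB.instance Definition _ := Measure.on leb2.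

HB.instance Definition _ := Measure_isSigmaFinite.Build _ _ _ leb2
  (sigma_finite_product_measure1 (m1 := leb) leb (sigma_finiteT leb)).

(** The normalization of the normal density of variance [1 / (2 b)]. *)
Lemma integral_gauss1 b : (0 < b)%R ->
  \int[leb]_x (expR (- b * x ^+ 2))%:E = (Num.sqrt (pi / b))%:E.
Proof.
move=> b0; pose s := Num.sqrt (2 * b)^-1.
have b20 : (0 < (2 * b)^-1)%R by rewrite invr_gt0 mulr_gt0.
have s2 : (s ^+ 2 = (2 * b)^-1)%R by rewrite sqr_sqrtr // ltW.
have s0 : s != 0%R by rewrite gt_eqF // sqrtr_gt0.
have pk : (s ^+ 2 * pi *+ 2 = pi / b)%R.
  rewrite s2 -mulr_natr invfM; have ? := lt0r_neq0 b0; by field.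
have p0 : (0 < pi / b :> R)%R by rewrite divr_gt0 ?pi_gt0.
have q0 : (0 < Num.sqrt (pi / b) :> R)%R by rewrite sqrtr_gt0.
transitivity (\int[leb]_x ((Num.sqrt (pi / b))%:E * (normal_pdf 0%R s x)%:E)).
  apply: eq_integral => x _.
  rewrite -EFinM normal_pdfE // /normal_peak pk mulVKf ?gt_eqF //.
  rewrite /normal_fun subr0 s2; congr (expR _)%:E.
  rewrite -mulr_natr; have ? := lt0r_neq0 b0; by field.
rewrite ge0_integralZl //.
- by rewrite integral_normal_pdf mule1.
- by apply/measurable_EFinP; exact: measurable_normal_pdf.
- by move=> x _; rewrite lee_fin normal_pdf_ge0.
Qed.

Definition nrm2T n (t : n.-tuple plane) : R :=
  (\sum_(i < n) ((tnth t i).1 ^+ 2 + (tnth t i).2 ^+ 2))%R.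

Definition gaussT b n (t : n.-tuple plane) : R := expR (- b * nrm2T t).

Lemma measurable_nrm2T n : measurable_fun setT (@nrm2T n).
Proof.
apply: measurable_sum => i; apply: measurable_funD; apply: measurable_funX.
  by apply: measurableT_comp => //; exact: measurable_tnth.
by apply: measurableT_comp => //; exact: measurable_tnth.
Qed.

Lemma measurable_gaussT b n : measurable_fun setT (@gaussT b n).
Proof.
apply: measurableT_comp => //; apply: measurable_funM => //.
exact: measurable_nrm2T.
Qed.

Lemma measurable_gauss2 b :
  measurable_fun setT (fun p : plane => expR (- b * (p.1 ^+ 2 + p.2 ^+ 2))%R).
Proof.
apply: measurableT_comp => //; apply: measurable_funM => //.
by apply: measurable_funD; apply: measurable_funX.
Qed.

Lemma integral_gauss2 b : (0 < b)%R ->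
  \int[leb \x leb]_p (expR (- b * (p.1 ^+ 2 + p.2 ^+ 2)))%:E = (pi / b)%:E.
Proof.
move=> b0; rewrite fubini_tonelli1 //=; first last.
  by apply/measurable_EFinP; exact: measurable_gauss2.
rewrite /fubini_F /=.
have m1 : measurable_fun setT (fun x : mR => (expR (- b * x ^+ 2))%:E).
  apply/measurable_EFinP; apply: measurableT_comp => //.
  by apply: measurable_funM => //; exact: measurable_funX.
transitivity (\int[leb]_x ((expR (- b * x ^+ 2))%:E * (Num.sqrt (pi / b))%:E)).
  apply: eq_integral => x _; rewrite -integral_gauss1 // -ge0_integralZl //.
  by apply: eq_integral => y _; rewrite -EFinM mulrDr expRD.
rewrite ge0_integralZr //.
by rewrite integral_gauss1 // -EFinM -expr2 sqr_sqrtr // divr_ge0 ?pi_ge0 ?ltW.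
Qed.

Lemma integral_gaussT b n : (0 < b)%R ->
  \int[lebesgue_tuple n]_t (gaussT b t)%:E = ((pi / b) ^+ n)%:E.
Proof.
move=> b0; have pb0 : (0 <= pi / b :> R)%R by rewrite divr_ge0 ?pi_ge0 ?ltW.
elim: n => [|n IH].
  rewrite (@eq_integral _ _ _ _ _ (cst 1)); last first.
    by move=> t _; rewrite /gaussT /nrm2T big_ord0 mulr0 expR0.
  rewrite integral_cst // mul1e; exact: diracT.
pose c (p : plane * n.-tuple plane) : n.+1.-tuple plane :=
  [the n.+1.-tuple plane of p.1 :: p.2].
have mc : measurable_fun setT c by exact: measurable_cons.
rewrite -[LHS]/(\int[pushforward ((leb \x leb) \x lebesgue_tuple n) c]_t (gaussT b t)%:E).
have mg : measurable_fun setT (fun t : n.+1.-tuple plane => (gaussT b t)%:E).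
  by apply/measurable_EFinP; exact: measurable_gaussT.
have g0 m (t : m.-tuple plane) : 0 <= (gaussT b t)%:E by rewrite lee_fin expR_ge0.
rewrite (@ge0_integral_pushforward _ _ _ _ _ c mc _ _ _ measurableT mg (fun t _ => g0 _ t)).
rewrite preimage_setT.
have := @fubini_tonelli1 _ _ _ _ R leb2 (lebesgue_tuple n)
  _ (measurableT_comp mg mc) (fun x => g0 _ (c x)).
rewrite -[X in X = _ -> _]/(\int[(leb \x leb) \x lebesgue_tuple n]_x
  ((fun t => (gaussT b t)%:E) \o c) x) => ->.
rewrite /fubini_F.
transitivity (\int[leb \x leb]_p ((expR (- b * (p.1 ^+ 2 + p.2 ^+ 2)))%:E *
    ((pi / b) ^+ n)%:E)).
  apply: eq_integral => p _; rewrite -IH -ge0_integralZl //.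
  - apply: eq_integral => t _; rewrite -EFinM /= /gaussT -expRD -mulrDr.
    congr (expR (_ * _))%:E; rewrite /nrm2T big_ord_recl tnth0; congr (_ + _)%R.
    by apply: eq_bigr => i _; rewrite tnthS.
  - by apply/measurable_EFinP; exact: measurable_gaussT.
rewrite ge0_integralZr //.
- by rewrite integral_gauss2 // -EFinM exprS.
- by apply/measurable_EFinP; exact: measurable_gauss2.
- by rewrite lee_fin exprn_ge0.
Qed.

End gauss.

(** * Cauchy's theorem on rectangles and the mean value property *)

Section segment_integral.
Context {R : realType}.
Local Notation leb := (@lebesgue_measure R).

Definition segint (f : R -> R) (a b : R) : R := \int[leb]_(x in `[a, b]) f x.

Lemma segment_integrable (f : R -> R) (a b : R) : continuous f ->
  leb.-integrable `[a, b] (EFin \o f).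
Proof.
move=> cf; apply: continuous_compact_integrable; first exact: segment_compact.
exact: continuous_subspaceT.
Qed.

Lemma segintB (f g : R -> R) a b : continuous f -> continuous g ->
  segint (fun x => f x - g x) a b = segint f a b - segint g a b.
Proof.
by move=> cf cg; rewrite /segint RintegralB //; exact: segment_integrable.
Qed.

Lemma segint_split (f : R -> R) a b c : continuous f -> a <= b -> b <= c ->
  segint f a c = segint f a b + segint f b c.
Proof.
move=> cf ab bc; rewrite /segint -[in RHS](Rintegral_itv_obnd_cbnd (r := b)).
  rewrite -(@Rintegral_itvB _ f (BLeft a) (BRight c) b) ?bnd_simp //.
    by rewrite addrC subrK.
  exact: segment_integrable.
apply: integrableS (segment_integrable b c cf) => //.
by apply: subset_itvr; rewrite bnd_simp.
Qed.

Lemma segint_cst (r : R) a b : a <= b -> segint (fun=> r) a b = r * (b - a).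
Proof.
move=> ab; rewrite /segint Rintegral_cst //= lebesgue_measure_itv /= lte_fin.
by move: ab; rewrite le_eqVlt => /predU1P[->|->] //; rewrite ltxx subrr.
Qed.

Lemma segint_near (f : R -> R) a b c M : continuous f -> a <= b ->
  (forall x, a <= x <= b -> `|f x - c| <= M) ->
  `|segint f a b - c * (b - a)| <= M * (b - a).
Proof.
move=> cf ab H.
have cst (r : R) : continuous (fun _ : R => r) by move=> ?; exact: cvg_cst.
have cc := cst c.
rewrite -segint_cst // -segintB //.
have cd : continuous (fun x => f x - c) by move=> x; apply: cvgB; [exact: cf|exact: cvg_cst].
apply: (le_trans (le_normr_Rintegral _ (segment_integrable _ _ cd))) => //.
rewrite -segint_cst //; apply: le_Rintegral => //.
- apply: (segment_integrable (f := fun x => `|f x - c|)).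
  by move=> x; apply: cvg_norm; exact: cd.
- exact: (segment_integrable (f := fun=> M) _ _ (cst M)).
Qed.

End segment_integral.

Section goursat.
Context {R : realType}.
Variables u v : R -> R -> R.

(** The system u_x = v_y between two functions differentiable at every point,
with no regularity of the partial derivatives. *)
Hypothesis uv_diff : forall x y, exists a b c : R, forall e, 0 < e ->
  exists2 d, 0 < d & forall h k : R, `|h| < d -> `|k| < d ->
  `|u (x + h) (y + k) - u x y - (a * h + b * k)| <= e * (`|h| + `|k|) /\
  `|v (x + h) (y + k) - v x y - (c * h + a * k)| <= e * (`|h| + `|k|).

Let uv_cont x y e : 0 < e -> exists2 d : R, 0 < d & forall h k : R,
  `|h| < d -> `|k| < d -> `|u (x + h) (y + k) - u x y| < e /\
  `|v (x + h) (y + k) - v x y| < e.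
Proof.
move=> e0; have [a [b [c H]]] := uv_diff x y.
have [d d0 Hd] := H 1 ltr01.
pose K := `|a| + `|b| + `|c| + 2.
have K0 : 0 < K by rewrite /K; have := normr_ge0 a; have := normr_ge0 b; have := normr_ge0 c; lra.
exists (Num.min d (e / (2 * K))).
  by rewrite lt_min d0 divr_gt0 // mulr_gt0.
move=> h k; rewrite !lt_min => /andP[hd he] /andP[kd ke].
have [Hu Hv] := Hd h k hd kd.
have hk : (`|h| + `|k|) * K < e.
  by rewrite -ltr_pdivlMr //; move: he ke; rewrite invfM; lra.
have bd (p q w : R) : `|p| + `|q| + 1 <= K -> `|w - (p * h + q * k)| <= 1 * (`|h| + `|k|) ->
    `|w| < e.
  move=> pqK Hw; apply: le_lt_trans hk.
  have h1 : `|w| <= `|w - (p * h + q * k)| + `|p * h + q * k|.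
    by rewrite -{1}(subrK (p * h + q * k) w) ler_normD.
  have h2 := ler_normD (p * h) (q * k).
  rewrite !normrM in h2.
  have := normr_ge0 h; have := normr_ge0 k; have := normr_ge0 p; have := normr_ge0 q.
  move: (`|p|) (`|q|) (`|h|) (`|k|) pqK Hw h1 h2 => P Q A B pqK Hw h1 h2 Q0 P0 B0 A0.
  have : (A + B) * (P + Q + 1) <= (A + B) * K by rewrite ler_wpM2l // addr_ge0.
  have := mulr_ge0 P0 B0; have := mulr_ge0 Q0 A0; lra.
split; [apply: bd Hu|apply: bd Hv]; rewrite /K;
  have := normr_ge0 a; have := normr_ge0 b; have := normr_ge0 c; lra.
Qed.

Let cvg_of (f : R -> R) x : (forall e, 0 < e -> exists2 d : R, 0 < d &
   forall h, `|h| < d -> `|f (x + h) - f x| < e) -> {for x, continuous f}.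
Proof.
move=> H; apply/cvgrPdist_lt => e e0; have [d d0 Hd] := H _ e0.
near=> t; rewrite distrC; have := Hd (t - x); rewrite (addrC x) subrK; apply.
by near: t; apply/nbhs_ballP; exists d => //= t; rewrite /ball /= distrC.
Unshelve. all: by end_near. Qed.

Let cv1 y : continuous (v^~ y).
Proof.
move=> x; apply: cvg_of => e e0; have [d d0 H] := uv_cont x y e0.
by exists d => // h hd; have := H h 0 hd; rewrite normr0 addr0 => /(_ d0)[].
Qed.
Let cu2 x : continuous (u x).
Proof.
move=> y; apply: cvg_of => e e0; have [d d0 H] := uv_cont x y e0.
by exists d => // h hd; have := H 0 h; rewrite normr0 addr0 => /(_ d0 hd)[].
Qed.
(** The imaginary part of the integral of [u + i v] along the boundary of a
rectangle. *)
Definition boundary_integral x0 x1 y0 y1 : R :=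
  segint (fun x => v x y0 - v x y1) x0 x1 + segint (fun y => u x1 y - u x0 y) y0 y1.

Local Notation J := boundary_integral.

Let cvB y0 y1 : continuous (fun x => v x y0 - v x y1).
Proof. by move=> x; apply: cvgB; exact: cv1. Qed.
Let cuB x0 x1 : continuous (fun y => u x1 y - u x0 y).
Proof. by move=> x; apply: cvgB; exact: cu2. Qed.

Let J_split1 x0 xm x1 y0 y1 : x0 <= xm -> xm <= x1 ->
  J x0 x1 y0 y1 = J x0 xm y0 y1 + J xm x1 y0 y1.
Proof.
move=> h1 h2; rewrite /J (segint_split (@cvB y0 y1) h1 h2) !segintB //; ring.
Qed.

Let J_split2 x0 x1 y0 ym y1 : y0 <= ym -> ym <= y1 ->
  J x0 x1 y0 y1 = J x0 x1 y0 ym + J x0 x1 ym y1.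
Proof.
move=> h1 h2; rewrite /J (segint_split (@cuB x0 x1) h1 h2).
rewrite (segintB _ _ (@cv1 y0) (@cv1 y1)) (segintB _ _ (@cv1 y0) (@cv1 ym)).
rewrite (segintB _ _ (@cv1 ym) (@cv1 y1)); ring.
Qed.

(** The affine part of [u + i v] at a point has zero boundary integral, so only
the remainder [e] counts. *)
Let J_near X Y a b c e x0 x1 y0 y1 : 0 <= e ->
  x0 <= X <= x1 -> y0 <= Y <= y1 ->
  (forall x y, x0 <= x <= x1 -> y0 <= y <= y1 ->
    `|u x y - u X Y - (a * (x - X) + b * (y - Y))| <= e /\
    `|v x y - v X Y - (c * (x - X) + a * (y - Y))| <= e) ->
  `|J x0 x1 y0 y1| <= 2 * e * ((x1 - x0) + (y1 - y0)).
Proof.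
move=> e0 /andP[hX1 hX2] /andP[hY1 hY2] H.
have x01 : x0 <= x1 by lra.
have y01 : y0 <= y1 by lra.
have h1 : `|segint (fun x => v x y0 - v x y1) x0 x1 - (- a * (y1 - y0)) * (x1 - x0)|
    <= (2 * e) * (x1 - x0).
  apply: segint_near => // x hx.
  have [_ A] := H x y0 hx ltac:(rewrite lexx y01; by []).
  have [_ B] := H x y1 hx ltac:(rewrite lexx y01; by []).
  rewrite (_ : _ - _ - _ = (v x y0 - v X Y - (c * (x - X) + a * (y0 - Y)))
      - (v x y1 - v X Y - (c * (x - X) + a * (y1 - Y)))); last by ring.
  apply: (le_trans (ler_normB _ _)); lra.
have h2 : `|segint (fun y => u x1 y - u x0 y) y0 y1 - (a * (x1 - x0)) * (y1 - y0)|
    <= (2 * e) * (y1 - y0).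
  apply: segint_near => // y hy.
  have [A _] := H x1 y ltac:(rewrite lexx x01; by []) hy.
  have [B _] := H x0 y ltac:(rewrite lexx x01; by []) hy.
  rewrite (_ : _ - _ - _ = (u x1 y - u X Y - (a * (x1 - X) + b * (y - Y)))
      - (u x0 y - u X Y - (a * (x0 - X) + b * (y - Y)))); last by ring.
  apply: (le_trans (ler_normB _ _)); lra.
rewrite /J; set s1 := segint _ _ _ in h1 *; set s2 := segint _ _ _ in h2 *.
rewrite (_ : s1 + s2 = (s1 - (- a * (y1 - y0)) * (x1 - x0)) +
   (s2 - (a * (x1 - x0)) * (y1 - y0))); last by ring.
apply: (le_trans (ler_normD _ _)); lra.
Qed.

Let J_quarter x y w l (c : R) : 0 <= w -> 0 <= l ->
  4 * c <= `|J x (x + 2 * w) y (y + 2 * l)| ->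
  exists p : R * R, [/\ x <= p.1 <= x + w, y <= p.2 <= y + l &
    c <= `|J p.1 (p.1 + w) p.2 (p.2 + l)|].
Proof.
move=> w0 l0.
have xw : x <= x + w by lra.
have xw2 : x + w <= x + 2 * w by lra.
have yl : y <= y + l by lra.
have yl2 : y + l <= y + 2 * l by lra.
rewrite (J_split1 _ _ xw xw2) (J_split2 _ _ yl yl2) (J_split2 _ _ yl yl2).
have -> : x + 2 * w = (x + w) + w by ring.
have -> : y + 2 * l = (y + l) + l by ring.
set j1 := J x (x + w) y (y + l); set j2 := J x (x + w) (y + l) (y + l + l).
set j3 := J (x + w) (x + w + w) y (y + l).
set j4 := J (x + w) (x + w + w) (y + l) (y + l + l) => H.
have [h1|h1] := leP c `|j1|; first by exists (x, y); rewrite /= !lexx xw yl.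
have [h2|h2] := leP c `|j2|; first by exists (x, y + l); rewrite /= !lexx xw yl.
have [h3|h3] := leP c `|j3|; first by exists (x + w, y); rewrite /= !lexx xw yl.
have [h4|h4] := leP c `|j4|; first by exists (x + w, y + l); rewrite /= !lexx xw yl.
have := ler_normD (j1 + j2) (j3 + j4); have := ler_normD j1 j2; have := ler_normD j3 j4.
lra.
Qed.

(** Goursat's argument: were the integral nonzero, quartering would produce
nested rectangles on which it is at least of the order of the area, while at
their common point differentiability makes it of smaller order. *)
Lemma boundary_integral_eq0 x0 y0 w l : 0 <= w -> 0 <= l ->
  boundary_integral x0 (x0 + w) y0 (y0 + l) = 0.
Proof.
move=> w0 l0; apply/eqP; rewrite -normr_eq0 eq_le normr_ge0 andbT leNgt.
apply/negP; set c := `|_| => c0.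
(* Sides of the k-th rectangle, and the lower bound for its integral. *)
pose W k : R := w / 2 ^+ k; pose H k : R := l / 2 ^+ k; pose D k : R := c / 4 ^+ k.
have WS k : W k = 2 * W k.+1 by rewrite /W exprS; field; rewrite expf_neq0 //.
have HS k : H k = 2 * H k.+1 by rewrite /H exprS; field; rewrite expf_neq0 //.
have DS k : D k = 4 * D k.+1 by rewrite /D exprS; field; rewrite expf_neq0 //.
have W0 k : 0 <= W k by rewrite divr_ge0 // exprn_ge0.
have H0 k : 0 <= H k by rewrite divr_ge0 // exprn_ge0.
pose P k (p : R * R) := D k <= `|J p.1 (p.1 + W k) p.2 (p.2 + H k)|.
pose Q k (p q : R * R) := [/\ p.1 <= q.1 <= p.1 + W k.+1, p.2 <= q.2 <= p.2 + H k.+1 & P k.+1 q].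
have /choice[f Hf] : forall kp : nat * (R * R), exists q, P kp.1 kp.2 -> Q kp.1 kp.2 q.
  move=> [k p] /=; have [Pkp|] := pselect (P k p); last by exists p.
  have := Pkp; rewrite /P WS HS DS => /J_quarter[//|//|q [q1 q2 q3]].
  by exists q => _.
pose s := fix s k := if k is k'.+1 then f (k', s k') else (x0, y0).
have Ps k : P k (s k).
  elim: k => [|k /(Hf (k, _)) []] //=.
  by rewrite /P /D /W /H /= !expr0 !divr1.
have Qs k : Q k (s k) (s k.+1) by exact: (Hf (k, s k) (Ps k)).
have mono1 k : (s k).1 <= (s k.+1).1 by have [/andP[]] := Qs k.
have mono2 k : (s k).2 <= (s k.+1).2 by have [_ /andP[]] := Qs k.
have anti1 k : (s k.+1).1 + W k.+1 <= (s k).1 + W k.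
  by have [/andP[_ h] _ _] := Qs k; rewrite (WS k); lra.
have anti2 k : (s k.+1).2 + H k.+1 <= (s k).2 + H k.
  by have [_ /andP[_ h] _] := Qs k; rewrite (HS k); lra.
have nested (a b : nat -> R) : (forall k, a k <= a k.+1) ->
    (forall k, b k.+1 <= b k) -> (forall k, a k <= b k) ->
    exists X, forall k, a k <= X <= b k.
  move=> ma mb ab; exists (sup (range a)) => k.
  have A m k' : a k' <= a (k' + m)%N.
    by elim: m => [|m IH]; rewrite ?addn0 ?addnS //; exact: le_trans (ma _).
  have B m k' : b (k' + m)%N <= b k'.
    by elim: m => [|m IH]; rewrite ?addn0 ?addnS //; apply: le_trans (mb _) _.
  have ub : ubound (range a) (b k).
    move=> _ [m _ <-]; have [km|/ltnW mk] := leqP k m.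
      by apply: (le_trans (ab m)); rewrite -(subnKC km).
    by apply: le_trans (ab k); rewrite -(subnKC mk).
  apply/andP; split.
    by apply: ub_le_sup; [exists (b k)|exists k].
  by apply: ge_sup => //; exists (a k), k.
have [X HX] := nested (fun k => (s k).1) (fun k => (s k).1 + W k) mono1 anti1
   ltac:(move=> k /=; rewrite lerDl; exact: W0).
have [Y HY] := nested (fun k => (s k).2) (fun k => (s k).2 + H k) mono2 anti2
   ltac:(move=> k /=; rewrite lerDl; exact: H0).
have [a [b [c' Hd]]] := uv_diff X Y.
pose K := w + l; have K0 : 0 <= K by rewrite addr_ge0.
(* The upper bound 2 e (w + l)^2 / 4^k is then smaller than c / 4^k. *)
pose e := c / (4 * (K ^+ 2 + 1)).
have K1 : 0 < K ^+ 2 + 1 by rewrite ltr_wpDl // sqr_ge0.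
have e0 : 0 < e by rewrite divr_gt0 // mulr_gt0.
have [d d0 Hdd] := Hd e e0.
have [k Kk] : exists k, K / 2 ^+ k < d.
  have [k _ Hk] := near_infty_natSinv_expn_lt (PosNum (@divr_gt0 _ d (K + 1) d0 ltac:(lra))).
  exists k; have := Hk k (leqnn k); rewrite /= => h.
  have h2 : 0 < 2 ^+ k :> R by rewrite exprn_gt0.
  rewrite ltr_pdivrMr //; move: h; rewrite div1r ltr_pdivlMr; last lra.
  rewrite mulrC ltr_pdivrMr //; lra.
have Wd : W k + H k < d by rewrite /W /H -mulrDl.
have := @J_near X Y a b c' (e * (W k + H k)) (s k).1 ((s k).1 + W k) (s k).2 ((s k).2 + H k).
have eWH : 0 <= e * (W k + H k) by rewrite mulr_ge0 ?addr_ge0 // ltW.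
move=> /(_ eWH (HX k) (HY k)).
have Wk := W0 k; have Hk := H0 k.
move=> N; have {N} : `|J (s k).1 ((s k).1 + W k) (s k).2 ((s k).2 + H k)|
   <= 2 * (e * (W k + H k)) * ((s k).1 + W k - (s k).1 + ((s k).2 + H k - (s k).2)).
  apply: N => x y /andP[x1 x2] /andP[y1 y2].
  have /andP[X1 X2] := HX k; have /andP[Y1 Y2] := HY k.
  have hx : `|x - X| <= W k by rewrite ler_norml; apply/andP; split; lra.
  have hy : `|y - Y| <= H k by rewrite ler_norml; apply/andP; split; lra.
  have [] := Hdd (x - X) (y - Y).
  - by apply: le_lt_trans hx _; apply: le_lt_trans Wd; rewrite lerDl.
  - by apply: le_lt_trans hy _; apply: le_lt_trans Wd; rewrite lerDr.
  rewrite !(addrC X) !(addrC Y) !subrK => A B.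
  have E : e * (`|x - X| + `|y - Y|) <= e * (W k + H k).
    by apply: ler_wpM2l; [exact: ltW|exact: lerD].
  by split; [exact: le_trans A E|exact: le_trans B E].
have -> : (s k).1 + W k - (s k).1 + ((s k).2 + H k - (s k).2) = W k + H k by ring.
move=> /(le_trans (Ps k)); rewrite leNgt => /negP; apply.
have -> : 2 * (e * (W k + H k)) * (W k + H k) = 2 * e * K ^+ 2 / 4 ^+ k.
  rewrite /W /H /K (_ : 4 = 2 * 2); last by ring.
  by rewrite exprMn; field; rewrite expf_neq0.
rewrite /D ltr_pM2r ?invr_gt0 ?exprn_gt0 //.
rewrite /e -subr_gt0.
have -> : c - 2 * (c / (4 * (K ^+ 2 + 1))) * K ^+ 2 =
   (c * (2 * K ^+ 2 + 4)) / (4 * (K ^+ 2 + 1)).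
  by field; rewrite gt_eqF.
by rewrite divr_gt0 ?mulr_gt0 //; have := sqr_ge0 K; lra.
Qed.

End goursat.

Section mean_value.
Context {R : realType}.
Local Notation C := R[i].

Definition cderiv (h : C -> C) (z d : C) : Prop :=
  forall e : R, 0 < e -> exists2 r : R, 0 < r &
  forall w, normc w < r -> normc (h (z + w) - h z - d * w) <= e * normc w.

Lemma cderiv_continuous (h : C -> C) z d : cderiv h z d ->
  forall e : R, 0 < e -> exists2 r : R, 0 < r &
  forall w, normc w < r -> normc (h (z + w) - h z) < e.
Proof.
move=> hd e e0; have [r r0 H] := hd 1 ltr01.
pose K := 1 + normc d; have K0 : 0 < K by rewrite ltr_pwDl // normc_ge0.
exists (Num.min r (e / K)); first by rewrite lt_min r0 divr_gt0.
move=> w; rewrite lt_min ltr_pdivlMr // => /andP[/H wr we].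
apply: le_lt_trans we.
rewrite -(subrK (d * w) (h (z + w) - h z)); apply: (le_trans (le_normcD _ _)).
by rewrite Normc.normcM /K; lra.
Qed.

(** The passage to the logarithmic coordinate. *)
Lemma cderiv_comp_cexp (h : C -> C) z d : cderiv h (cexp z) d ->
  cderiv (fun x => h (cexp x)) z (d * cexp z).
Proof.
move=> hd e e0.
set m := normc (cexp z); have m0 : 0 <= m := normc_ge0 _.
set nd := normc d; have nd0 : 0 <= nd := normc_ge0 _.
pose E := expR 1 : R; have E0 : 0 < E := expR_gt0 _.
pose K := m * (1 + 4 * E) + 1.
have K0 : 0 < K by rewrite ltr_wpDl // mulr_ge0 //; lra.
have e1 : 0 < e / 2 / K by rewrite divr_gt0 // divr_gt0.
have [r r0 H] := hd _ e1.
pose M := nd * m * (4 * E) + 1.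
have M0 : 0 < M by rewrite ltr_wpDl // !mulr_ge0 //; lra.
exists (Num.min 1 (Num.min (r / K) (e / 2 / M))).
  by rewrite !lt_min ltr01 !divr_gt0.
move=> w; rewrite !lt_min => /and3P[w1 wr we].
set nw := normc w in w1 wr we *; have nw0 : 0 <= nw := normc_ge0 _.
pose q := cexp w - 1 - w.
have hq : normc q <= 4 * E * nw ^+ 2.
  apply: (le_trans (cexp_taylor w)); rewrite -/nw -mulrA (mulrC (nw ^+ 2)) mulrA.
  by rewrite ler_wpM2r ?sqr_ge0 // ler_wpM2l // ler_expR ltW.
have hq1 : 4 * E * nw ^+ 2 <= 4 * E * nw.
  by apply: ler_wpM2l; [rewrite mulr_ge0 // ltW|rewrite expr2 ler_piMr // ltW].
pose t := cexp z * (w + q).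
have ht : normc t <= K * nw.
  rewrite Normc.normcM -/m /K.
  have h1 : normc (w + q) <= nw + 4 * E * nw.
    by apply: (le_trans (le_normcD _ _)); rewrite lerD2l; exact: le_trans hq1.
  have := ler_wpM2l m0 h1; lra.
have -> : cexp (z + w) = cexp z + t by rewrite cexpD /t /q; ring.
have -> : h (cexp z + t) - h (cexp z) - d * cexp z * w =
    (h (cexp z + t) - h (cexp z) - d * t) + d * cexp z * q by rewrite /t; ring.
apply: (le_trans (le_normcD _ _)).
have h1 : normc (h (cexp z + t) - h (cexp z) - d * t) <= e / 2 * nw.
  apply: (le_trans (H _ _)).
    by apply: (le_lt_trans ht); rewrite mulrC -ltr_pdivlMr.
  by apply: (le_trans (ler_wpM2l (ltW e1) ht)); rewrite mulrA divfK // gt_eqF.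
have h2 : normc (d * cexp z * q) <= e / 2 * nw.
  rewrite 2!Normc.normcM -/nd -/m.
  have h3 : nd * m * normc q <= nd * m * (4 * E * nw ^+ 2) by rewrite ler_wpM2l // mulr_ge0.
  apply: (le_trans h3).
  have : nw * M <= e / 2 by move: we; rewrite ltr_pdivlMr // => /ltW.
  move=> /(ler_wpM2r nw0); apply: le_trans; rewrite /M.
  by have := sqr_ge0 nw; lra.
lra.
Qed.

(** The integral of an entire function over a circle centred at the origin does
not depend on the radius: in the coordinates s + i theta of the logarithm the
circle is a vertical segment, and the periodicity in theta makes the horizontal
sides of a rectangle cancel.  Shrinking the radius gives the value at 0. *)
Lemma mean_value_Re (h : C -> C) : (forall z, exists d, cderiv h z d) ->
  segint (fun x : R => cRe (h (cexp (0 +i* x)))) 0 (pi *+ 2) = pi *+ 2 * cRe (h 0).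
Proof.
move=> hd.
pose H (z : C) := h (cexp z).
pose u (x y : R) := cRe (H (x +i* y)); pose v (x y : R) := cIm (H (x +i* y)).
have uv x y : exists a b c : R, forall e, 0 < e ->
  exists2 d, 0 < d & forall p q : R, `|p| < d -> `|q| < d ->
  `|u (x + p) (y + q) - u x y - (a * p + b * q)| <= e * (`|p| + `|q|) /\
  `|v (x + p) (y + q) - v x y - (c * p + a * q)| <= e * (`|p| + `|q|).
  have [d0 /cderiv_comp_cexp] := hd (cexp (x +i* y)).
  set d := d0 * _ => Hd.
  exists (cRe d), (- cIm d), (cIm d) => e e0; have [r r0 Hr] := Hd e e0.
  exists (r / 2); first by rewrite divr_gt0.
  move=> p q pr qr.
  have nw : normc (p +i* q) <= `|p| + `|q| := normc_leD _.
  have {}Hr : normc (H (x +i* y + p +i* q) - H (x +i* y) - d * (p +i* q))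
     <= e * (`|p| + `|q|).
    apply: (le_trans (Hr _ _)); last by rewrite ler_wpM2l // ltW.
    by apply: le_lt_trans nw _; rewrite (splitr r) ltrD.
  rewrite (_ : x +i* y + p +i* q = (x + p) +i* (y + q)) // in Hr.
  set X := _ - _ - _ in Hr.
  have -> : u (x + p) (y + q) - u x y - (cRe d * p + - cIm d * q) = cRe X.
    by rewrite /X !cReIm /u /=; ring.
  have -> : v (x + p) (y + q) - v x y - (cIm d * p + cRe d * q) = cIm X.
    by rewrite /X !cReIm /v /=; ring.
  by split; apply: le_trans Hr; [exact: normc_Re|exact: normc_Im].
have pi20 : 0 <= pi *+ 2 :> R by rewrite mulrn_wge0 // pi_ge0.
have per s : H (s +i* (pi *+ 2)) = H (s +i* 0).
  by rewrite /H /cexp /= cos2pi sin2pi cos0 sin0.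
have cu x : continuous (u x).
  move=> y; apply/cvgrPdist_lt => e e0.
  have [d /cderiv_comp_cexp/cderiv_continuous/(_ e e0)[r r0 Hr]] := hd (cexp (x +i* y)).
  near=> t; rewrite distrC.
  have tr : `|t - y| < r.
    by near: t; apply/nbhs_ballP; exists r => //= t; rewrite /ball /= distrC.
  have : normc (H (x +i* y + 0 +i* (t - y)) - H (x +i* y)) < e.
    by apply: Hr; apply: (le_lt_trans (normc_leD _)) => /=; rewrite normr0 add0r.
  apply: le_lt_trans; apply: le_trans (normc_Re _).
  rewrite cReB (_ : x +i* y + 0 +i* (t - y) = x +i* t) //.
  by apply: eqcP; rewrite !cReIm /=; ring.
(* The rectangle [-s, 0] x [0, 2 pi] joins the circles of radii exp(-s) and 1. *)
have eqs s : 0 <= s -> segint (u 0) 0 (pi *+ 2) = segint (u (- s)) 0 (pi *+ 2).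
  move=> s0; have := @boundary_integral_eq0 R u v uv (- s) 0 s (pi *+ 2) s0 pi20.
  rewrite /boundary_integral addNr add0r.
  have -> : (fun x => v x 0 - v x (pi *+ 2)) = fun _ => 0.
    by apply/funext => x; rewrite /v per subrr.
  have sN : - s <= 0 by rewrite oppr_le0.
  rewrite (segint_cst _ sN) mul0r add0r (segintB _ _ (@cu 0) (@cu (- s))).
  by move/eqP; rewrite subr_eq0 => /eqP.
rewrite -[LHS]/(segint (u 0) 0 (pi *+ 2)).
apply/eqP; rewrite -subr_eq0 -normr_eq0 eq_le normr_ge0 andbT.
apply/ler_addgt0Pl => e e0; rewrite addr0.
have e1 : 0 < e / (pi *+ 2 + 1) by rewrite divr_gt0 // ltr_wpDl.
have [d hd0] := hd 0.
have [r r0 Hr] := cderiv_continuous hd0 e1.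
have [s s0 sr] : exists2 s : R, 0 <= s & expR (- s) < r.
  exists (Num.max 0 (1 - ln r)); first by rewrite le_max lexx.
  rewrite -[ltRHS](lnK r0) ltr_expR ltrNl lt_max; apply/orP; right; lra.
rewrite (eqs s s0) mulrC -{2}(subr0 (pi *+ 2)).
apply: (@le_trans _ _ (e / (pi *+ 2 + 1) * (pi *+ 2 - 0))).
  apply: segint_near => // x _.
  have /ltW : normc (h (0 + cexp (- s +i* x)) - h 0) < e / (pi *+ 2 + 1).
    by apply: Hr; rewrite normc_cexp.
  by apply: le_trans; apply: le_trans (normc_Re _); rewrite cReB add0r.
rewrite subr0 mulrAC ler_pdivrMr ?ltr_wpDl // ler_wpM2l ?ltW //; lra.
Unshelve. all: by end_near. Qed.

End mean_value.

(** * Complex differentiability in coordinates *)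

Lemma ltr0cE (R : realType) (x : R) : (0 < x%:C) = (0 < x).
Proof. exact: (ltcR 0 x). Qed.

Section differentiability.
Context {R : realType} (n : nat).
Local Notation C := R[i].
Implicit Types (w z : 'rV[C]_n).

(** Complex differentiability with real quantities only: [M] is a bound for the
coordinates of the increment and stands for its sup norm. *)
Definition cderivn (g : 'rV[C]_n -> C) z (D : 'I_n -> C) : Prop :=
  forall e : R, 0 < e -> exists2 r : R, 0 < r &
  forall w (M : R), (forall i, normc (w 0 i) <= M) -> 0 <= M -> M < r ->
  normc (g (z + w) - g z - \sum_(i < n) D i * w 0 i) <= e * M.

Let supn w : R := cRe `|w|.

Let supnE w : `|w| = (supn w)%:C.
Proof. by apply: eqcP => //=; rewrite ger0_Im // normr_ge0. Qed.

Let supn_ge0 w : 0 <= supn w.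
Proof. by rewrite -ler0c -supnE normr_ge0. Qed.

Let normc_le_supn w i : normc (w 0 i) <= supn w.
Proof.
rewrite -lecR -supnE -normrcE {2}/Num.norm /= mx_normE.
by rewrite -[leLHS]nngE num_le; exact: (le_bigmax _ _ (0, i)).
Qed.

Let supn_le w M : 0 <= M -> (forall i, normc (w 0 i) <= M) -> supn w <= M.
Proof.
move=> M0 H; have [w0|w0] := eqVneq `|w| 0; first by rewrite /supn w0.
have [[i j] /= E] := mx_norm_neq0 w0.
by rewrite -lecR -supnE [`|w|]E (ord1 i) normrcE lecR; exact: H.
Qed.

Lemma holomorphic_cderivn (g : 'rV[C]_n -> C) :
  holomorphic g -> forall z, exists D, cderivn g z D.
Proof.
move=> + z => /(_ z) dg; exists (fun i => 'd (g : 'rV[C]_n -> C^o) (z : ('rV[C]_n : normedModType C)) (delta_mx 0 i)) => e e0.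
have := diff_locally dg => /eqaddoP /(_ e%:C); rewrite ltr0cE => /(_ e0).
move=> /nbhs_ballP[r r0 Hr].
have rE : r = (cRe r)%:C by apply: eqcP => //=; rewrite ger0_Im // ltW.
exists (cRe r); first by rewrite -ltr0cE -rE.
move=> w M wM M0 Mr.
have : ball 0 r w.
  split; first by [].
  move=> i j; rewrite (ord1 i) /ball /= mxE sub0r normrN normrcE rE ltcR.
  exact: le_lt_trans (wM j) Mr.
move=> /Hr /=; rewrite supnE normrcE -rmorphM lecR => h.
apply: le_trans (_ : _ <= e * supn w) _; last by rewrite ler_pM2l // supn_le.
apply: le_trans h; rewrite le_eqVlt; apply/orP; left; apply/eqP; congr normc.
rewrite -![(_ + _ : _ -> _) _]/(_ + _) -![(- _ : _ -> _) _]/(- _) /= /cst.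
rewrite (addrC w) opprD addrA; congr (_ - _).
rewrite {2}(row_sum_delta w) linear_sum; apply: eq_bigr => i _.
by rewrite linearZ /= mulrC.
Qed.

Definition dlin (D : 'I_n -> C) (w : 'rV[C]_n) : C^o := \sum_(i < n) D i * w 0 i.

Let dlin_is_linear D : linear (dlin D).
Proof.
move=> a u v; rewrite /dlin scaler_sumr -big_split /=; apply: eq_bigr => i _.
by rewrite !mxE mulrDr mulrCA.
Qed.

HB.instance Definition _ D := GRing.isLinear.Build C 'rV[C]_n C^o _ (dlin D)
  (dlin_is_linear D).

Let dlin_continuous D : continuous (dlin D : ('rV[C]_n : normedModType C) -> (C^o : normedModType C)).
Proof.
apply: continuous_big => [|i _ w]; first exact: add_continuous.
exact: (cvgMl_tmp (@coord_continuous C 1 n 0 i w)).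
Qed.

Lemma cderivn_holomorphic (g : 'rV[C]_n -> C) :
  (forall z, exists D, cderivn g z D) -> holomorphic g.
Proof.
move=> + z => /(_ z)[D gD].
have E : (g : 'rV[C]_n -> C^o) \o shift z = cst (g z : C^o) + dlin D +o_ 0 id.
  apply/eqaddoP => e e0.
  have eE : e = (cRe e)%:C by apply: eqcP => //=; rewrite ger0_Im // ltW.
  have e0' : 0 < cRe e by rewrite -ltr0cE -eE.
  have [r r0 H] := gD _ e0'.
  apply/nbhs_ballP; exists r%:C => /=; first by rewrite ltr0cE.
  move=> w [_ wr] /=; rewrite supnE normrcE eE -rmorphM lecR.
  rewrite -![(_ + _ : _ -> _) _]/(_ + _) -![(- _ : _ -> _) _]/(- _) /= /cst.
  rewrite opprD addrA (addrC w); apply: H => //.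
  have [w0|w0] := eqVneq `|w| 0; first by rewrite /supn w0.
  have [[i j] /= Ew] := mx_norm_neq0 w0.
  rewrite -ltcR -supnE [`|w|]Ew; have := wr i j.
  by rewrite /ball /= mxE sub0r normrN.
apply/diff_locallyP; rewrite (diff_unique (@dlin_continuous D) E).
by split; first exact: dlin_continuous.
Qed.

Lemma cderivn_continuous (g : 'rV[C]_n -> C) z D : cderivn g z D ->
  forall e : R, 0 < e -> exists2 r : R, 0 < r &
  forall w, (forall i, normc (w 0 i) < r) -> normc (g (z + w) - g z) < e.
Proof.
move=> gD e e0; have [r r0 H] := gD 1 ltr01.
pose K := 1 + \sum_(i < n) normc (D i).
have S0 : 0 <= \sum_(i < n) normc (D i) by apply: sumr_ge0 => i _; exact: normc_ge0.
have K0 : 0 < K by rewrite ltr_pwDl.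
pose m := Num.min (r / 2) (e / 2 / K).
have m0 : 0 < m by rewrite lt_min !divr_gt0.
have mr : m < r by rewrite gt_min; apply/orP; left; lra.
have me : m * K < e.
  have : m * K <= e / 2 by rewrite -ler_pdivlMr // ge_min lexx orbT.
  lra.
exists m => // w wm.
have wm' i : normc (w 0 i) <= m by exact: ltW.
apply: le_lt_trans me.
rewrite -(subrK (\sum_(i < n) D i * w 0 i) (g (z + w) - g z)).
apply: (le_trans (le_normcD _ _)); rewrite /K mulrDr; apply: lerD.
  by rewrite mulr1 -[leRHS]mul1r; apply: H => //; exact: ltW.
apply: (le_trans (ler_normc_sum _ _ _)); rewrite mulr_sumr; apply: ler_sum => i _.
by rewrite Normc.normcM mulrC ler_wpM2r // normc_ge0.
Qed.

Lemma cderivn_line (g : 'rV[C]_n -> C) (z : 'rV[C]_n) :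
  (forall x, exists D, cderivn g x D) ->
  forall c, exists d, cderiv (fun c => g (c *: z)) c d.
Proof.
move=> hg c; have [D HD] := hg (c *: z).
exists (\sum_(i < n) D i * z 0 i) => e e0.
pose K := 1 + \sum_(i < n) normc (z 0 i).
have K0 : 0 < K by rewrite ltr_pwDl // sumr_ge0 // => i _; exact: normc_ge0.
have [r r0 H] := HD (e / K) (divr_gt0 e0 K0).
exists (r / K); first by rewrite divr_gt0.
move=> w; rewrite ltr_pdivlMr // => wr.
have : normc (g (c *: z + w *: z) - g (c *: z) - \sum_(i < n) D i * (w *: z) 0 i)
    <= e / K * (normc w * K).
  apply: H => //; last by rewrite mulr_ge0 ?normc_ge0 // ltW.
  move=> i; rewrite mxE Normc.normcM ler_wpM2l ?normc_ge0 // /K (bigD1 i) //=.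
  rewrite addrCA lerDl addr_ge0 // sumr_ge0 // => j _; exact: normc_ge0.
rewrite -scalerDl mulrCA mulfVK ?gt_eqF // mulrC; congr (normc (_ - _) <= _).
by rewrite mulr_suml; apply: eq_bigr => i _; rewrite mxE; ring.
Qed.

End differentiability.

(** * The mean value property against a Gaussian *)

Section gaussian_mean.
Context {R : realType} (n : nat).
Local Notation mR := (measurableTypeR R).
Local Notation plane := (mR * mR)%type.
Local Notation leb := (@lebesgue_measure R).
Local Notation C := R[i].
Local Notation T := (n.-tuple plane).
Local Notation mu := (@lebesgue_tuple R n).

Definition nrm2 (z : 'rV[C]_n) : R := \sum_(i < n) normc (z 0 i) ^+ 2.

Lemma nrm2TE (t : T) : nrm2T t = nrm2 (tuple_Cn t).
Proof. by apply: eq_bigr => i _; rewrite mxE sqr_normcE. Qed.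

Lemma nrm2Z (c : C) z : nrm2 (c *: z) = normc c ^+ 2 * nrm2 z.
Proof.
by rewrite /nrm2 mulr_sumr; apply: eq_bigr => i _; rewrite mxE Normc.normcM exprMn.
Qed.

Lemma ccont_Re (g : 'rV[C]_n -> C) : (forall z, exists D, cderivn g z D) ->
  ccont (fun z => cRe (g z)).
Proof.
move=> hg z e e0; have [D /cderivn_continuous/(_ e e0)[r r0 H]] := hg z.
exists r => // w wr; rewrite -cReB; apply: (le_lt_trans (normc_Re _)).
have := H (w - z); rewrite (addrC z) subrK; apply => i.
by rewrite !mxE; exact: wr.
Qed.

Lemma measurable_fun_Cn (f : 'rV[C]_n -> R) : ccont f ->
  measurable_fun setT (fun t : T => f (tuple_Cn t)).
Proof.
move=> cf; apply: (measurable_fun_ccont (u := fun i t => (tnth t i).1)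
  (v := fun i t => (tnth t i).2)) => // i;
  by apply: measurableT_comp => //; exact: measurable_tnth.
Qed.

Variables (g : 'rV[C]_n -> C) (a b K : R).
Hypotheses (a0 : 0 < a) (b0 : 0 < b) (hg : forall z, exists D, cderivn g z D).
Hypothesis gK : forall z, normc (g z) * expR (- b * nrm2 z) <= K * expR (- a * nrm2 z).

Let u (t : T) : R := cRe (g (tuple_Cn t)) * gaussT b t.

Let u_bound t : `|u t| <= K * gaussT a t.
Proof.
rewrite /u normrM (ger0_norm (expR_ge0 _)) /gaussT nrm2TE.
by apply: le_trans (gK _); rewrite ler_wpM2r ?expR_ge0 // normc_Re.
Qed.

Let K0 : 0 <= K.
Proof.
rewrite -(pmulr_lge0 _ (expR_gt0 (- a * nrm2 0))).
by apply: le_trans (gK 0); rewrite mulr_ge0 ?normc_ge0 // expR_ge0.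
Qed.

Let mu_u : measurable_fun setT u.
Proof.
apply: measurable_funM; last exact: measurable_gaussT.
exact: (measurable_fun_Cn (ccont_Re hg)).
Qed.

Lemma integrable_gaussT c : 0 < c -> mu.-integrable setT (fun t => (gaussT c t)%:E).
Proof.
move=> c0; apply/integrableP; split.
  by apply/measurable_EFinP; exact: measurable_gaussT.
under eq_integral => t _ do rewrite gee0_abs ?lee_fin ?expR_ge0 //.
by rewrite integral_gaussT // ltry.
Qed.

Let circle (x : R) : C := cexp (0 +i* x).

Let normc_circle x : normc (circle x) = 1.
Proof. by rewrite normc_cexp expR0. Qed.

Let U (p : T * mR) : R := u (rotT (circle p.2) p.1) * \1_`[0, pi *+ 2] p.2.

Let mU : measurable_fun setT U.
Proof.
apply: measurable_funM; last first.
  by apply: measurableT_comp => //; exact: measurable_indic.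
rewrite /u; apply: measurable_funM.
  have := @measurable_fun_ccont R _ (T * mR)%type n (fun z => cRe (g z))
     (fun i p => (tnth (rotT (circle p.2) p.1) i).1)
     (fun i p => (tnth (rotT (circle p.2) p.1) i).2) (ccont_Re hg).
  rewrite (_ : (fun t => cRe _) =
    (fun p : T * mR => cRe (g (tuple_Cn (rotT (circle p.2) p.1))))); last by [].
  have mt i : measurable_fun setT (fun p : T * mR => tnth p.1 i).
    by apply: (measurableT_comp (measurable_tnth i)).
  have mt1 i : measurable_fun setT (fun p : T * mR => (tnth p.1 i).1).
    exact: (measurableT_comp measurable_fst (mt i)).
  have mt2 i : measurable_fun setT (fun p : T * mR => (tnth p.1 i).2).
    exact: (measurableT_comp measurable_snd (mt i)).
  have mc : measurable_fun setT (fun p : T * mR => cRe (circle p.2)).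
    rewrite /circle /cexp /=; under eq_fun do rewrite expR0 mul1r mul0r subr0.
    apply: measurableT_comp => //.
    by apply: continuous_measurable_fun; exact: continuous_cos.
  have ms : measurable_fun setT (fun p : T * mR => cIm (circle p.2)).
    rewrite /circle /cexp /=; under eq_fun do rewrite expR0 mul1r mul0r addr0.
    apply: measurableT_comp => //.
    by apply: continuous_measurable_fun; exact: continuous_sin.
  apply => i.
    rewrite (_ : (fun p => _) = fun p : T * mR => cRe (circle p.2) * (tnth p.1 i).1 -
      cIm (circle p.2) * (tnth p.1 i).2); last first.
      by apply/funext => p; rewrite tnth_mktuple.
    apply: measurable_funB; apply: measurable_funM;
      first [exact: mc|exact: ms|exact: mt1|exact: mt2].
  rewrite (_ : (fun p => _) = fun p : T * mR => cIm (circle p.2) * (tnth p.1 i).1 +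
    cRe (circle p.2) * (tnth p.1 i).2); last first.
    by apply/funext => p; rewrite tnth_mktuple.
  apply: measurable_funD; apply: measurable_funM;
    first [exact: mc|exact: ms|exact: mt1|exact: mt2].
have -> : (fun p : T * mR => gaussT b (rotT (circle p.2) p.1)) =
    fun p => gaussT b p.1.
  by apply/funext => p; rewrite /gaussT !nrm2TE tuple_Cn_rot nrm2Z normc_circle expr1n mul1r.
by apply: measurableT_comp => //; exact: measurable_gaussT.
Qed.

Let gauss_rot c x (t : T) : gaussT c (rotT (circle x) t) = gaussT c t.
Proof. by rewrite /gaussT !nrm2TE tuple_Cn_rot nrm2Z normc_circle expr1n mul1r. Qed.

Let indic_int : (\int[leb]_x (\1_`[0%R, (pi *+ 2)%R] x)%:E = (pi *+ 2 : R)%:E)%E.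
Proof.
rewrite integral_indic //= setIT lebesgue_measure_itv /= lte_fin.
by rewrite pmulrn_lgt0 // pi_gt0 sube0.
Qed.

Let integrable_U : (mu \x leb)%E.-integrable setT (EFin \o U).
Proof.
apply/integrable12ltyP; first exact/measurable_EFinP.
apply: (@le_lt_trans _ _ (\int[mu]_t ((K * gaussT a t)%:E * (pi *+ 2)%:E))%E).
  apply: ge0_le_integral => //.
  - move=> t _; exact: integral_ge0.
  - have mabs : measurable_fun setT (abse \o (EFin \o U)).
      by apply: measurableT_comp => //; exact/measurable_EFinP.
    exact: (measurable_fun_fubini_tonelli_F _ mabs (fun=> abse_ge0 _)).
  - apply: emeasurable_funM => //; apply/measurable_EFinP; apply: measurable_funM => //.
    exact: measurable_gaussT.
  move=> t _; rewrite -indic_int -ge0_integralZl //; last first.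
  - by rewrite lee_fin mulr_ge0 // expR_ge0.
  - by apply/measurable_EFinP; exact: measurable_indic.
  apply: ge0_le_integral => //.
  - apply: measurableT_comp => //; apply/measurable_EFinP.
    exact: (measurableT_comp mU (measurable_pair1 t)).
  - by apply: emeasurable_funM => //; apply/measurable_EFinP; exact: measurable_indic.
  move=> x _; rewrite lee_fin /U /= normrM (@ger0_norm _ (\1__ _)) //.
  rewrite ler_wpM2r //; apply: (le_trans (u_bound _)).
  by rewrite gauss_rot.
rewrite ge0_integralZr //.
- under eq_integral do rewrite EFinM.
  rewrite ge0_integralZl //.
  + by rewrite integral_gaussT // -!EFinM ltry.
  + by apply/measurable_EFinP; exact: measurable_gaussT.
  + by move=> t _; rewrite lee_fin expR_ge0.
- by apply/measurable_EFinP; apply: measurable_funM => //; exact: measurable_gaussT.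
- by move=> t _; rewrite lee_fin mulr_ge0 // expR_ge0.
- by rewrite lee_fin mulrn_wge0 // pi_ge0.
Qed.

(** The Gaussian and Lebesgue measure are invariant under the rotations
[z |-> e^(i x) z].  Averaging over [x] first replaces [Re g] at [z] by its mean
over the circle through [z] of the complex line of [z], which is [Re g(0)].
The bound [gK] makes the double integral absolutely convergent. *)
Lemma gaussian_mean_Re :
  (\int[mu]_t (cRe (g (tuple_Cn t)) * gaussT b t)%:E =
   ((pi / b) ^+ n * cRe (g 0))%:E)%E.
Proof.
have iu : mu.-integrable setT (EFin \o u).
  apply: (@le_integrable _ _ _ _ _ measurableT _ (fun t => (K * gaussT a t)%:E)).
  - exact/measurable_EFinP.
  - move=> t _; rewrite /= lee_fin (ger0_norm (_ : 0 <= K * gaussT a t)) ?u_bound //.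
    by rewrite mulr_ge0 // expR_ge0.
  - exact: (integrableZl _ K (integrable_gaussT a0)).
have pi20 : 0 < pi *+ 2 :> R by rewrite pmulrn_lgt0 // pi_gt0.
have F := Fubini integrable_U.
have L : (\int[mu]_t \int[leb]_x (EFin \o U) (t, x) =
   \int[mu]_t ((pi *+ 2 * cRe (g 0))%:E * (gaussT b t)%:E))%E.
  apply: eq_integral => t _.
  pose f x := cRe (g (circle x *: tuple_Cn t)).
  have cf : leb.-integrable `[0, pi *+ 2] (EFin \o f).
    apply: segment_integrable => x; apply/cvgrPdist_lt => e e0.
    have [d /cderiv_comp_cexp/cderiv_continuous/(_ e e0)[r r0 Hr]] :=
      cderivn_line (tuple_Cn t) hg (circle x).
    near=> y; rewrite distrC /f -cReB; apply: le_lt_trans (normc_Re _) _.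
    have yr : `|y - x| < r.
      by near: y; apply/nbhs_ballP; exists r => //= y; rewrite /ball /= distrC.
    have := Hr (0 +i* (y - x)); rewrite (_ : 0 +i* x + 0 +i* (y - x) = 0 +i* y).
      by apply; apply: (le_lt_trans (normc_leD _)) => /=; rewrite normr0 add0r.
    by apply: eqcP; rewrite !cReIm /=; ring.
  transitivity (\int[leb]_(x in `[0%R, (pi *+ 2)%R]) ((gaussT b t)%:E * (f x)%:E))%E.
    rewrite [RHS]integral_mkcond; apply: eq_integral => x _.
    rewrite /= /U /u /= gauss_rot tuple_Cn_rot patchE indicE.
    by case: ifP => xI; rewrite ?mulr0 // mulr1 -EFinM mulrC.
  have mv : (\int[leb]_(x in `[0%R, (pi *+ 2)%R]) (f x)%:E = (pi *+ 2 * cRe (g 0))%:E)%E.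
    rewrite -[LHS]fineK; last exact: (integrable_fin_num _ cf).
    have := mean_value_Re (cderivn_line (tuple_Cn t) hg); rewrite scale0r => <-.
    by [].
  by rewrite integralZl // mv muleC.
have Rr : (\int[leb]_x \int[mu]_t (EFin \o U) (t, x) =
   \int[leb]_x ((\int[mu]_t (u t)%:E) * (\1_`[0%R, (pi *+ 2)%R] x)%:E))%E.
  apply: eq_integral => x _.
  transitivity (\int[mu]_t ((u (rotT (circle x) t))%:E * (\1_`[0%R, (pi *+ 2)%R] x)%:E))%E.
    by apply: eq_integral.
  have P := integral_preserving (preserving_rotT n (normc_circle x)) measurableT
    ((measurable_EFinP _ _).2 mu_u).
  rewrite preimage_setT in P.
  rewrite indicE; case: (_ \in _) => /=.
    by rewrite mule1; under eq_integral do rewrite mule1; exact: P.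
  by rewrite mule0; under eq_integral do rewrite mule0; rewrite integral0.
have ii : leb.-integrable setT (fun x => (\1_`[0%R, (pi *+ 2)%R] x)%:E).
  apply/integrableP; split; first by apply/measurable_EFinP; exact: measurable_indic.
  under eq_integral => x _ do rewrite gee0_abs ?lee_fin //.
  by rewrite indic_int ltry.
move: F; rewrite L Rr (integralZl measurableT (integrable_gaussT b0)) integral_gaussT //.
rewrite -(fineK (integrable_fin_num measurableT iu)) (integralZl measurableT ii).
rewrite indic_int => -[E]; congr _%:E.
by apply: (mulIf (lt0r_neq0 pi20)); rewrite -E; ring.
Unshelve. all: by end_near. Qed.

End gaussian_mean.

(** * Lattices *)

Section lattice.
Context {R : realType} (n : nat).
Local Notation C := R[i].
Implicit Types (z w g : 'rV[C]_n) (G : set 'rV[C]_n).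

Section subgroup.
Variables (G : set 'rV[C]_n) (sG : additive_subgroup G).

Lemma subgroup0 : G 0. Proof. by case: sG. Qed.
Lemma subgroupB x y : G x -> G y -> G (x - y). Proof. by case: sG => _; apply. Qed.
Lemma subgroupN x : G x -> G (- x).
Proof. by move=> Gx; rewrite -sub0r; apply: subgroupB => //; exact: subgroup0. Qed.
Lemma subgroupD x y : G x -> G y -> G (x + y).
Proof. by move=> Gx Gy; rewrite -(opprK y); apply: subgroupB => //; exact: subgroupN. Qed.
Lemma subgroupMz x (k : int) : G x -> G (x *~ k).
Proof.
have nat_case (m : nat) : G x -> G (x *+ m).
  move=> Gx; elim: m => [|m IH]; first by rewrite mulr0n; exact: subgroup0.
  by rewrite mulrS; exact: subgroupD.
by case: k => m Gx; [rewrite -pmulrn; exact: nat_case|rewrite NegzE mulrNz; apply/subgroupN; rewrite -pmulrn; exact: nat_case].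
Qed.
Lemma subgroup_sum I (r : seq I) (f : I -> 'rV[C]_n) :
  (forall i, G (f i)) -> G (\sum_(i <- r) f i).
Proof. by move=> Gf; elim/big_ind: _ => //; [exact: subgroup0|exact: subgroupD]. Qed.

End subgroup.

Variables (G : set 'rV[C]_n) (latG : full_rank_lattice G).
Let sG : additive_subgroup G. Proof. by case: latG. Qed.

Lemma lattice_discrete : exists2 r : R, 0 < r &
  forall g, G g -> (forall i, normc (g 0 i) < r) -> g = 0.
Proof.
case: latG => _ isoG _; have [_ [V + VG]] := isoG 0 (subgroup0 sG).
move=> /nbhs_ballP[r r0 Hr].
have rE : r = (cRe r)%:C by apply: eqcP => //=; rewrite ger0_Im // ltW.
exists (cRe r); first by rewrite -ltr0cE -rE.
move=> g Gg gr; suff : [set (0 : 'rV[C]_n)] g by [].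
rewrite -VG; split => //; apply: Hr; split=> // i j.
by rewrite (ord1 i) /ball /= mxE sub0r normrN normrcE rE ltcR.
Qed.

Lemma lattice_basis : exists2 v : 'I_(2 * n) -> 'rV[C]_n,
  (forall i, G (v i)) & Z_independent v.
Proof. by case: latG => _ _ [[v [? ?]] _]; exists v. Qed.

(** Two lattice points in the same cell of a grid finer than the radius of
discreteness coincide. *)
Lemma lattice_countable : countable G.
Proof.
have [r r0 Hr] := lattice_discrete.
pose f g : {ffun 'I_n -> int * int} :=
  [ffun i => (Num.floor (cRe (g 0 i) / (r / 2)), Num.floor (cIm (g 0 i) / (r / 2)))].
have r2 : 0 < r / 2 by rewrite divr_gt0.
have close (x y : R) : Num.floor (x / (r / 2)) = Num.floor (y / (r / 2)) ->
    `|x - y| < r / 2.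
  move=> E; have h1 := floor_le (x / (r / 2)); have h2 := floorD1_gt (x / (r / 2)).
  have h3 := floor_le (y / (r / 2)); have h4 := floorD1_gt (y / (r / 2)).
  rewrite E in h1 h2; rewrite intrD1 in h2; rewrite intrD1 in h4.
  have : `|x / (r / 2) - y / (r / 2)| < 1 by rewrite ltr_norml; apply/andP; split; lra.
  by rewrite -mulrBl normrM (@gtr0_norm _ _^-1) ?invr_gt0 // ltr_pdivrMr // mul1r.
apply/countable_injP; exists (choice.pickle \o f) => x y.
move=> /set_mem Gx /set_mem Gy /(pcan_inj choice.pickleK) /ffunP E.
apply/eqP; rewrite -subr_eq0; apply/eqP; apply: Hr; first exact: subgroupB.
move=> i; have := E i; rewrite !ffunE => -[/close h1 /close h2].
rewrite !mxE; apply: (le_lt_trans (normc_leD _)); rewrite cReB cImB.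
by rewrite (splitr r) ltrD.
Qed.

Lemma lattice_infinite : (1 <= n)%N -> infinite_set G.
Proof.
move=> n1; have [v Gv iv] := lattice_basis.
have n2 : (0 < 2 * n)%N by rewrite muln_gt0.
pose i0 := Ordinal n2.
have inj : injective (fun k : nat => v i0 *~ k%:Z).
  move=> k l E; have := iv (fun i => if i == i0 then k%:Z - l%:Z else 0).
  rewrite (bigD1 i0) //= big1 ?addr0; last first.
    by move=> i /negPf ->; rewrite mulr0z.
  rewrite ?eqxx mulrzBr E subrr => /(_ erefl i0); rewrite eqxx.
  by move=> /eqP; rewrite subr_eq0 => /eqP[].
apply/infiniteP.
have [_ le1] : ((fun k : nat => v i0 *~ k%:Z) @` [set: nat] #<= [set: nat])%card /\
    ([set: nat] #<= (fun k : nat => v i0 *~ k%:Z) @` [set: nat])%card.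
  by apply/card_eqPle; apply: inj_card_eq => k l _ _; exact: inj.
by apply: (card_le_trans le1); apply: subset_card_le => _ [k _ <-]; exact: subgroupMz.
Qed.

Lemma lattice_enum : (1 <= n)%N -> exists2 e : nat -> 'rV[C]_n,
  injective e & forall g, G g <-> exists k, e k = g.
Proof.
move=> n1; have := eq_card_nat lattice_countable (lattice_infinite n1).
rewrite card_eq_sym => /card_bijP[f [h fK hK]].
exists (fun k => val (f (to_setT k))).
  by move=> k l /val_inj /(can_inj fK) /(congr1 val).
move=> g; split=> [Gg|[k <-]]; last exact: set_valP.
exists (val (h (SigSub (mem_set Gg)))).
rewrite (_ : to_setT _ = h (SigSub (mem_set Gg))) ?hK //.
exact: val_inj.
Qed.

(** Discreteness upgrades independence over Z to independence over R: by the
pigeonhole principle the multiples of a real relation come arbitrarily close to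
integral ones, which give arbitrarily small elements of the lattice. *)
Lemma lattice_real_independent (v : 'I_(2 * n) -> 'rV[C]_n) :
  (forall i, G (v i)) -> Z_independent v ->
  forall a : 'I_(2 * n) -> R, \sum_i (a i)%:C *: v i = 0 -> forall i, a i = 0.
Proof.
move=> Gv iv a0 a0v i0; apply/eqP/negPn/negP => ai0.
(* Normalized so that the coefficient of index [i0] in the integral relation
obtained below is the nonzero difference of two multipliers. *)
pose a i := a0 i / a0 i0.
have av : \sum_i (a i)%:C *: v i = 0.
  transitivity (((a0 i0)^-1)%:C *: \sum_i (a0 i)%:C *: v i); last by rewrite a0v scaler0.
  by rewrite scaler_sumr; apply: eq_bigr => i _; rewrite scalerA -rmorphM mulrC.
have a1 : a i0 = 1 by rewrite /a divff.
have [r r0 Hr] := lattice_discrete.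
pose S := \sum_i \sum_j normc (v i 0 j).
have S0 : 0 <= S by do 2 (apply: sumr_ge0 => ? _); exact: normc_ge0.
pose N := (Num.truncn (S / r)).+1.
have SN : S / N%:R < r.
  rewrite ltr_pdivrMr ?ltr0n // mulrC -ltr_pdivrMr //.
  exact: truncnS_gt.
have N0 : 0 < N%:R :> R by rewrite ltr0n.
pose frac (x : R) := x - (Num.floor x)%:~R.
have frac_ge0 x : 0 <= frac x by rewrite subr_ge0 floor_le.
have frac_lt1 x : frac x < 1 by rewrite ltrBlDl -intrD1 floorD1_gt.
have lt_N (x : R) : (Num.truncn (frac x * N%:R) < N)%N.
  by rewrite truncn_lt_nat ?gtr_pMl // mulr_ge0 // ltW.
(* Cells of side 1/N of the fractional parts of [k a]: one more multiple than
cells. *)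
pose box (k : 'I_(N ^ (2 * n)).+1) : {ffun 'I_(2 * n) -> 'I_N} :=
  [ffun i => Ordinal (lt_N (k%:R * a i))].
have : ~~ injectiveb box.
  apply/negP => /injectiveP /leq_card.
  by rewrite card_ffun !card_ord ltnn.
move=> /injectivePn[k1 [k2 k12 /ffunP E]].
wlog kl : k1 k2 k12 E / (k1 < k2)%N => [wl|].
  have := k12; rewrite -val_eqE /= neq_ltn => /orP[|] h; first exact: (wl k1 k2).
  by apply: (wl k2 k1) => //; rewrite eq_sym.
pose p i : int := Num.floor (k2%:R * a i) - Num.floor (k1%:R * a i).
have close i : `|(p i)%:~R - (k2%:R - k1%:R) * a i| <= N%:R^-1.
  have /(congr1 val) := E i; rewrite !ffunE /= => {}E.
  have h1 := truncn_itv (mulr_ge0 (frac_ge0 (k1%:R * a i)) (ltW N0)).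
  have h2 := truncn_itv (mulr_ge0 (frac_ge0 (k2%:R * a i)) (ltW N0)).
  rewrite -E in h2; move: h1 h2 => /andP[h1 h1'] /andP[h2 h2'].
  have -> : (p i)%:~R - (k2%:R - k1%:R) * a i = frac (k1%:R * a i) - frac (k2%:R * a i).
    by rewrite /p /frac rmorphB /=; ring.
  have : `|(frac (k1%:R * a i) - frac (k2%:R * a i)) * N%:R| <= 1.
    rewrite -natr1 in h1' h2'; rewrite mulrBl.
    by rewrite ler_norml; apply/andP; split; lra.
  by rewrite normrM (gtr0_norm N0) -ler_pdivlMr // div1r.
have g0 : \sum_i v i *~ p i = 0.
  apply: Hr; first by apply: subgroup_sum => // i; exact: subgroupMz.
  move=> j.
  have -> : \sum_i v i *~ p i = \sum_i ((p i)%:~R - (k2%:R - k1%:R) * a i)%:C *: v i.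
    transitivity (\sum_i v i *~ p i - (k2%:R - k1%:R)%:C *: \sum_i (a i)%:C *: v i).
      by rewrite av scaler0 subr0.
    rewrite scaler_sumr -sumrB; apply: eq_bigr => i _; rewrite [in RHS]rmorphB [in RHS]rmorphM scalerBl scalerA; congr (_ - _).
    by rewrite -scaler_int; congr (_ *: _); rewrite rmorph_int.
  rewrite summxE; apply: (le_lt_trans (ler_normc_sum _ _ _)); apply: le_lt_trans SN.
  rewrite /S mulr_suml; apply: ler_sum => i _.
  rewrite mxE Normc.normcM normcCE mulrC; apply: ler_pM; rewrite ?normc_ge0 //.
  by rewrite (bigD1 j) //= lerDl sumr_ge0 // => ? _; exact: normc_ge0.
have := iv p g0 i0; have := close i0; rewrite a1 mulr1 => + pi0.
have : p i0 = (k2%:Z - k1%:Z).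
  by rewrite /p a1 !mulr1 !pmulrn !intrKfloor.
rewrite pi0 => /eqP; rewrite eq_sym subr_eq0 => /eqP[] k21.
by rewrite k21 ltnn in kl.
Qed.

(** Hence a Z-independent family of full size is a real basis, and rounding the
coordinates down moves any point to a bounded region. *)
Lemma lattice_cobounded : exists B : R, forall z, exists2 g, G g &
  forall i, normc ((z - g) 0 i) <= B.
Proof.
have [v Gv iv] := lattice_basis.
have iR := lattice_real_independent Gv iv.
pose re z : 'rV[R]_n := \row_j cRe (z 0 j); pose im z : 'rV[R]_n := \row_j cIm (z 0 j).
(* The real coordinates of the family: independence makes this square matrix
invertible. *)
pose M : 'M[R]_(2 * n, n + n) := \matrix_(i, j) (row_mx (re (v i)) (im (v i))) 0 j.
have mulM (t : 'rV[R]_(2 * n)) : t *m M =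
    row_mx (re (\sum_i (t 0 i)%:C *: v i)) (im (\sum_i (t 0 i)%:C *: v i)).
  apply/rowP => j; rewrite mxE; case: (split_ordP j) => k ->.
    rewrite row_mxEl mxE summxE cRe_sum; apply: eq_bigr => i _.
    by rewrite [M _ _]mxE row_mxEl !mxE cReZ.
  rewrite row_mxEr mxE summxE cIm_sum; apply: eq_bigr => i _.
  by rewrite [M _ _]mxE row_mxEr !mxE cImZ.
have reim z w : re z = re w -> im z = im w -> z = w.
  move=> /rowP h1 /rowP h2; apply/rowP => j; apply: eqcP.
    by have := h1 j; rewrite !mxE.
  by have := h2 j; rewrite !mxE.
have freeM : row_free M.
  rewrite -kermx_eq0; apply/rowV0P => t /sub_kermxP.
  rewrite mulM -[X in _ = X]row_mx0 => /eq_row_mx[h1 h2].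
  apply/rowP => i; rewrite [RHS]mxE; apply: (iR (fun i => t 0 i)).
  by apply: reim; [rewrite h1|rewrite h2]; apply/rowP => j; rewrite !mxE.
have /row_fullP[Q QM] : row_full M.
  by rewrite /row_full; move: freeM; rewrite /row_free => /eqP ->; rewrite mul2n addnn.
exists (\sum_i \sum_j normc (v i 0 j)) => z.
pose t := row_mx (re z) (im z) *m Q.
have tz : \sum_i (t 0 i)%:C *: v i = z.
  have := mulM t; rewrite /t -mulmxA QM mulmx1 => /esym/eq_row_mx[h1 h2].
  exact: reim.
exists (\sum_i v i *~ Num.floor (t 0 i)).
  by apply: subgroup_sum => // i; exact: subgroupMz.
move=> j; rewrite -{1}tz -sumrB summxE; apply: (le_trans (ler_normc_sum _ _ _)).
apply: ler_sum => i _.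
have -> : (t 0 i)%:C *: v i - v i *~ Num.floor (t 0 i) =
    (t 0 i - (Num.floor (t 0 i))%:~R)%:C *: v i.
  by rewrite rmorphB scalerBl -scaler_int rmorph_int.
rewrite mxE Normc.normcM normcCE.
apply: (@le_trans _ _ (normc (v i 0 j))).
  apply: ler_piMl; first exact: normc_ge0.
  rewrite ger0_norm ?subr_ge0 ?floor_le // lerBlDl ltW //.
  by have := floorD1_gt (t 0 i); rewrite intrD1.
by rewrite (bigD1 j) //= lerDl sumr_ge0 // => ? _; exact: normc_ge0.
Qed.

End lattice.

(** * Absolutely convergent series of complex numbers *)

Section complex_series.
Context {R : realType}.
Local Notation C := R[i].
Implicit Types (f g : nat -> C).

Definition abssum f : Prop := cvgn (series (fun k => normc (f k))).

(** The sum in the order of the indices, defined through real limits; meaningful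
when [abssum] holds. *)
Definition csumN f : C :=
  limn (series (fun k => cRe (f k))) +i* limn (series (fun k => cIm (f k))).

Lemma summable_le (a b : nat -> R) (K : R) : (forall k, 0 <= a k <= K * b k) ->
  (forall k, 0 <= b k) -> cvgn (series b) -> cvgn (series a).
Proof.
move=> ab b0 cb; apply: (@series_le_cvg _ a (K *: b)).
- by move=> k; have /andP[] := ab k.
- by move=> k; have /andP[h1 h2] := ab k; exact: le_trans h2.
- by move=> k; have /andP[_] := ab k.
- exact: is_cvg_seriesZ.
Qed.

Lemma abssum_le f g (K : R) : (forall k, normc (f k) <= K * normc (g k)) ->
  abssum g -> abssum f.
Proof.
move=> fg; apply: (summable_le (K := K)) => k; rewrite normc_ge0 //=; exact: fg.
Qed.

Lemma abssum_le_real f (a : nat -> R) (K : R) : (forall k, normc (f k) <= K * a k) ->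
  (forall k, 0 <= a k) -> cvgn (series a) -> abssum f.
Proof.
by move=> fa a0; apply: (summable_le (K := K)) => // k; rewrite normc_ge0 /=.
Qed.

Lemma abssum_Re f : abssum f -> cvgn (series (fun k => cRe (f k))).
Proof.
move=> af; apply: normed_cvg.
by apply: (summable_le (K := 1)) af => k; rewrite ?normr_ge0 ?mul1r ?normc_Re ?normc_ge0.
Qed.

Lemma abssum_Im f : abssum f -> cvgn (series (fun k => cIm (f k))).
Proof.
move=> af; apply: normed_cvg.
by apply: (summable_le (K := 1)) af => k; rewrite ?normr_ge0 ?mul1r ?normc_Im ?normc_ge0.
Qed.

Lemma abssumM (c : C) f : abssum f -> abssum (fun k => c * f k).
Proof.
by apply: (abssum_le (K := normc c)) => k; rewrite Normc.normcM.
Qed.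

Lemma abssumD f g : abssum f -> abssum g -> abssum (fun k => f k + g k).
Proof.
move=> af ag.
have := is_cvg_seriesD af ag; apply: (summable_le (K := 1)) => k.
  by rewrite normc_ge0 mul1r /=; exact: le_normcD.
by rewrite addr_ge0 ?normc_ge0.
Qed.

Lemma csumND f g : abssum f -> abssum g ->
  csumN (fun k => f k + g k) = csumN f + csumN g.
Proof.
move=> af ag; apply: eqcP; rewrite !cReIm /=.
  rewrite -(lim_seriesD (abssum_Re af) (abssum_Re ag)); congr (limn (series _)).
  by apply/funext => k; rewrite cReD.
rewrite -(lim_seriesD (abssum_Im af) (abssum_Im ag)); congr (limn (series _)).
by apply/funext => k; rewrite cImD.
Qed.

Lemma csumNM (c : C) f : abssum f -> csumN (fun k => c * f k) = c * csumN f.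
Proof.
move=> af; have aRe := abssum_Re af; have aIm := abssum_Im af.
have E (a b : R) : limn (series (fun k => a * cRe (f k) + b * cIm (f k))) =
    a * limn (series (fun k => cRe (f k))) + b * limn (series (fun k => cIm (f k))).
  transitivity (limn (series (a *: (fun k => cRe (f k)))) +
    limn (series (b *: (fun k => cIm (f k))))); last by rewrite !lim_seriesZ.
  by rewrite -lim_seriesD //; exact: is_cvg_seriesZ.
apply: eqcP; rewrite !cReIm /=.
  rewrite -mulNr -E; congr (limn (series _)); apply/funext => k.
  by rewrite cReM mulNr.
rewrite [RHS]addrC -E; congr (limn (series _)); apply/funext => k.
by rewrite cImM addrC.
Qed.

Lemma csumN_cvg f : abssum f -> forall e : R, 0 < e -> exists N, forall m,
  (N <= m)%N -> normc (\sum_(0 <= k < m) f k - csumN f) < e.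
Proof.
move=> af e e0; have e2 : 0 < e / 2 by rewrite divr_gt0.
have /cvgrPdist_lt/(_ _ e2)[N1 _ H1] := abssum_Re af.
have /cvgrPdist_lt/(_ _ e2)[N2 _ H2] := abssum_Im af.
exists (maxn N1 N2) => m; rewrite geq_max => /andP[m1 m2].
apply: (le_lt_trans (normc_leD _)); rewrite !cReIm cRe_sum cIm_sum /=.
rewrite (splitr e) distrC (distrC _ (limn _)); apply: ltrD; [exact: H1|exact: H2].
Qed.

Lemma csumN_tail f : abssum f -> forall e : R, 0 < e -> exists N, forall m,
  (N <= m)%N -> \sum_(N <= k < m) normc (f k) < e.
Proof.
move=> af e e0; have e2 : 0 < e / 2 by rewrite divr_gt0.
have /cvgrPdist_lt/(_ _ e2)[N _ HN] := af.
exists N => m Nm; have := HN N (leqnn N); have := HN m Nm; rewrite /= /series /=.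
rewrite (@big_cat_nat _ _ _ N 0 m) //=; move: (limn _) => l.
set s1 := \sum_(0 <= k < N) _; set s2 := \sum_(N <= k < m) _ => h1 h2.
have := ler_normB (l - s1) (l - (s1 + s2)).
rewrite opprB addrC addrA subrK addrC addKr => h3.
by rewrite (splitr e) (le_lt_trans (ler_norm _)) // (le_lt_trans h3) // ltrD.
Qed.

Lemma normc_csumN f (M : R) : abssum f ->
  (forall m, \sum_(0 <= k < m) normc (f k) <= M) -> normc (csumN f) <= M.
Proof.
move=> af fM; apply/ler_addgt0Pl => e e0.
have [N HN] := csumN_cvg af e0; have := HN N (leqnn N).
rewrite normcBC => h.
rewrite -(subrK (\sum_(0 <= k < N) f k) (csumN f)).
apply: (le_trans (le_normcD _ _)); apply: lerD; first exact: ltW.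
by apply: (le_trans (ler_normc_sum _ _ _)).
Qed.

End complex_series.

Section csum_enum.
Import mathcomp.finmap.finmap.
Context {R : realType} {T : choiceType}.
Local Notation C := R[i].
Variables (D : set T) (e : nat -> T).
Hypotheses (einj : injective e) (eD : forall x, D x <-> exists k, e k = x).

(** The limit along finite subsets is computed by any enumeration. *)
Lemma partial_sum_enum (f : T -> C^o) : abssum (fun k => f (e k)) ->
  summability.partial_sum (f \_ D) @ summability.totally -->
  (csumN (fun k => f (e k)) : C^o).
Proof.
move=> af; set S := csumN _; have FF := @summability.totally_filter T.
apply/cvgrPdist_lt => eps eps0.
have epsE : eps = (cRe eps)%:C by apply: eqcP => //=; rewrite ger0_Im // ltW.
have e0 : 0 < cRe eps by rewrite -ltcR -epsE.
have e2 : 0 < cRe eps / 2 by rewrite divr_gt0.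
have [N HN] := csumN_tail af e2; have [N' HN'] := csumN_cvg af e2.
pose A : {fset T} := seq_fset tt [seq e k | k <- iota 0 N].
exists A => // B AB /=.
rewrite distrC normrcE epsE ltcR.
have [M0 HM0] : exists M, forall x, x \in (B : seq T) -> D x -> exists2 k, (k < M)%N & e k = x.
  elim: (B : seq T) => [|x s [M HM]]; first by exists 0%N.
  have [Dx|nDx] := pselect (D x); last first.
    exists M => y; rewrite inE => /predU1P[->//|]; exact: HM.
  have [k ek] := (eD x).1 Dx.
  exists (maxn M k.+1) => y; rewrite inE => /predU1P[-> _|ys Dy].
    by exists k => //; exact: leq_maxr.
  by have [l lM el] := HM _ ys Dy; exists l => //; apply: leq_trans lM (leq_maxl _ _).
pose M := maxn M0 (maxn N N').
have MN : (N <= M)%N by rewrite /M !leq_max leqnn orbT.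
have MN' : (N' <= M)%N by rewrite /M !leq_max leqnn !orbT.
have -> : summability.partial_sum (f \_ D) B = \sum_(0 <= k < M | e k \in B) f (e k).
  rewrite /summability.partial_sum -(big_seq_fsetE _ _ xpredT (f \_ D)) /=.
  rewrite (bigID (fun x => x \in D)) /= [X in _ + X]big1 ?addr0; last first.
    by move=> x /negPf xD; rewrite patchE xD.
  rewrite (eq_bigr f); last by move=> x xD; rewrite patchE xD.
  rewrite -[LHS]big_filter -[RHS]big_filter -(big_map e xpredT f).
  apply: perm_big; apply: uniq_perm.
  - by rewrite filter_uniq // fset_uniq.
  - by rewrite map_inj_uniq // filter_uniq // iota_uniq.
  move=> x; rewrite mem_filter; apply/andP/mapP.
    move=> [/set_mem Dx xB]; have [k kM ek] := HM0 _ xB Dx.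
    exists k => //; rewrite mem_filter mem_index_iota /= ek xB /=.
    by apply: leq_trans kM _; rewrite /M leq_max leqnn.
  move=> [k]; rewrite mem_filter => /andP[kB _] ->; split => //.
  by apply/mem_set/eD; exists k.
rewrite (splitr (cRe eps)).
have -> : \sum_(0 <= k < M | e k \in B) f (e k) - S =
    - \sum_(0 <= k < M | e k \notin B) f (e k) + (\sum_(0 <= k < M) f (e k) - S).
  have aux (V : zmodType) (a b c : V) : a - c = - b + (a + b - c).
    by rewrite (addrC a b) -addrA addKr.
  have -> : \sum_(0 <= k < M) f (e k) = \sum_(0 <= k < M | e k \in B) f (e k) +
    \sum_(0 <= k < M | e k \notin B) f (e k) by rewrite (bigID (fun k => e k \in B)).
  exact: aux.
apply: (le_lt_trans (le_normcD _ _)); apply: ltrD; last exact: HN'.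
rewrite normcN; apply: (le_lt_trans (ler_normc_sum _ _ _)).
apply: le_lt_trans (HN _ MN).
rewrite (@big_cat_nat _ _ _ N) //= big1_seq ?add0r; last first.
  move=> k /andP[ekB]; rewrite mem_index_iota => /andP[_ kN].
  suff : e k \in B by rewrite (negPf ekB).
  apply: (fsubsetP AB); rewrite seq_fsetE; apply: map_f.
  by rewrite mem_iota add0n.
by rewrite big_mkcond /=; apply: ler_sum => k _; case: ifP => // _; exact: normc_ge0.
Qed.

Lemma csummable_enum (f : T -> C^o) : abssum (fun k => f (e k)) -> csummable D f.
Proof. by move=> af; apply/cvg_ex; exists (csumN (fun k => f (e k))); exact: partial_sum_enum. Qed.

Lemma csum_enum (f : T -> C^o) : abssum (fun k => f (e k)) ->
  csum D f = csumN (fun k => f (e k)).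
Proof.
move=> af; have FF := @summability.totally_filter T.
exact: (cvg_lim (@norm_hausdorff _ (C^o : normedModType C)) (partial_sum_enum af)).
Qed.

End csum_enum.

(** * Periodization over a fundamental domain *)

Section real_series.
Local Open Scope ereal_scope.
Context {R : realType}.

Lemma nneseries_EFin (a : nat -> R) : cvgn (series a) ->
  \sum_(k <oo) (a k)%:E = (limn (series a))%:E.
Proof.
move=> ca; rewrite -EFin_lim //; congr (limn _).
by apply/funext => m /=; rewrite /series /= sumEFin.
Qed.

Lemma nneseries_finite_cvg (a : nat -> R) : (forall k, 0 <= a k)%R ->
  \sum_(k <oo) (a k)%:E < +oo -> cvgn (series a).
Proof.
move=> a0; move E : (\sum_(k <oo) _) => s soo.
have s0 : 0 <= s by rewrite -E; apply: nneseries_ge0 => k _ _; rewrite lee_fin.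
move: E soo s0; case: s => // s E _ _.
apply: nondecreasing_is_cvgn.
  by apply: nondecreasing_series => k _ _; exact: a0.
exists s => _ [m _ <-]; rewrite -lee_fin -E /series /= -sumEFin.
by apply: nneseries_lim_ge => k _ _; rewrite lee_fin.
Qed.

End real_series.

Section squared_norm.
Context {R : realType} (n : nat).
Local Notation C := R[i].

Lemma nrm2_ge0 (z : 'rV[C]_n) : (0 <= nrm2 z)%R.
Proof. by apply: sumr_ge0 => i _; exact: sqr_ge0. Qed.

Lemma nrm2D (z w : 'rV[C]_n) : (nrm2 (z + w) <= 2 * nrm2 z + 2 * nrm2 w)%R.
Proof.
rewrite /nrm2 !mulr_sumr -big_split /=; apply: ler_sum => i _; rewrite mxE.
have h1 := le_normcD (z 0 i) (w 0 i); have h0 := normc_ge0 (z 0 i + w 0 i).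
apply: (@le_trans _ _ ((normc (z 0 i) + normc (w 0 i)) ^+ 2)%R).
  by rewrite ler_pXn2r ?nnegrE // addr_ge0 ?normc_ge0.
by have := sqr_ge0 (normc (z 0 i) - normc (w 0 i)); lra.
Qed.

Lemma nrm2N (z : 'rV[C]_n) : nrm2 (- z) = nrm2 z.
Proof. by apply: eq_bigr => i _; rewrite !mxE normcN. Qed.

End squared_norm.

Section domain.
Local Open Scope ereal_scope.
Context {R : realType} (n : nat).
Local Notation mR := (measurableTypeR R).
Local Notation plane := (mR * mR)%type.
Local Notation C := R[i].
Local Notation T := (n.-tuple plane).
Local Notation cT := (caratheodory_type (lebesgue_tuple n)^*%mu).
Local Notation mu := (@lebesgue_tuple R n).
Local Notation lc := (@lebesgue_Cn R n).
Variables (G L : set 'rV[C]_n) (e : nat -> 'rV[C]_n).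
Hypotheses (latG : full_rank_lattice G) (fd : fundamental_domain G L)
  (einj : injective e) (eG : forall g, G g <-> exists k, e k = g).
Let Lam : set cT := @tuple_Cn R n @^-1` L.
Let mL : measurable Lam := measurable_domain fd.

Lemma gaussT_shift b (x : T) a : gaussT b (shiftT a x) = expR (- b * nrm2 (tuple_Cn x + a)).
Proof. by rewrite /gaussT nrm2TE tuple_Cn_shift. Qed.

Lemma integral_gauss_unfold b : (0 < b)%R ->
  \int[lc]_(x in Lam) \sum_(k <oo) (gaussT b (shiftT (e k) x))%:E = ((pi / b) ^+ n)%:E.
Proof.
move=> b0; rewrite -(integral_gaussT n b0).
have mg : measurable_fun setT (fun x : T => (gaussT b x)%:E).
  by apply/measurable_EFinP; exact: measurable_gaussT.
have g0 (x : T) : 0 <= (gaussT b x)%:E by rewrite lee_fin expR_ge0.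
rewrite -(ge0_integral_completion mu mg g0).
exact/esym/(integral_unfold fd einj eG (measurable_fun_completion (m := mu) mg measurableT) g0).
Qed.

Let msum b : measurable_fun Lam (fun x => \sum_(k <oo) (gaussT b (shiftT (e k) x))%:E).
Proof.
apply: ge0_emeasurable_sum => [k x _ _|k _]; first by rewrite lee_fin expR_ge0.
have mg : measurable_fun setT (fun x : T => (gaussT b (shiftT (e k) x))%:E).
  apply/measurable_EFinP.
  exact: (measurableT_comp (@measurable_gaussT R b n) (preserving_shiftT (e k)).1).
exact: measurable_funTS (measurable_fun_completion (m := mu) mg measurableT).
Qed.

(** Over a null set the periodized Gaussian would have integral 0 instead of the
integral of the Gaussian over the whole space. *)
Lemma vol_domain_gt0 : 0 < vol L.
Proof.
rewrite lt_neqAle measure_ge0 andbT eq_sym; apply/eqP => v0.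
have := integral_gauss_unfold (@ltr01 R).
rewrite (null_set_integral mL (msum 1) v0) => -[] /esym/eqP.
by rewrite gt_eqF // exprn_gt0 // divr_gt0 // pi_gt0.
Qed.

(** Every point has a lattice translate in a fixed ball, so the periodized
Gaussian is bounded below, while its integral over the domain is finite. *)
Lemma vol_domain_fin : vol L < +oo.
Proof.
have [B HB] := lattice_cobounded latG.
pose c : R := expR (- (n%:R * B ^+ 2)).
have c0 : (0 < c)%R := expR_gt0 _.
have Hc x : c%:E <= \sum_(k <oo) (gaussT 1 (shiftT (e k) x))%:E.
  have [g Gg gB] := HB (tuple_Cn x).
  have [sG _ _] := latG.
  have [k ek] := (eG (- g)).1 (subgroupN sG Gg).
  apply: (@le_trans _ _ (gaussT 1 (shiftT (e k) x))%:E).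
    rewrite lee_fin gaussT_shift ek ler_expR mulN1r lerN2 /nrm2.
    apply: (@le_trans _ _ (\sum_(i < n) B ^+ 2)%R).
      apply: ler_sum => i _; have h := gB i; rewrite ler_pXn2r ?nnegrE ?normc_ge0 //.
      exact: le_trans (normc_ge0 _) h.
    by rewrite sumr_const card_ord mulr_natl.
  apply: le_trans (nneseries_lim_ge k.+1 _); last by move=> ? _ _; rewrite lee_fin expR_ge0.
  by rewrite big_nat_recr //= leeDr // sume_ge0 // => ? _; rewrite lee_fin expR_ge0.
have : c%:E * vol L <= ((pi / 1) ^+ n)%:E.
  rewrite -integral_gauss_unfold // -[vol L]/(lc Lam) -integral_cst //.
  by apply: ge0_le_integral => // x _; rewrite lee_fin ltW.
have : 0 <= vol L by exact: measure_ge0.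
by case: (vol L) => [v _ _| |]; rewrite ?ltry // gt0_muley ?lte_fin.
Qed.

(** The periodized Gaussian has a finite integral over a set of positive volume,
so it is finite somewhere; this is how convergence of the lattice sums is
obtained. *)
Let finite_point b : (0 < b)%R -> exists x : T,
  \sum_(k <oo) (gaussT b (shiftT (e k) x))%:E < +oo.
Proof.
move=> b0; apply: contrapT => H.
have Hoo x : \sum_(k <oo) (gaussT b (shiftT (e k) x))%:E = +oo.
  apply/eqP; apply/negPn/negP => h; apply: H; exists x.
  by rewrite ltey.
have := integral_gauss_unfold b0.
rewrite (eq_integral (cst +oo)) ?integral_cst //.
by rewrite gt0_mulye //; exact: vol_domain_gt0.
Qed.

Lemma lattice_gauss_summable b : (0 < b)%R ->
  cvgn (series (fun k => expR (- b * nrm2 (e k)))).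
Proof.
move=> b0; have b20 : (0 < b / 2)%R by rewrite divr_gt0.
have [x /nneseries_finite_cvg] := finite_point b20.
move=> /(_ (fun k => expR_ge0 _)).
apply: (summable_le (K := expR (b * nrm2 (tuple_Cn x)))) => k; last exact: expR_ge0.
rewrite expR_ge0 /= gaussT_shift -expRD ler_expR.
by have /(ler_wpM2l (ltW b0)) := nrm2D (tuple_Cn x) (e k); lra.
Qed.

Lemma gauss_translates_summable b (z : 'rV[C]_n) : (0 < b)%R ->
  cvgn (series (fun k => expR (- b * nrm2 (z + e k)))).
Proof.
move=> b0; have b20 : (0 < b / 2)%R by rewrite divr_gt0.
apply: summable_le (lattice_gauss_summable b20) => k; last exact: expR_ge0.
rewrite expR_ge0 /=; instantiate (1 := expR (b * nrm2 z)).
rewrite -expRD ler_expR.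
have := nrm2D (z + e k) (- z).
rewrite addrAC subrr add0r nrm2N => /(ler_wpM2l (ltW b0)).
lra.
Qed.

(** A signed function dominated by a Gaussian is the difference of two nonnegative
ones, obtained by adding that Gaussian; both unfold. *)
Lemma integral_unfold_signed (h : 'rV[C]_n -> R) (K a : R) : (0 < a)%R ->
  measurable_fun setT (fun t : T => h (tuple_Cn t)) ->
  (forall z, `|h z| <= K * expR (- a * nrm2 z))%R ->
  lc.-integrable Lam (fun x => (limn (series (fun k => h (tuple_Cn x + e k))))%:E) /\
  \int[lc]_(x in Lam) (limn (series (fun k => h (tuple_Cn x + e k))))%:E =
  \int[mu]_t (h (tuple_Cn t))%:E.
Proof.
move=> a0 mh hK.
have K0 : (0 <= K)%R.
  rewrite -(pmulr_lge0 _ (expR_gt0 (- a * nrm2 (0 : 'rV[C]_n)))).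
  by apply: le_trans (hK 0%R).
(* The dominating Gaussian, added to make the function nonnegative. *)
pose H2 (t : T) : R := (K * gaussT a t)%R.
pose H1 (t : T) : R := (h (tuple_Cn t) + H2 t)%R.
have mH2 : measurable_fun setT H2.
  by apply: measurable_funM => //; exact: measurable_gaussT.
have mH1 : measurable_fun setT H1 by exact: measurable_funD.
have H20 t : (0 <= H2 t)%R by rewrite mulr_ge0 // expR_ge0.
have hH2 t : (`|h (tuple_Cn t)| <= H2 t)%R by rewrite /H2 /gaussT nrm2TE.
have H10 t : (0 <= H1 t)%R by have := hH2 t; rewrite /H1 ler_norml; lra.
have s2 x : cvgn (series (fun k => H2 (shiftT (e k) x))).
  apply: (summable_le (K := K) _ _ (gauss_translates_summable (z := tuple_Cn x) a0)) => k;
    last exact: expR_ge0.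
  by rewrite H20 /= /H2 gaussT_shift.
have sh x : cvgn (series (fun k => h (tuple_Cn x + e k)%R)).
  apply: normed_cvg; apply: (summable_le (K := 1%R) _ _ (s2 x)) => k; last exact: H20.
  by rewrite normr_ge0 /= -tuple_Cn_shift mul1r; exact: hH2.
have s1 x : cvgn (series (fun k => H1 (shiftT (e k) x))).
  have := is_cvg_seriesD (sh x) (s2 x).
  by congr (cvgn (series _)); apply/funext => k /=; rewrite /H1 tuple_Cn_shift.
have U (H : T -> R) : measurable_fun setT H -> (forall t, 0 <= H t)%R ->
    (forall x, cvgn (series (fun k => H (shiftT (e k) x)))) ->
    \int[mu]_t (H t)%:E < +oo ->
    lc.-integrable Lam (fun x => (limn (series (fun k => H (shiftT (e k) x))))%:E) /\
    \int[lc]_(x in Lam) (limn (series (fun k => H (shiftT (e k) x))))%:E =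
      \int[mu]_t (H t)%:E.
  move=> mH H0 sH fin.
  have mE : measurable_fun setT (fun t => (H t)%:E) by exact/measurable_EFinP.
  have E0 t : 0 <= (H t)%:E by rewrite lee_fin.
  have Eq : \int[lc]_(x in Lam) (limn (series (fun k => H (shiftT (e k) x))))%:E =
      \int[mu]_t (H t)%:E.
    rewrite -(ge0_integral_completion mu mE E0).
    rewrite (integral_unfold fd einj eG (measurable_fun_completion (m := mu) mE measurableT) E0).
    by apply: eq_integral => x _; rewrite nneseries_EFin.
  split=> //; apply/integrableP; split.
    rewrite (_ : (fun x => _) = fun x => \sum_(k <oo) (H (shiftT (e k) x))%:E); last first.
      by apply/funext => x; rewrite nneseries_EFin.
    apply: ge0_emeasurable_sum => [k x _ _|k _]; first exact: E0.
    have mk : measurable_fun setT (fun x : T => (H (shiftT (e k) x))%:E).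
      exact: (measurableT_comp mE (preserving_shiftT (e k)).1).
    exact: measurable_funTS (measurable_fun_completion (m := mu) mk measurableT).
  under eq_integral => x _.
    rewrite gee0_abs; last first.
      rewrite lee_fin; apply: limr_ge => //; apply: nearW => m.
      by apply: sumr_ge0 => k _; exact: H0.
    over.
  by rewrite Eq.
have i2 : mu.-integrable setT (fun t => (H2 t)%:E).
  exact: (integrableZl _ K (integrable_gaussT _ a0)).
have ih : mu.-integrable setT (fun t => (h (tuple_Cn t))%:E).
  apply: le_integrable i2 => //; first exact/measurable_EFinP.
  by move=> t _; rewrite /= lee_fin (ger0_norm (H20 t)).
have i1 : mu.-integrable setT (fun t => (H1 t)%:E).
  exact: (integrableD measurableT ih i2).
have fin H : mu.-integrable setT (fun t => (H t)%:E) -> (forall t, 0 <= H t)%R ->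
    \int[mu]_t (H t)%:E < +oo.
  move=> /integrableP[_ +] H0.
  by under eq_integral => t _ do rewrite gee0_abs ?lee_fin //.
have [j1 E1] := U H1 mH1 H10 s1 (fin _ i1 H10).
have [j2 E2] := U H2 mH2 H20 s2 (fin _ i2 H20).
have Eh : (fun x : cT => (limn (series (fun k => h (tuple_Cn x + e k)%R)))%:E) =
   (fun x => (limn (series (fun k => H1 (shiftT (e k) x))))%:E -
             (limn (series (fun k => H2 (shiftT (e k) x))))%:E).
  apply/funext => x; rewrite -EFinB; congr _%:E.
  rewrite -lim_seriesB //; congr (limn (series _)); apply/funext => k.
  rewrite -[RHS]/(H1 (shiftT (e k) x) - H2 (shiftT (e k) x))%R.
  by rewrite /H1 tuple_Cn_shift addrK.
rewrite Eh; split; first exact: integrableB.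
rewrite integralB // E1 E2 -integralB //.
apply: eq_integral => t _; rewrite -EFinB /H1; congr _%:E; ring.
Qed.

End domain.

(** * The space of theta functions *)

Section hermitian.
Context {R : realType} (n : nat).
Local Notation C := R[i].
Implicit Types z w u : 'rV[C]_n.

Lemma hdotDl z w u : hdot (z + w) u = hdot z u + hdot w u.
Proof. by rewrite -big_split; apply: eq_bigr => i _; rewrite mxE mulrDl. Qed.

Lemma hdotDr z w u : hdot u (z + w) = hdot u z + hdot u w.
Proof. by rewrite -big_split; apply: eq_bigr => i _; rewrite mxE rmorphD mulrDr. Qed.

Lemma hdotC z w : hdot w z = conjc (hdot z w).
Proof.
rewrite rmorph_sum; apply: eq_bigr => i _.
by rewrite rmorphM /= conjcK mulrC.
Qed.

Lemma hdotNl z u : hdot (- z) u = - hdot z u.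
Proof. by rewrite -sumrN; apply: eq_bigr => i _; rewrite mxE mulNr. Qed.

Lemma hdotNr z u : hdot u (- z) = - hdot u z.
Proof. by rewrite -sumrN; apply: eq_bigr => i _; rewrite mxE rmorphN mulrN. Qed.

Lemma hdotZl (c : C) z u : hdot (c *: z) u = c * hdot z u.
Proof. by rewrite mulr_sumr; apply: eq_bigr => i _; rewrite mxE mulrA. Qed.

Lemma hdotZr (c : R) z u : hdot z (c%:C *: u) = c%:C * hdot z u.
Proof.
rewrite mulr_sumr; apply: eq_bigr => i _.
by rewrite mxE rmorphM /= oppr0 mulrCA.
Qed.

Lemma hdotzz z : hdot z z = (nrm2 z)%:C.
Proof.
by rewrite /nrm2 rmorph_sum; apply: eq_bigr => i _; rewrite mulcJ_normc.
Qed.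

Lemma normc_hdot z u (M : R) : (forall i, normc (z 0 i) <= M) ->
  normc (hdot z u) <= M * \sum_(i < n) normc (u 0 i).
Proof.
move=> zM; apply: (le_trans (ler_normc_sum _ _ _)); rewrite mulr_sumr.
by apply: ler_sum => i _; rewrite Normc.normcM normcJE ler_wpM2r // normc_ge0.
Qed.

(** The Peter-Paul form of the Cauchy-Schwarz inequality. *)
Lemma hdot_young z u (d : R) : 0 < d ->
  normc (hdot z u) <= d * nrm2 u + (4 * d)^-1 * nrm2 z.
Proof.
move=> d0; apply: (le_trans (ler_normc_sum _ _ _)).
rewrite /nrm2 !mulr_sumr -big_split /=; apply: ler_sum => i _.
rewrite Normc.normcM normcJE; move: (normc _) (normc _) => y x.
rewrite -subr_ge0.
have -> : d * y ^+ 2 + (4 * d)^-1 * x ^+ 2 - x * y = (4 * d)^-1 * (x - 2 * d * y) ^+ 2.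
  by field; rewrite gt_eqF.
by rewrite mulr_ge0 ?sqr_ge0 // invr_ge0 mulr_ge0 // ltW.
Qed.

End hermitian.

Section measurable_complex.
Context {R : realType} (n : nat).
Local Notation mR := (measurableTypeR R).
Local Notation plane := (mR * mR)%type.
Local Notation C := R[i].
Local Notation T := (n.-tuple plane).
Implicit Types F H : 'rV[C]_n -> C.

(** Borel measurability; it implies measurability for the completion, and the
latter is not stable under composition. *)
Definition cmeasurable F : Prop :=
  measurable_fun setT (fun t : T => cRe (F (tuple_Cn t))) /\
  measurable_fun setT (fun t : T => cIm (F (tuple_Cn t))).

Lemma cmeasurableM F H : cmeasurable F -> cmeasurable H ->
  cmeasurable (fun z => F z * H z).
Proof.
move=> [f1 f2] [h1 h2]; split.
  under eq_fun do rewrite cReM.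
  by apply: measurable_funB; apply: measurable_funM.
under eq_fun do rewrite cImM.
by apply: measurable_funD; apply: measurable_funM.
Qed.

Lemma cmeasurableD F H : cmeasurable F -> cmeasurable H ->
  cmeasurable (fun z => F z + H z).
Proof.
move=> [f1 f2] [h1 h2]; split.
  by under eq_fun do rewrite cReD; exact: measurable_funD.
by under eq_fun do rewrite cImD; exact: measurable_funD.
Qed.

Lemma cmeasurableJ F : cmeasurable F -> cmeasurable (fun z => conjc (F z)).
Proof.
move=> [f1 f2]; split; first by under eq_fun do rewrite cReJ.
by under eq_fun do rewrite cImJ; exact: measurableT_comp.
Qed.

Lemma cmeasurable_cst (c : C) : cmeasurable (fun=> c).
Proof. by split; exact: measurable_cst. Qed.

Lemma cmeasurable_deriv F : (forall z, exists D, cderivn F z D) -> cmeasurable F.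
Proof.
move=> hF; split; first exact: (measurable_fun_Cn (ccont_Re hF)).
have hF' z : exists D, cderivn (fun z => - 'i * F z) z D.
  have [D HD] := hF z; exists (fun i => - 'i * D i) => e e0.
  have [r r0 H] := HD e e0; exists r => // w M wM M0 Mr.
  apply: le_trans (H w M wM M0 Mr).
  rewrite -mulrBr (_ : \sum_(i < n) _ = - 'i * \sum_(i < n) D i * w 0 i); last first.
    by rewrite mulr_sumr; apply: eq_bigr => i _; rewrite mulrA.
  rewrite -mulrBr Normc.normcM normcN (_ : normc 'i = 1) ?mul1r //.
  by rewrite /= expr0n expr1n add0r sqrtr1.
have := measurable_fun_Cn (ccont_Re hF').
by under eq_fun do rewrite mulNr cReN cReM /= mul0r sub0r mul1r opprK.
Qed.

Lemma cmeasurable_real (f : 'rV[C]_n -> R) :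
  measurable_fun setT (fun t : T => f (tuple_Cn t)) -> cmeasurable (fun z => (f z)%:C).
Proof. by move=> mf; split => //; exact: measurable_cst. Qed.

Lemma cmeasurable_gauss (b : R) : cmeasurable (fun z => (expR (- b * nrm2 z))%:C).
Proof.
apply: cmeasurable_real; have := @measurable_gaussT R b n.
rewrite (_ : @gaussT R b n = fun t => expR (- b * nrm2 (tuple_Cn t))) //.
by apply/funext => t; rewrite /gaussT nrm2TE.
Qed.

End measurable_complex.

Section compact_box.
Context {R : realType} (n : nat).
Local Notation C := R[i].

Lemma ccont_bounded_box (f : 'rV[C]_n -> R) (B : R) : ccont f ->
  exists M, forall z : 'rV[C]_n, (forall i, normc (z 0 i) <= B) -> f z <= M.
Proof.
move=> cf.
(* The box is the image of a compact box of real row vectors. *)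
pose z (x : 'rV[R]_(n + n)) : 'rV[C]_n := \row_i (x 0 (lshift n i) +i* x 0 (rshift n i)).
pose A := [set x : 'rV[R]_(n + n) | forall i, `[- B, B]%classic (x ord0 i)].
have cA : compact A.
  apply: (@rV_compact R (n + n) (fun=> `[- B, B]%classic)) => i.
  exact: segment_compact.
have cfz : continuous (fun x => f (z x)).
  move=> x; have FF := nbhs_filter x; apply/cvgrPdist_lt => e e0.
  have [d d0 Hd] := cf (z x) e e0.
  exists (fun i j => ball (x i j) (d / 2)).
    by move=> i j; apply: nbhsx_ballx; rewrite divr_gt0.
  move=> y xy; rewrite /= distrC; apply: Hd => i; rewrite !mxE.
  apply: (le_lt_trans (normc_leD _)); rewrite cReB cImB /=.
  have h1 := xy 0 (lshift n i); have h2 := xy 0 (rshift n i).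
  by rewrite (splitr d); apply: ltrD; rewrite distrC; [exact: h1|exact: h2].
have := continuous_compact (continuous_subspaceT cfz) cA.
move=> /compact_bounded[M [_ HM]].
exists (M + 1) => w wB.
pose x : 'rV[R]_(n + n) := row_mx (\row_i cRe (w 0 i)) (\row_i cIm (w 0 i)).
have <- : z x = w.
  by apply/rowP => i; rewrite mxE row_mxEl row_mxEr !mxE; case: (w 0 i).
apply: le_trans (ler_norm _) _; apply: (HM (M + 1)); first by rewrite ltrDl.
exists x => // i; rewrite /= in_itv /= -ler_norml /x.
case: (split_ordP i) => k ->.
  by rewrite row_mxEl mxE; apply: le_trans (wB k); exact: normc_Re.
by rewrite row_mxEr mxE; apply: le_trans (wB k); exact: normc_Im.
Qed.

End compact_box.

Section pseudocharacters.
Context {R : realType} (n : nat) (nu : R).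
Local Notation C := R[i].
Variables (G : set 'rV[C]_n) (chi : 'rV[C]_n -> C).
Hypotheses (sG : additive_subgroup G) (pchi : pseudocharacter nu G chi).

Lemma normc_chi g : G g -> normc (chi g) = 1.
Proof. by case: pchi => + _ => /[apply]; rewrite normrcE => -[]. Qed.

Lemma omega_diag (g : 'rV[C]_n) : omega g g = 0.
Proof. by rewrite /omega hdotzz. Qed.

Lemma omegaC (g h : 'rV[C]_n) : omega h g = - omega g h.
Proof. by rewrite /omega hdotC cImJ. Qed.

Lemma chi0 : chi 0 = 1.
Proof.
have G0 := subgroup0 sG.
have := pchi.2 _ _ G0 G0; rewrite addr0 omega_diag mulr0 mulr0 cexp0 mulr1.
have c0 : chi 0 != 0.
  by apply/eqP => h; have := normc_chi G0; rewrite h Normc.normc0 => /eqP; rewrite eq_sym oner_eq0.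
by move=> /(congr1 (fun x => x / chi 0)); rewrite mulfV // mulfK.
Qed.

Lemma chiN g : G g -> chi (- g) = conjc (chi g).
Proof.
move=> Gg; have := pchi.2 _ _ Gg (subgroupN sG Gg).
rewrite subrr chi0 /omega hdotNr cImN -/(omega g g) omega_diag oppr0 !mulr0 cexp0 mulr1.
move=> /(congr1 (fun x => conjc (chi g) * x)).
by rewrite mulr1 mulrA (mulrC (conjc _)) mulcJ_unit ?normc_chi // mul1r.
Qed.

(** Exchanging [g] and [h] in the pseudocharacter relation changes the sign of
[omega], so that [nu * omega g h] is an integral multiple of [pi]. *)
Lemma cexp_2omega g h : G g -> G h -> cexp ('i * (2 * nu * omega g h)%:C) = 1.
Proof.
move=> Gg Gh; have := pchi.2 _ _ Gg Gh; rewrite addrC (pchi.2 _ _ Gh Gg).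
rewrite (mulrC (chi h)) omegaC => /mulfI E.
have c0 x : G x -> chi x != 0.
  by move=> Gx; apply/eqP => hx; have := normc_chi Gx; rewrite hx Normc.normc0 => /eqP; rewrite eq_sym oner_eq0.
have {}E := E (mulf_neq0 (c0 _ Gg) (c0 _ Gh)).
have -> : 'i * (2 * nu * omega g h)%:C =
    'i * (nu * omega g h)%:C + 'i * (nu * omega g h)%:C :> C.
  by rewrite -mulrDr -rmorphD; congr (_ * _%:C); ring.
rewrite cexpD -{1}E -cexpD -mulrDr -rmorphD mulrN addNr mulr0 cexp0 //.
Qed.

End pseudocharacters.

Section theta_growth.
Context {R : realType} (n : nat) (nu : R).
Local Notation C := R[i].
Variables (G : set 'rV[C]_n) (chi : 'rV[C]_n -> C).
Hypotheses (nu0 : 0 < nu) (latG : full_rank_lattice G) (pchi : pseudocharacter nu G chi).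

Lemma theta_deriv f : theta_space nu G chi f -> forall z, exists D, cderivn f z D.
Proof. by case=> hf _; exact: holomorphic_cderivn. Qed.

(** The multiplier has modulus [exp(nu/2 |g|^2 + nu Re<z, g>)], which is exactly the
increment of the exponent [nu/2 |z|^2]. *)
Lemma theta_periodic f z g : theta_space nu G chi f -> G g ->
  normc (f (z + g)) * expR (- (nu / 2) * nrm2 (z + g)) =
  normc (f z) * expR (- (nu / 2) * nrm2 z).
Proof.
move=> [_ Hf] Gg; rewrite (Hf _ _ Gg) 2!Normc.normcM (normc_chi pchi Gg) mul1r.
rewrite normc_cexp mulrAC -expRD mulrC; congr (_ * expR _).
have -> : nrm2 (z + g) = nrm2 z + nrm2 g + 2 * cRe (hdot z g).
  have := congr1 (@complex.Re _) (hdotzz (z + g)); rewrite /= => <-.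
  rewrite hdotDl !hdotDr (hdotC z g) !cReD !hdotzz cReJ /=; ring.
by rewrite hdotzz cReD !cReZ /=; field.
Qed.

(** A continuous periodic function is bounded, since a bounded box meets every
coset of the lattice. *)
Lemma theta_bounded f : theta_space nu G chi f ->
  exists M, forall z, normc (f z) * expR (- (nu / 2) * nrm2 z) <= M.
Proof.
move=> Of; have [B HB] := lattice_cobounded latG.
have cf : ccont (fun z => normc (f z)).
  move=> z e e0; have [D /cderivn_continuous/(_ e e0)[r r0 H]] := theta_deriv Of z.
  exists r => // w wr.
  have := H (w - z); rewrite (addrC z) subrK => {}H.
  have {}H : normc (f w - f z) < e by apply: H => i; rewrite !mxE; exact: wr.
  apply: le_lt_trans H; rewrite ler_norml; apply/andP; split.
    have := le_normcD (f z - f w) (f w); rewrite subrK normcBC; lra.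
  have := le_normcD (f w - f z) (f z); rewrite subrK; lra.
have [M HM] := ccont_bounded_box B cf.
exists M => z; have [g Gg gB] := HB z.
rewrite -{1 2}(subrK g z) theta_periodic //.
apply: le_trans (HM _ gB).
rewrite ler_piMr ?normc_ge0 // -expR0 ler_expR mulNr oppr_le0.
by rewrite mulr_ge0 ?nrm2_ge0 // divr_ge0 // ltW.
Qed.

(** The square root of the weight is attached to each factor of the integrand. *)
Definition theta_weighted (f : 'rV[C]_n -> C) z : C := f z * (expR (- (nu / 2) * nrm2 z))%:C.

Lemma theta_integrandE f1 f2 z :
  theta_integrand nu f1 f2 z = theta_weighted f1 z * conjc (theta_weighted f2 z).
Proof.
rewrite /theta_integrand /theta_weighted hdotzz -rmorphM -rmorphN cexp_real.
have cJ (c : C) (x : R) : conjc (c * x%:C) = conjc c * x%:C by rewrite rmorphM /= oppr0.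
rewrite cJ; have -> : - (nu * nrm2 z) = - (nu / 2) * nrm2 z + - (nu / 2) * nrm2 z by field.
by rewrite expRD rmorphM; ring.
Qed.

Lemma normc_theta_weighted f z : normc (theta_weighted f z) =
  normc (f z) * expR (- (nu / 2) * nrm2 z).
Proof. by rewrite Normc.normcM normcCE ger0_norm ?expR_ge0. Qed.

Lemma cmeasurable_integrand f1 f2 : theta_space nu G chi f1 -> theta_space nu G chi f2 ->
  cmeasurable (theta_integrand nu f1 f2).
Proof.
move=> O1 O2.
have W f : theta_space nu G chi f -> cmeasurable (theta_weighted f).
  move=> Of; apply: cmeasurableM; last exact: cmeasurable_gauss.
  exact/cmeasurable_deriv/theta_deriv.
rewrite (_ : theta_integrand nu f1 f2 =
  fun z => theta_weighted f1 z * conjc (theta_weighted f2 z)); last first.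
  by apply/funext => z; exact: theta_integrandE.
by apply: cmeasurableM; [exact: W|exact/cmeasurableJ/W].
Qed.

Lemma bounded_integrand f1 f2 : theta_space nu G chi f1 -> theta_space nu G chi f2 ->
  exists M, forall z, normc (theta_integrand nu f1 f2 z) <= M.
Proof.
move=> /theta_bounded[M1 H1] /theta_bounded[M2 H2]; exists (M1 * M2) => z.
rewrite theta_integrandE Normc.normcM normcJE !normc_theta_weighted.
by apply: ler_pM => //; rewrite mulr_ge0 ?normc_ge0 ?expR_ge0.
Qed.

End theta_growth.

(** * Holomorphy of series of exponentials *)

Section csumN_sum.
Context {R : realType}.
Local Notation C := R[i].

Lemma csumN_sum (I : Type) (s : seq I) (F : I -> nat -> C) :
  (forall i, abssum (F i)) ->
  abssum (fun k => \sum_(i <- s) F i k) /\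
  csumN (fun k => \sum_(i <- s) F i k) = \sum_(i <- s) csumN (F i).
Proof.
move=> aF; elim: s => [|i s [IH1 IH2]].
  have E : (fun k : nat => \sum_(i <- [::]) F i k) = fun k => 0 * (0 : C).
    by apply/funext => k; rewrite big_nil mul0r.
  rewrite E; have a0 : abssum (fun k : nat => 0 : C).
    rewrite /abssum; under eq_fun do rewrite Normc.normc0.
    by apply: is_cvg_near_cst; exists 0%N => // k _; rewrite /series /= big1.
  by split; [exact: abssumM|rewrite csumNM // mul0r big_nil].
have E : (fun k : nat => \sum_(j <- i :: s) F j k) =
    fun k => F i k + \sum_(j <- s) F j k.
  by apply/funext => k; rewrite big_cons.
by rewrite E big_cons -IH2; split; [exact: abssumD|exact: csumND].
Qed.

Lemma csumNB (f g : nat -> C) : abssum f -> abssum g ->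
  csumN (fun k => f k - g k) = csumN f - csumN g.
Proof.
move=> af ag; rewrite -mulN1r -csumNM // -csumND //; last exact: abssumM.
by congr csumN; apply/funext => k; rewrite mulN1r.
Qed.

Lemma abssumB (f g : nat -> C) : abssum f -> abssum g -> abssum (fun k => f k - g k).
Proof.
move=> af ag; have := abssumD af (abssumM (c := -1) ag).
by congr abssum; apply/funext => k; rewrite mulN1r.
Qed.

End csumN_sum.

Section exponentials.
Context {R : realType} (n : nat).
Local Notation C := R[i].
Implicit Types z w u : 'rV[C]_n.

Definition norm1 u : R := \sum_(i < n) normc (u 0 i).

Lemma norm1_ge0 u : 0 <= norm1 u.
Proof. by apply: sumr_ge0 => i _; exact: normc_ge0. Qed.

Lemma norm1_ge u i : normc (u 0 i) <= norm1 u.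
Proof.
by rewrite /norm1 (bigD1 i) //= lerDl; apply: sumr_ge0 => j _; exact: normc_ge0.
Qed.

Lemma normc_cexp_hdot z u : normc (cexp (hdot z u)) <= expR (norm1 z * norm1 u).
Proof.
rewrite normc_cexp ler_expR; apply: (le_trans (ler_norm _)).
by apply: (le_trans (normc_Re _)); apply: normc_hdot => i; exact: norm1_ge.
Qed.

Lemma cderivn_quadratic (f : 'rV[C]_n -> C) z D (S : R) :
  (forall w M, (forall i, normc (w 0 i) <= M) -> 0 <= M -> M <= 1 ->
    normc (f (z + w) - f z - \sum_(i < n) D i * w 0 i) <= M ^+ 2 * S) ->
  cderivn f z D.
Proof.
move=> H e e0; have p : 0 < `|S| + 1 by rewrite ltr_wpDl.
exists (Num.min 1 (e / (`|S| + 1))); first by rewrite lt_min ltr01 divr_gt0.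
move=> w M wM M0; rewrite lt_min => /andP[M1 Me].
apply: le_trans (H w M wM M0 (ltW M1)) _.
rewrite expr2 -mulrA mulrC ler_wpM2r //.
apply: (@le_trans _ _ (M * (`|S| + 1))).
  by rewrite ler_wpM2l //; have := ler_norm S; lra.
by rewrite -ler_pdivlMr // ltW.
Qed.

(** The polynomial factors in [norm1 u] are absorbed in the exponential, at the
price of the additional 3 in the exponent. *)
Lemma exp_remainder z w u M : (forall i, normc (w 0 i) <= M) -> 0 <= M -> M <= 1 ->
  normc (cexp (hdot (z + w) u) - cexp (hdot z u) - cexp (hdot z u) * hdot w u) <=
  M ^+ 2 * (4 * expR ((norm1 z + 3) * norm1 u)).
Proof.
move=> wM M0 M1; rewrite hdotDl cexpD.
rewrite -[X in _ - X - _]mulr1 -mulrBr -mulrBr Normc.normcM.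
have s0 := norm1_ge0 u.
have hh : normc (hdot w u) <= M * norm1 u by exact: normc_hdot.
have se : norm1 u <= expR (norm1 u) by apply: le_trans (expR_ge1Dx _); rewrite lerDr.
apply: (@le_trans _ _ (expR (norm1 z * norm1 u) *
    (4 * (M * expR (norm1 u)) ^+ 2 * expR (norm1 u)))).
  apply: ler_pM; rewrite ?normc_ge0 ?normc_cexp_hdot //.
  apply: (le_trans (cexp_taylor _)).
  apply: ler_pM; rewrite ?expR_ge0 ?mulr_ge0 ?normc_ge0 //.
    rewrite ler_wpM2l // ler_pXn2r ?nnegrE ?normc_ge0 ?mulr_ge0 ?expR_ge0 //.
    by apply: (le_trans hh); rewrite ler_wpM2l.
  rewrite ler_expR; apply: (le_trans hh).
  by rewrite -[leRHS]mul1r ler_wpM2r.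
have -> : (norm1 z + 3) * norm1 u =
  norm1 z * norm1 u + (norm1 u + norm1 u + norm1 u) by ring.
rewrite !expRD exprMn [expR _ ^+ 2]expr2; set a := expR _; set b := expR _.
by rewrite le_eqVlt; apply/orP; left; apply/eqP; ring.
Qed.

Lemma cderivn_exp u z :
  cderivn (fun z => cexp (hdot z u)) z (fun i => cexp (hdot z u) * conjc (u 0 i)).
Proof.
apply: (@cderivn_quadratic _ _ _ (4 * expR ((norm1 z + 3) * norm1 u))) => w M wM M0 M1.
rewrite (_ : \sum_(i < n) _ = cexp (hdot z u) * hdot w u); first exact: exp_remainder.
by rewrite mulr_sumr; apply: eq_bigr => i _; rewrite mulrAC mulrA.
Qed.

Variables (c : nat -> C) (u : nat -> 'rV[C]_n).
Hypothesis cu : forall r : R, cvgn (series (fun k => normc (c k) * expR (r * norm1 (u k)))).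

Lemma abssum_exp z : abssum (fun k => c k * cexp (hdot z (u k))).
Proof.
apply: (abssum_le_real (K := 1)
  (a := fun k => normc (c k) * expR ((norm1 z) * norm1 (u k))) _ _ (@cu _)) => k; last first.
  by rewrite mulr_ge0 ?normc_ge0 ?expR_ge0.
rewrite mul1r Normc.normcM ler_wpM2l ?normc_ge0 //; exact: normc_cexp_hdot.
Qed.

(** Differentiation term by term.  The remainders of the terms are bounded by
[exp_remainder], whose right-hand side is summable by the hypothesis with [r]
larger by 3. *)
Lemma cderivn_expseries z : exists D,
  cderivn (fun z => csumN (fun k => c k * cexp (hdot z (u k)))) z D.
Proof.
pose E k := c k * cexp (hdot z (u k)).
have aE : abssum E by exact: abssum_exp.
have aD i : abssum (fun k => E k * conjc (u k 0 i)).
  apply: (abssum_le_real (K := 1)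
  (a := fun k => normc (c k) * expR ((norm1 z + 1) * norm1 (u k))) _ _ (@cu _)) => k; last first.
    by rewrite mulr_ge0 ?normc_ge0 ?expR_ge0.
  rewrite mul1r /E 2!Normc.normcM normcJE -mulrA ler_wpM2l ?normc_ge0 //.
  rewrite mulrDl mul1r expRD; apply: ler_pM; rewrite ?normc_ge0 ?normc_cexp_hdot //.
  apply: (le_trans (norm1_ge _ _)); apply: le_trans (expR_ge1Dx _).
  by rewrite lerDr.
exists (fun i => csumN (fun k => E k * conjc (u k 0 i))).
pose b k := normc (c k) * expR ((norm1 z + 3) * norm1 (u k)).
have cb : cvgn (series b) := @cu _.
apply: (@cderivn_quadratic _ _ _ (4 * limn (series b))) => w M wM M0 M1.
have aDw (i : 'I_n) : abssum (fun k => w 0 i * (E k * conjc (u k 0 i))) by exact: abssumM.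
have [aS eS] := csumN_sum (index_enum 'I_n) aDw.
rewrite (_ : \sum_(i < n) _ =
  csumN (fun k => \sum_(i < n) w 0 i * (E k * conjc (u k 0 i)))); last first.
  by rewrite eS; apply: eq_bigr => i _; rewrite csumNM // mulrC.
rewrite -csumNB //; last exact: abssum_exp.
rewrite -csumNB //; last by apply: abssumB => //; exact: abssum_exp.
apply: normc_csumN.
  by apply: abssumB => //; apply: abssumB => //; exact: abssum_exp.
move=> m; apply: (@le_trans _ _ (\sum_(0 <= k < m) M ^+ 2 * 4 * b k)).
  apply: ler_sum => k _.
  rewrite (_ : \sum_(i < n) _ = E k * hdot w (u k)); last first.
    by rewrite mulr_sumr; apply: eq_bigr => i _; rewrite mulrCA.
  rewrite /E -(mulrA (c k)) -2!mulrBr Normc.normcM /b [leRHS]mulrCA.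
  rewrite ler_wpM2l ?normc_ge0 // -(mulrA (M ^+ 2)); exact: exp_remainder.
rewrite -mulr_sumr mulrA ler_wpM2l ?mulr_ge0 ?sqr_ge0 //.
have := nondecreasing_cvgn_le (u_ := series b); apply => //.
by apply: nondecreasing_series => k _ _; rewrite mulr_ge0 ?normc_ge0 ?expR_ge0.
Qed.

End exponentials.

Section holomorphic_operations.
Context {R : realType} (n : nat).
Local Notation C := R[i].
Implicit Types f g : 'rV[C]_n -> C.

Lemma holomorphicM f g : @holomorphic R n f -> @holomorphic R n g ->
  @holomorphic R n (fun z => f z * g z).
Proof. by move=> hf hg x; exact: (differentiableM (hf x) (hg x)). Qed.

Lemma holomorphic_cst (a : C) : @holomorphic R n (fun=> a).
Proof. by move=> x; exact: differentiable_cst. Qed.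

Lemma holomorphic_comb f g (a : C) : @holomorphic R n f -> @holomorphic R n g ->
  @holomorphic R n (fun z => a * f z + g z).
Proof.
move=> hf hg; suff h : @holomorphic R n (fun z => a * f z).
  by move=> x; exact: (differentiableD (h x) (hg x)).
move=> x; exact: (differentiableM (holomorphic_cst a x) (hf x)).
Qed.

Lemma cderivn_shift f (a z : 'rV[C]_n) D : cderivn f (z + a) D ->
  cderivn (fun z => f (z + a)) z D.
Proof.
move=> H e e0; have [r r0 Hr] := H e e0; exists r => // w M wM M0 Mr.
by have := Hr w M wM M0 Mr; rewrite (addrAC z a).
Qed.

End holomorphic_operations.

(** * The kernel *)

Section kernel_enum.
Context {R : realType} (n : nat) (nu : R).
Local Notation C := R[i].
Variables (G L : set 'rV[C]_n) (chi : 'rV[C]_n -> C) (e : nat -> 'rV[C]_n).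
Hypotheses (nu0 : 0 < nu) (pchi : pseudocharacter nu G chi)
  (fd : fundamental_domain G L)
  (einj : injective e) (eG : forall g, G g <-> exists k, e k = g).

Let Ge k : G (e k).
Proof. by apply/eG; exists k. Qed.

(** A linear exponent is dominated by the quadratic one of the kernel coefficients. *)
Lemma norm1_le (u : 'rV[C]_n) r : r * norm1 u <= nrm2 u / 8 + n%:R * (2 * r ^+ 2).
Proof.
have -> : n%:R * (2 * r ^+ 2) = \sum_(i < n) (2 * r ^+ 2).
  by rewrite big_const_ord iter_addr_0 mulr_natl.
rewrite /norm1 /nrm2 mulr_sumr mulr_suml -big_split /=; apply: ler_sum => i _.
move: (normc _) => x; rewrite -subr_ge0.
have -> : x ^+ 2 / 8 + 2 * r ^+ 2 - r * x = 2 * (r - x / 4) ^+ 2 by field.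
by rewrite mulr_ge0 ?sqr_ge0.
Qed.

(** [kernel_coef] and [kernel_freq] display the kernel series as a series of
exponentials in its first variable. *)
Definition kernel_coef w k : C :=
  chi (e k) * cexp (- ((nu / 2)%:C * hdot (e k) (e k)) - nu%:C * hdot (e k) w).

Definition kernel_freq k : 'rV[C]_n := nu%:C *: e k.

Lemma kernel_termE z w k :
  kernel_term nu chi z w (e k) = kernel_coef w k * cexp (hdot z (kernel_freq k)).
Proof.
rewrite /kernel_term /kernel_coef -mulrA -cexpD; congr (_ * cexp _).
by rewrite hdotZr -(hdotC w) mulrBr; ring.
Qed.

Lemma kernel_coef_summable w r :
  cvgn (series (fun k => normc (kernel_coef w k) * expR (r * norm1 (kernel_freq k)))).
Proof.
have nu4 : 0 < nu / 4 by rewrite divr_gt0.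
apply: (@summable_le _ _ _ (expR (nu * (2 * nrm2 w + n%:R * (2 * r ^+ 2)))) _ _
  (lattice_gauss_summable fd einj eG nu4)) => k; last exact: expR_ge0.
rewrite mulr_ge0 ?normc_ge0 ?expR_ge0 //= /kernel_coef Normc.normcM.
rewrite (normc_chi pchi (Ge k)) mul1r normc_cexp -!expRD ler_expR.
have -> : norm1 (kernel_freq k) = nu * norm1 (e k).
  rewrite /norm1 mulr_sumr; apply: eq_bigr => i _.
  by rewrite mxE Normc.normcM normcCE gtr0_norm.
rewrite hdotzz cReB cReN !cReZ /=.
have h1 := norm1_le (e k) r.
have h2 : - cRe (hdot (e k) w) <= nrm2 (e k) / 8 + 2 * nrm2 w.
  have := @hdot_young R n w (e k) 8^-1; rewrite invr_gt0 ltr0n => /(_ isT).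
  rewrite hdotC normcJE (_ : (4 * 8^-1)^-1 = 2 :> R); last by field.
  by have := normc_Re (hdot (e k) w); rewrite ler_norml; lra.
have := ler_wpM2l (ltW nu0) (lerD h1 h2); lra.
Qed.

Lemma abssum_kernel z w : abssum (fun k => kernel_term nu chi z w (e k)).
Proof.
rewrite (_ : (fun k => _) = fun k => kernel_coef w k * cexp (hdot z (kernel_freq k))).
  by apply: abssum_exp => r; exact: kernel_coef_summable.
by apply/funext => k; exact: kernel_termE.
Qed.

Lemma csummable_kernel z w : csummable G (kernel_term nu chi z w).
Proof. exact: (csummable_enum einj eG (@abssum_kernel z w)). Qed.

Lemma theta_kernelE z w : theta_kernel nu G chi z w =
  ((nu / pi) ^+ n)%:C * cexp (nu%:C * hdot z w) *
  csumN (fun k => kernel_term nu chi z w (e k)).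
Proof. by rewrite /theta_kernel (csum_enum einj eG (@abssum_kernel z w)). Qed.

Lemma holomorphic_kernel w : @holomorphic R n (fun z => theta_kernel nu G chi z w).
Proof.
rewrite (_ : (fun z => _) = fun z => cexp (hdot z (nu%:C *: w)) *
  (((nu / pi) ^+ n)%:C * csumN (fun k => kernel_coef w k * cexp (hdot z (kernel_freq k))))).
  apply: holomorphicM; first by apply: cderivn_holomorphic => z; eexists; exact: cderivn_exp.
  apply: holomorphicM; first exact: holomorphic_cst.
  apply: cderivn_holomorphic => z; apply: cderivn_expseries => r.
  exact: kernel_coef_summable.
apply/funext => z; rewrite theta_kernelE hdotZr [RHS]mulrCA [RHS]mulrA; congr (_ * csumN _).
by apply/funext => k; exact: kernel_termE.
Qed.

End kernel_enum.

Section kernel.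
Context {R : realType} (n : nat) (nu : R).
Local Notation C := R[i].
Variables (G L : set 'rV[C]_n) (chi : 'rV[C]_n -> C) (e : nat -> 'rV[C]_n).
Hypotheses (nu0 : 0 < nu) (sG : additive_subgroup G) (pchi : pseudocharacter nu G chi)
  (fd : fundamental_domain G L)
  (einj : injective e) (eG : forall g, G g <-> exists k, e k = g).

(** The pseudocharacter relation produces a factor [exp(i nu omega(g, d))] and the
quadratic exponent another one; they combine to [exp(2 i nu omega(g, d))], which
is 1 on the lattice. *)
Lemma kernel_term_shift z w g d : G g -> G d ->
  cexp (nu%:C * hdot (z + g) w) * kernel_term nu chi (z + g) w (g + d) =
  chi g * cexp ((nu / 2)%:C * hdot g g + nu%:C * hdot z g) *
  (cexp (nu%:C * hdot z w) * kernel_term nu chi z w d).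
Proof.
move=> Gg Gd; rewrite /kernel_term (pchi.2 _ _ Gg Gd).
set X := cexp (nu%:C * hdot (z + g) w); set Y := cexp ('i * _).
set Z := cexp (- _ + _); set X' := cexp (_ + _); set Y' := cexp (_ * hdot z w).
set Z' := cexp (_ + _).
suff E : X * Y * Z = X' * Y' * Z'.
  transitivity (chi g * chi d * (X * Y * Z)); first by ring.
  by rewrite E; ring.
rewrite /X /Y /Z /X' /Y' /Z' -!cexpD.
rewrite -[RHS]mul1r -(cexp_2omega pchi Gg Gd) -cexpD.
congr cexp; rewrite -!(hdotC w) !hdotDl !hdotDr (hdotC g d).
have -> : conjc (hdot g d) = hdot g d - 'i * (omega g d)%:C *+ 2.
  by rewrite /omega; case: (hdot g d) => a b; apply: eqcP; rewrite !cReIm /=; ring.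
rewrite -mulrA !rmorphM /= [2%:C](_ : _ = 2); last by rewrite rmorph_nat.
rewrite [(2^-1)%:C](_ : _ = 2^-1); last by rewrite fmorphV rmorph_nat.
by field.
Qed.

Lemma enum_shift g : G g -> injective (fun k => g + e k) /\
  forall h, G h <-> exists k, g + e k = h.
Proof.
move=> Gg; split=> [k l /addrI/einj //|h]; split=> [Gh|[k <-]].
  have /eG[k Ek] := subgroupB sG Gh Gg.
  by exists k; rewrite Ek addrC subrK.
by apply: (subgroupD sG) => //; apply/eG; exists k.
Qed.

(** The series is invariant under reindexing, so that it can be summed over [g + d]
for the value at [z + g]. *)
Lemma theta_space_kernel w : theta_space nu G chi (fun z => theta_kernel nu G chi z w).
Proof.
split; first exact: (holomorphic_kernel nu0 pchi fd einj eG).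
move=> z g Gg; have [einj' eG'] := enum_shift Gg.
rewrite (theta_kernelE nu0 pchi fd einj' eG') (theta_kernelE nu0 pchi fd einj eG).
have a1 := @abssum_kernel _ _ _ _ _ _ _ nu0 pchi fd einj' eG' (z + g) w.
have a2 := @abssum_kernel _ _ _ _ _ _ _ nu0 pchi fd einj eG z w.
have {}a1 := csumNM (cexp (nu%:C * hdot (z + g) w)) a1.
have {}a3 := csumNM (cexp (nu%:C * hdot z w)) a2.
have a4 := csumNM (chi g * cexp ((nu / 2)%:C * hdot g g + nu%:C * hdot z g))
  (@abssumM _ (cexp (nu%:C * hdot z w)) _ a2).
rewrite -[LHS]mulrA -a1 -[X in _ = _ * X]mulrA -a3 [RHS]mulrCA -a4.
congr (_ * csumN _); apply/funext => k.
by rewrite kernel_term_shift //; apply/eG; exists k.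
Qed.

End kernel.

(** * Integration over the fundamental domain *)

Section integral_Cn.
Context {R : realType} (n : nat).
Local Notation mR := (measurableTypeR R).
Local Notation plane := (mR * mR)%type.
Local Notation C := R[i].
Local Notation T := (n.-tuple plane).
Local Notation cT := (caratheodory_type (lebesgue_tuple n)^*%mu).
Local Notation mu := (@lebesgue_tuple R n).
Local Notation lc := (@lebesgue_Cn R n).
Variable L : set 'rV[C]_n.
Let Lam : set cT := @tuple_Cn R n @^-1` L.
Hypotheses (mL : measurable Lam) (finL : (vol L < +oo)%E).
Implicit Types F H : 'rV[C]_n -> C.

(** The class of functions, stable under linear combinations, whose integrability
over the domain needs no further argument. *)
Definition cbounded F : Prop := cmeasurable F /\ exists M, forall z, normc (F z) <= M.

Lemma cmeasurable_Lam (f : 'rV[C]_n -> R) :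
  measurable_fun setT (fun t : T => f (tuple_Cn t)) ->
  measurable_fun Lam (fun x : cT => f (tuple_Cn x)).
Proof.
move=> mf; apply/measurable_EFinP; apply: measurable_funTS.
by apply: (measurable_fun_completion (m := mu)) => //; exact/measurable_EFinP.
Qed.

Lemma integrable_Lam (f : 'rV[C]_n -> R) (M : R) :
  measurable_fun setT (fun t : T => f (tuple_Cn t)) -> (forall z, `|f z| <= M) ->
  lc.-integrable Lam (EFin \o (fun x : cT => f (tuple_Cn x))).
Proof.
move=> mf fM.
apply: (measurable_bounded_integrable mL finL (cmeasurable_Lam mf)).
by exists M; split; [exact: num_real|move=> y My x _; exact: le_trans (fM _) (ltW My)].
Qed.

Lemma cbounded_integrable F : cbounded F -> integrable_Cn L F.
Proof.
move=> [[m1 m2] [M FM]]; split.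
  apply: (@integrable_Lam (fun z => cRe (F z)) M m1) => z.
  exact: le_trans (normc_Re _) (FM z).
apply: (@integrable_Lam (fun z => cIm (F z)) M m2) => z.
exact: le_trans (normc_Im _) (FM z).
Qed.

Lemma eq_integral_Cn F H : (forall z, F z = H z) -> integral_Cn L F = integral_Cn L H.
Proof. by move=> FH; congr integral_Cn; exact/funext. Qed.

Lemma integral_Cn_linear (a : C) F H : integrable_Cn L F -> integrable_Cn L H ->
  integral_Cn L (fun z => a * F z + H z) = a * integral_Cn L F + integral_Cn L H.
Proof.
move=> [f1 f2] [h1 h2].
have Z (b : R) (f : cT -> R) : lc.-integrable Lam (EFin \o f) ->
    lc.-integrable Lam (EFin \o (fun x => b * f x)).
  by move=> jf; exact: (integrableZl mL b jf).
have D (f g : cT -> R) : lc.-integrable Lam (EFin \o f) -> lc.-integrable Lam (EFin \o g) ->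
    lc.-integrable Lam (EFin \o (fun x => f x + g x)).
  by move=> jf jg; exact: (integrableD mL jf jg).
apply: eqcP; rewrite !cReIm /=.
  transitivity (\int[lc]_(x in Lam) ((cRe a * cRe (F (tuple_Cn x)) +
      (- cIm a) * cIm (F (tuple_Cn x))) + cRe (H (tuple_Cn x)))).
    by apply: eq_Rintegral => x _; rewrite !cReIm mulNr.
  rewrite RintegralD //; last by apply: D; exact: Z.
  rewrite RintegralD //; try exact: Z.
  rewrite RintegralZl // RintegralZl // mulNr //.
transitivity (\int[lc]_(x in Lam) ((cRe a * cIm (F (tuple_Cn x)) +
      cIm a * cRe (F (tuple_Cn x))) + cIm (H (tuple_Cn x)))).
  by apply: eq_Rintegral => x _; rewrite !cReIm.
rewrite RintegralD //; last by apply: D; exact: Z.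
rewrite RintegralD //; try exact: Z.
rewrite RintegralZl // RintegralZl //.
Qed.

Lemma integral_CnZ (a : C) F : integrable_Cn L F ->
  integral_Cn L (fun z => a * F z) = a * integral_Cn L F.
Proof.
move=> jF; have j0 : integrable_Cn L (fun=> 0 : C) by split; exact: integrable0.
have I0 : integral_Cn L (fun=> 0 : C) = 0.
  by apply: eqcP; rewrite /= /Rintegral integral0.
by rewrite -[RHS]addr0 -I0 -integral_Cn_linear //; apply: eq_integral_Cn => z; rewrite addr0.
Qed.

Lemma integral_Cn_conj F : integrable_Cn L F ->
  integral_Cn L (fun z => conjc (F z)) = conjc (integral_Cn L F).
Proof.
move=> [f1 f2]; apply: eqcP; rewrite !cReIm /=.
  by apply: eq_Rintegral => x _; rewrite cReJ.
transitivity (\int[lc]_(x in Lam) (-1 * cIm (F (tuple_Cn x)))).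
  by apply: eq_Rintegral => x _; rewrite cImJ mulN1r.
by rewrite RintegralZl // mulN1r.
Qed.

Lemma normc_integral_Cn (F : 'rV[C]_n -> C) M : cmeasurable F -> (forall z, normc (F z) <= M) ->
  normc (integral_Cn L F) <= 2 * M * fine (vol L).
Proof.
move=> [m1 m2] FM.
have B (f : 'rV[C]_n -> R) : measurable_fun setT (fun t : T => f (tuple_Cn t)) ->
    (forall z, `|f z| <= M) -> `|\int[lc]_(x in Lam) f (tuple_Cn x)| <= M * fine (vol L).
  move=> mf fM; have jf := @integrable_Lam f M mf fM.
  apply: le_trans (le_normr_Rintegral mL jf) _.
  rewrite -(Rintegral_cst lc mL); apply: le_Rintegral => //.
  - exact: (integrable_norm jf).
  - exact: (@integrable_Lam (fun=> M) `|M|).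
apply: (le_trans (normc_leD _)); rewrite -mulrA mulrDl mul1r /=; apply: lerD.
  by apply: (B (fun z => cRe (F z))) => // z; exact: le_trans (normc_Re _) (FM z).
by apply: (B (fun z => cIm (F z))) => // z; exact: le_trans (normc_Im _) (FM z).
Qed.

End integral_Cn.

(** * The reproducing property *)

Section gaussian_mean_at.
Context {R : realType} (n : nat) (nu M : R).
Local Notation C := R[i].
Local Notation mu := (@lebesgue_tuple R n).
Variables (f : 'rV[C]_n -> C).
Hypotheses (nu0 : 0 < nu) (hf : @holomorphic R n f)
  (fM : forall z, normc (f z) * expR (- (nu / 2) * nrm2 z) <= M).

(** The integrand of the reproducing formula of the Fock space at the point [w], of
which the lattice sum in the kernel is the periodization. *)
Definition coherent (w z : 'rV[C]_n) : C :=
  f z * cexp (nu%:C * hdot w z - nu%:C * hdot z z).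

Lemma coherent_bound w z : normc (coherent w z) <=
  M * expR (nu * nrm2 w) * expR (- (nu / 4) * nrm2 z).
Proof.
rewrite /coherent Normc.normcM normc_cexp hdotzz cReB !cReZ /=.
have fz : normc (f z) <= M * expR (nu / 2 * nrm2 z).
  have := ler_wpM2r (expR_ge0 (nu / 2 * nrm2 z)) (fM z).
  by rewrite -(mulrA (normc _)) -expRD mulNr addNr expR0 mulr1.
have M0 : 0 <= M.
  by rewrite -(pmulr_lge0 _ (expR_gt0 (nu / 2 * nrm2 z))); exact: le_trans (normc_ge0 _) fz.
apply: (le_trans (ler_wpM2r (expR_ge0 _) fz)).
rewrite -!(mulrA M) ler_wpM2l // -!expRD ler_expR.
have := @hdot_young R n w z 4^-1; rewrite invr_gt0 ltr0n => /(_ isT).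
rewrite mulfV // invr1 mul1r => h1.
have h2 : cRe (hdot w z) <= 4^-1 * nrm2 z + nrm2 w.
  exact: le_trans (ler_norm _) (le_trans (normc_Re _) h1).
by have := ler_wpM2l (ltW nu0) h2; lra.
Qed.

Lemma cmeasurable_coherent w : cmeasurable (coherent w).
Proof.
rewrite (_ : coherent w = fun z => f z * (conjc (cexp (hdot z (nu%:C *: w))) *
    (expR (- nu * nrm2 z))%:C)).
  apply: cmeasurableM.
    by apply: cmeasurable_deriv => z; exact: (holomorphic_cderivn hf).
  apply: cmeasurableM; last exact: cmeasurable_gauss.
  by apply: cmeasurableJ; apply: cmeasurable_deriv => z; eexists; exact: cderivn_exp.
apply/funext => z; congr (_ * _).
rewrite -cexp_real -cexpJ -cexpD; congr cexp.
by rewrite hdotzz hdotZr (hdotC w) rmorphM /= oppr0 mulNr rmorphN rmorphM conjcK.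
Qed.

(** Translation by [w] turns the integrand into [f(z + w) exp(-nu <z, w>)] times the
centred Gaussian, and the holomorphic factor has value [f(w)] at 0. *)
Lemma gaussian_mean_at w :
  (\int[mu]_t (cRe (coherent w (tuple_Cn t)))%:E =
   ((pi / nu) ^+ n * cRe (f w))%:E)%E.
Proof.
pose g z := f (z + w) * cexp (hdot z ((- nu)%:C *: w)).
have coh z : coherent w (z + w) = g z * (expR (- nu * nrm2 z))%:C.
  rewrite /coherent /g -mulrA -cexp_real -cexpD; congr (_ * cexp _).
  have -> : (- nu * nrm2 z)%:C = - (nu%:C * hdot z z) :> C.
    by rewrite hdotzz -rmorphM -rmorphN mulNr.
  by rewrite hdotZr !hdotDr !hdotDl rmorphN; ring.
have hg z : exists D, cderivn g z D.
  apply: holomorphic_cderivn; apply: holomorphicM; apply: cderivn_holomorphic => x.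
    by have [D HD] := holomorphic_cderivn hf (x + w); exists D; exact: cderivn_shift.
  by eexists; exact: cderivn_exp.
have nu8 : 0 < nu / 8 by rewrite divr_gt0.
have M0 : 0 <= M.
  by apply: le_trans (fM 0); rewrite mulr_ge0 ?normc_ge0 ?expR_ge0.
have gK z : normc (g z) * expR (- nu * nrm2 z) <=
    (M * expR (nu * nrm2 w + nu / 4 * nrm2 w)) * expR (- (nu / 8) * nrm2 z).
  have -> : normc (g z) * expR (- nu * nrm2 z) = normc (coherent w (z + w)).
    by rewrite coh [RHS]Normc.normcM normcCE ger0_norm ?expR_ge0.
  apply: (le_trans (coherent_bound _ _)); rewrite -!(mulrA M) ler_wpM2l //.
  rewrite -!expRD ler_expR.
  have := nrm2D (z + w) (- w); rewrite addrK nrm2N => h.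
  by have := ler_wpM2l (ltW nu8) h; lra.
have := gaussian_mean_Re nu8 nu0 hg gK.
rewrite {2}/g add0r (_ : hdot 0 _ = 0); last first.
  by apply: big1 => i _; rewrite mxE mul0r.
rewrite cexp0 mulr1 => <-.
have mc := (cmeasurable_coherent w).1.
have := integral_preserving (preserving_shiftT w) measurableT
  (proj2 (measurable_EFinP _ _) mc).
rewrite preimage_setT => <-; apply: eq_integral => t _; congr EFin.
by rewrite tuple_Cn_shift coh cReM /= mulr0 subr0 /gaussT nrm2TE.
Qed.

End gaussian_mean_at.

Section csumN_conj.
Context {R : realType}.
Local Notation C := R[i].

Lemma abssum_conj (f : nat -> C) : abssum f -> abssum (fun k => conjc (f k)).
Proof. by rewrite /abssum; under [in X in _ -> X]eq_fun do rewrite normcJE. Qed.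

Lemma csumN_conj (f : nat -> C) : abssum f ->
  csumN (fun k => conjc (f k)) = conjc (csumN f).
Proof.
move=> af; apply: eqcP; rewrite !cReIm /=.
  by congr (limn (series _)); apply/funext => k; rewrite cReJ.
rewrite -limN; last exact: abssum_Im af.
congr (limn _); apply/funext => m; rewrite /series /= fctE -sumrN.
by apply: eq_bigr => k _; rewrite cImJ.
Qed.

End csumN_conj.

Section reproducing.
Context {R : realType} (n : nat) (nu : R).
Local Notation C := R[i].
Variables (G L : set 'rV[C]_n) (chi : 'rV[C]_n -> C) (e : nat -> 'rV[C]_n).
Hypotheses (nu0 : 0 < nu) (latG : full_rank_lattice G) (pchi : pseudocharacter nu G chi)
  (fd : fundamental_domain G L)
  (einj : injective e) (eG : forall g, G g <-> exists k, e k = g).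
Let sG : additive_subgroup G. Proof. by case: latG. Qed.
Let finL : (vol L < +oo)%E := vol_domain_fin latG fd einj eG.
Let mL := measurable_domain fd.
Variables (f : 'rV[C]_n -> C) (w : 'rV[C]_n).
Hypothesis Of : theta_space nu G chi f.

(** The transformation law of [f] matches the summand of the kernel at [- g]. *)
Lemma coherent_translate z g : G g ->
  f z * cexp (nu%:C * hdot w z) * conjc (kernel_term nu chi z w (- g)) *
    cexp (- (nu%:C * hdot z z)) = coherent nu f w (z + g).
Proof.
move=> Gg; rewrite /coherent (Of.2 _ _ Gg) /kernel_term (chiN sG pchi Gg).
have cD (x y : C) : conjc (x + y) = conjc x + conjc y := rmorphD _ x y.
have cN (x : C) : conjc (- x) = - conjc x := rmorphN _ x.
have cR (x : R) : conjc x%:C = x%:C :> C by rewrite /= oppr0.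
rewrite conjcM conjcK -cexpJ.
set X := cexp (nu%:C * hdot w z); set Y := cexp (conjc _); set Z := cexp (- _).
set X' := cexp (_ + _); set Y' := cexp _.
suff E : X * Y * Z = X' * Y'.
  transitivity (f z * chi g * (X * Y * Z)); first by ring.
  by rewrite E; ring.
rewrite /X /Y /Z /X' /Y' -!cexpD; congr cexp.
rewrite !hdotNr !hdotNl !hdotDr !hdotDl !(cD, cN, conjcM, cR) !conjcK -!(hdotC _ _).
have -> : nu%:C = (nu / 2)%:C + (nu / 2)%:C :> C.
  by rewrite -rmorphD; congr (_%:C); field.
ring.
Qed.

Lemma integrand_kernel z : theta_integrand nu f (fun z => theta_kernel nu G chi z w) z =
  ((nu / pi) ^+ n)%:C * csumN (fun k => coherent nu f w (z + e k)).
Proof.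
(* The kernel is summed over [- e k], the enumeration that matches the translates
of the unfolded integral. *)
have einj' : injective (fun k => - e k) by move=> k l /oppr_inj/einj.
have eG' g : G g <-> exists k, - e k = g.
  split=> [Gg|[k <-]]; last by apply: (subgroupN sG); apply/eG; exists k.
  by have /eG[k Ek] := subgroupN sG Gg; exists k; rewrite Ek opprK.
rewrite /theta_integrand (theta_kernelE nu0 pchi fd einj' eG').
have ak := @abssum_kernel _ _ _ _ _ _ _ nu0 pchi fd einj' eG' z w.
rewrite (conjcM _ (csumN _)) -csumN_conj // (conjcM (_%:C)) -cexpJ.
have -> : conjc (nu%:C * hdot z w) = nu%:C * hdot w z.
  by rewrite conjcM (hdotC z w) /= oppr0.
have -> : conjc ((nu / pi) ^+ n)%:C = ((nu / pi) ^+ n)%:C :> C by rewrite /= oppr0.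
have {}ak := @abssum_conj _ _ ak.
set A := ((nu / pi) ^+ n)%:C; set X := cexp (nu%:C * _); set Z := cexp _.
set S := csumN _.
transitivity (A * (f z * X * Z * S)); first by ring.
rewrite /S -csumNM //; congr (_ * csumN _); apply/funext => k.
by rewrite -coherent_translate; [rewrite mulrAC|apply/eG; exists k].
Qed.

(** The integral over the domain of a periodization is the integral over the whole
space.  The imaginary part is the real part for [- i f]. *)
Lemma theta_reproducing :
  theta_product nu L f (fun z => theta_kernel nu G chi z w) = f w.
Proof.
have [M fM] := theta_bounded nu0 latG pchi Of.
have hf : @holomorphic R n f := Of.1.
have nu4 : 0 < nu / 4 by rewrite divr_gt0.
pose F z := csumN (fun k => coherent nu f w (z + e k)).
have cb := coherent_bound nu0 fM w; have [m1 m2] := cmeasurable_coherent nu hf w.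
have [i1 E1] := integral_unfold_signed fd einj eG nu4 m1
  (fun z => le_trans (normc_Re _) (cb z)).
have [i2 E2] := integral_unfold_signed fd einj eG nu4 m2
  (fun z => le_trans (normc_Im _) (cb z)).
have iF : integrable_Cn L F by [].
rewrite /theta_product (eq_integral_Cn L integrand_kernel) integral_CnZ //.
have -> : integral_Cn L F = ((pi / nu) ^+ n)%:C * f w.
  apply: eqcP; rewrite cReIm /= /Rintegral ?E1 ?E2.
    by rewrite (gaussian_mean_at nu0 hf fM) /= mul0r subr0.
  pose f' z := - 'i * f z.
  have hf' : @holomorphic R n f'.
    exact: (holomorphicM (@holomorphic_cst R n (- 'i)) hf).
  have fM' z : normc (f' z) * expR (- (nu / 2) * nrm2 z) <= M.
    rewrite /f' Normc.normcM normcN (_ : normc 'i = 1) ?mul1r //.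
    by rewrite /= expr0n expr1n add0r sqrtr1.
  have := gaussian_mean_at nu0 hf' fM' w.
  have Ei (z : C) : cRe (- 'i * z) = cIm z by case: z => a b; rewrite !cReIm /=; ring.
  rewrite (_ : (fun t => _) = fun t => (cIm (coherent nu f w (tuple_Cn t)))%:E); last first.
    by apply/funext => t; rewrite /coherent /f' -mulrA Ei.
  by move=> ->; rewrite /= Ei mul0r addr0.
rewrite mulrA -rmorphM -exprMn (_ : nu / pi * (pi / nu) = 1) ?expr1n ?mul1r //.
by rewrite mulrA divfK ?mulfV ?lt0r_neq0 ?pi_gt0.
Qed.

End reproducing.

(** * Reproducing kernels and orthonormal families *)

Section hilbert.
Context {R : realType} {X : Type}.
Local Notation C := R[i].
Variables (H : set (X -> C)) (ip : (X -> C) -> (X -> C) -> C) (K : X -> X -> C).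
Hypotheses (HL : linear_subspace H)
  (ipl : forall (a : C) f g h, H f -> H g -> H h ->
    ip (fun x => a * f x + g x) h = a * ip f h + ip g h)
  (ipC : forall f g, H f -> H g -> ip g f = conjc (ip f g))
  (ip_ge0 : forall f, H f -> 0 <= ip f f)
  (HK : reproducing_kernel H ip K).

Definition sqn f : R := cRe (ip f f).

Lemma ipff f : H f -> ip f f = (sqn f)%:C.
Proof. by move=> /ip_ge0; rewrite /sqn; case: (ip f f) => a b; rewrite lecE /= => /andP[/eqP -> _]. Qed.

Lemma sqn_ge0 f : H f -> 0 <= sqn f.
Proof. by move=> Hf; have := ip_ge0 Hf; rewrite ipff // lecR. Qed.

Lemma sqn_comb (a : C) f h : H f -> H h -> sqn (fun x => a * h x + f x) =
  normc a ^+ 2 * sqn h + 2 * cRe (a * conjc (ip f h)) + sqn f.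
Proof.
move=> Hf Hh; have Hg := HL.2 a h f Hh Hf; set g := fun x => _ in Hg *.
rewrite /sqn /g (ipl a Hh Hf Hg) (ipC Hg Hh) (ipC Hg Hf) !ipl //.
rewrite (ipC Hf Hh) !ipff //; case: (ip f h) => x y; case: a @g Hg => u v g Hg.
by rewrite -/(sqn h) -/(sqn f) sqr_normcE !cReIm /=; ring.
Qed.

(** Only positivity is assumed, so [sqn h] may vanish for a nonzero
[h]; in that case the quadratic polynomial [Q] is affine and bounded below, hence
constant. *)
Lemma cauchy_schwarz f h : H f -> H h -> normc (ip f h) ^+ 2 <= sqn f * sqn h.
Proof.
move=> Hf Hh; set c := ip f h; set N := normc c ^+ 2.
have N0 : 0 <= N by exact: sqr_ge0.
have Q t : 0 <= t ^+ 2 * N * sqn h - 2 * t * N + sqn f.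
  have := sqn_ge0 (HL.2 (- (t%:C * c)) h f Hh Hf).
  rewrite sqn_comb // -/c normcN Normc.normcM normcCE exprMn real_normK ?num_real //.
  rewrite mulNr -(mulrA t%:C) mulcJ_normc -rmorphM /= -/N; lra.
have := sqn_ge0 Hh; rewrite le_eqVlt => /orP[/eqP h0|hp].
  rewrite -h0 mulr0; have [->//|N1] := eqVneq N 0.
  have := Q ((sqn f + 1) / (2 * N)); rewrite -h0 mulr0 add0r.
  have -> : 2 * ((sqn f + 1) / (2 * N)) * N = sqn f + 1 by field.
  lra.
have := Q (sqn h)^-1.
have -> : (sqn h)^-1 ^+ 2 * N * sqn h - 2 * (sqn h)^-1 * N + sqn f = sqn f - N / sqn h.
  by field; rewrite gt_eqF.
by rewrite subr_ge0 ler_pdivrMr.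
Qed.

Lemma reproducing_sqn w : K w w = (sqn (K^~ w))%:C.
Proof. by have Hk := (HK w).1; have := (HK w).2 _ Hk; rewrite ipff. Qed.

Lemma evaluation_bound f w : H f -> normc (f w) ^+ 2 <= sqn f * sqn (K^~ w).
Proof. by move=> Hf; rewrite -{1}((HK w).2 f Hf); apply: cauchy_schwarz => //; exact: (HK w).1. Qed.

(** Definiteness is a consequence of the reproducing property. *)
Lemma sqn_eq0 f : H f -> sqn f = 0 -> f = fun=> 0.
Proof.
move=> Hf f0; apply/funext => w; apply: Normc.eq0_normc.
have := evaluation_bound w Hf; rewrite f0 mul0r => h.
by apply/eqP; rewrite -sqrf_eq0 eq_le h sqr_ge0.
Qed.

Lemma reproducing_evaluation w : exists M : R, forall f, H f ->
  `|f w| <= (M * ip_norm ip f)%:C.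
Proof.
exists (Num.sqrt (sqn (K^~ w))) => f Hf.
have s0 := sqn_ge0 Hf; have k0 := sqn_ge0 (HK w).1.
rewrite normrcE lecR /ip_norm -/(sqn f).
by rewrite mulrC -sqrtrM // -[normc _](ger0_norm (normc_ge0 _)) -sqrtr_sqr ler_wsqrtr // evaluation_bound.
Qed.

Section families.
Variables (m : nat) (f : 'I_m -> X -> C).
Hypothesis Hf : forall i, H (f i).

Definition comb (c : 'I_m -> C) : X -> C := fun x => \sum_(i < m) c i * f i x.

Let psum c (s : seq 'I_m) := fun x => \sum_(i <- s) c i * f i x.

Let psum_mem c s : H (psum c s) /\ forall h, H h ->
  ip (psum c s) h = \sum_(i <- s) c i * ip (f i) h.
Proof.
have ip0 h : H h -> ip (fun=> 0) h = 0.
  move=> Hh; have := ipl (-1) HL.1 HL.1 Hh.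
  rewrite (_ : (fun x => _) = fun=> 0); last by apply/funext => x; rewrite mulr0 addr0.
  by rewrite mulN1r addNr.
elim: s => [|i s [IH1 IH2]].
  have -> : psum c [::] = fun=> 0 by apply/funext => x; rewrite /psum big_nil.
  by split=> [|h Hh]; [exact: HL.1|rewrite big_nil ip0].
have -> : psum c (i :: s) = fun x => c i * f i x + psum c s x.
  by apply/funext => x; rewrite /psum big_cons.
split=> [|h Hh]; first exact: HL.2.
by rewrite big_cons ipl // IH2.
Qed.

Lemma comb_mem c : H (comb c). Proof. exact: (psum_mem c _).1. Qed.

Lemma ip_comb c h : H h -> ip (comb c) h = \sum_(i < m) c i * ip (f i) h.
Proof. exact: (psum_mem c _).2. Qed.

End families.

Definition orthonormal_in m (f : 'I_m -> X -> C) : Prop :=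
  (forall i, H (f i)) /\ forall i j, ip (f i) (f j) = (i == j)%:R.

Section orthonormal_family.
Variables (m : nat) (f : 'I_m -> X -> C).
Hypothesis onf : orthonormal_in f.
Let Hf := onf.1.

Lemma ip_comb_orthonormal c j : ip (comb f c) (f j) = c j.
Proof.
rewrite ip_comb // (bigD1 j) //= big1 => [|i ij]; rewrite onf.2.
  by rewrite eqxx mulr1 addr0.
by rewrite (negbTE ij) mulr0.
Qed.

Lemma sqn_comb_orthonormal c : sqn (comb f c) = \sum_(i < m) normc (c i) ^+ 2.
Proof.
rewrite /sqn ip_comb //; last exact: comb_mem.
rewrite cRe_sum; apply: eq_bigr => i _.
by rewrite (ipC (comb_mem Hf c) (Hf i)) ip_comb_orthonormal mulcJ_normc.
Qed.

Lemma sqn_projection g : H g -> sqn (fun x => -1 * comb f (fun i => ip g (f i)) x + g x) =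
  sqn g - \sum_(i < m) normc (ip g (f i)) ^+ 2.
Proof.
move=> Hg; rewrite sqn_comb //; last exact: comb_mem.
rewrite sqn_comb_orthonormal -(ipC Hg (comb_mem Hf _)) ip_comb //.
have -> : cRe (-1 * \sum_(i < m) ip g (f i) * ip (f i) g) =
    - \sum_(i < m) normc (ip g (f i)) ^+ 2.
  rewrite mulN1r cReN cRe_sum; congr (- _); apply: eq_bigr => i _.
  by rewrite (ipC Hg (Hf i)) mulcJ_normc.
by rewrite normcN Normc.normc1; ring.
Qed.

(** Bessel's inequality for [K(., z)], whose coefficients are the conjugates of the
values at [z]. *)
Lemma bessel_kernel z : \sum_(i < m) normc (f i z) ^+ 2 <= sqn (K^~ z).
Proof.
have Hk := (HK z).1; have Hp := comb_mem Hf (fun i => ip (K^~ z) (f i)).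
have := sqn_ge0 (HL.2 (-1) _ _ Hp Hk); rewrite sqn_projection // subr_ge0.
rewrite (eq_bigr (fun i => normc (f i z) ^+ 2)) // => i _.
by rewrite (ipC (Hf i) Hk) (HK z).2 // normcJE.
Qed.

End orthonormal_family.

Lemma orthonormal_extend m (f : 'I_m -> X -> C) g : orthonormal_in f -> H g ->
  (forall i, ip g (f i) = 0) -> sqn g != 0 ->
  exists f' : 'I_m.+1 -> X -> C, orthonormal_in f'.
Proof.
move=> onf Hg gf g0.
have gp : 0 < sqn g by rewrite lt_neqAle eq_sym g0 sqn_ge0.
pose c := (Num.sqrt (sqn g))^-1; pose g' x := c%:C * g x + 0.
have Hg' : H g' by exact: (HL.2 _ _ _ Hg HL.1).
have c0 h : H h -> ip g' h = c%:C * ip g h.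
  move=> Hh; rewrite /g' ipl //; last exact: HL.1.
  have := @ip_comb 0 (fun=> g) (fun=> Hg) (fun=> 0) _ Hh.
  rewrite big_ord0 (_ : comb _ _ = fun=> 0) => [->|]; first by rewrite addr0.
  by apply/funext => x; rewrite /comb big_ord0.
have g'f i : ip g' (f i) = 0 by rewrite c0 ?gf ?mulr0 //; exact: onf.1.
have g'1 : ip g' g' = 1.
  rewrite c0 // (ipC Hg' Hg) c0 // ipff // -[conjc _](_ : (c * sqn g)%:C = _).
    rewrite -rmorphM mulrA -expr2 /c exprVn sqr_sqrtr ?sqn_ge0 //.
    by rewrite mulVf.
  by rewrite -rmorphM /= oppr0.
exists (fun i => oapp f g' (unlift ord0 i)); split=> [i|i j].
  by case: (unliftP ord0 i) => [k _|_] /=; [exact: onf.1|].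
case: (unliftP ord0 i) => [k|] ->; case: (unliftP ord0 j) => [l|] -> /=.
- by rewrite onf.2 (inj_eq lift_inj).
- by rewrite (ipC Hg' (onf.1 k)) g'f conjc0.
- by rewrite g'f.
- by rewrite g'1.
Qed.

(** A bound on the size of orthonormal families makes a maximal one an
orthonormal basis. *)
Lemma orthonormal_basis (D : R) :
  (forall m (f : 'I_m -> X -> C), orthonormal_in f -> m%:R <= D) ->
  exists m (f : 'I_m -> X -> C), orthonormal_in f /\
    forall g, H g -> g = comb f (fun i => ip g (f i)).
Proof.
move=> bD.
have [m [[f onf] max]] : exists m, (exists f : 'I_m -> X -> C, orthonormal_in f) /\
    ~ (exists f : 'I_m.+1 -> X -> C, orthonormal_in f).
  apply: contrapT => h.
  have all m : exists f : 'I_m -> X -> C, orthonormal_in f.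
    elim: m => [|m IH].
      by exists (fun i _ => 0); split; case.
    by apply: contrapT => hm; apply: h; exists m.
  have [f /bD] := all (Num.bound D).+1.
  have := archi_boundP (le_trans (ler0n R 0) (bD 0%N _ (proj2_sig (cid (all 0%N))))).
  by rewrite -natr1; lra.
exists m, f; split=> // g Hg; have Hf := onf.1.
pose g' x := -1 * comb f (fun i => ip g (f i)) x + g x.
have Hp := comb_mem Hf (fun i => ip g (f i)).
have Hg' : H g' by exact: HL.2.
have [g0|gN] := eqVneq (sqn g') 0.
  apply/funext => x; have := congr1 (fun h => h x) (sqn_eq0 Hg' g0).
  by rewrite /g' mulN1r addrC => /eqP; rewrite subr_eq0 => /eqP.
case: max; apply: (orthonormal_extend onf Hg') => // i.
by rewrite /g' ipl // ip_comb_orthonormal // mulN1r addNr.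
Qed.

Section basis.
Variables (m : nat) (f : 'I_m -> X -> C).
Hypotheses (onf : orthonormal_in f)
  (full : forall g, H g -> g = comb f (fun i => ip g (f i))).
Let Hf := onf.1.

Lemma basis_dim : has_dim H m.
Proof.
exists f; split=> // [c c0 i|g Hg].
  have E : comb f c = comb f (fun=> 0).
    apply/funext => x; rewrite /comb c0 big1 // => j _; exact: mul0r.
  by rewrite -(ip_comb_orthonormal onf c i) E ip_comb_orthonormal.
by exists (fun i => ip g (f i)) => x; rewrite {1}(full Hg).
Qed.

Lemma kernel_diagonal z : sqn (K^~ z) = \sum_(i < m) normc (f i z) ^+ 2.
Proof.
have Hk := (HK z).1; rewrite [in LHS](full Hk) sqn_comb_orthonormal //.
by apply: eq_bigr => i _; rewrite (ipC (Hf i) Hk) (HK z).2 // normcJE.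
Qed.

Lemma coefficient_bound g i : H g -> normc (ip g (f i)) <= ip_norm ip g.
Proof.
move=> Hg; have := cauchy_schwarz Hg (Hf i).
rewrite /(sqn (f i)) onf.2 eqxx mulr1 => h.
by rewrite -[normc _](ger0_norm (normc_ge0 _)) -sqrtr_sqr ler_wsqrtr.
Qed.

(** The coefficients of a Cauchy sequence are Cauchy sequences of complex numbers;
there are finitely many of them, so their limits give the limit in norm. *)
Lemma basis_complete : ip_complete H ip.
Proof.
move=> u Hu cu.
pose c k i := ip (u k) (f i).
have cc i : exists l : C, forall e : R, 0 < e -> exists N, forall k, (N <= k)%N ->
    normc (c k i - l) < e.
  have cau (h : nat -> R) : (forall e : R, 0 < e -> exists N, forall k l,
      (N <= k)%N -> (N <= l)%N -> `|h k - h l| < e) -> cvgn h.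
    move=> hc; apply: cauchy_cvg; apply/cauchy_exP => e e0.
    have [N HN] := hc e e0; exists (h N).
    by exists N => // k Nk; rewrite /= /ball /=; exact: HN.
  have cb e : 0 < e -> exists N, forall k l, (N <= k)%N -> (N <= l)%N ->
      normc (c k i - c l i) < e.
    move=> e0; have [N HN] := cu e e0; exists N => k l Nk Nl.
    apply: le_lt_trans (HN k l Nk Nl).
    have Hkl : H (fun x => u k x - u l x).
      rewrite (_ : (fun x => _) = fun x => -1 * u l x + u k x); first exact: HL.2.
      by apply/funext => x; rewrite mulN1r addrC.
    have := coefficient_bound i Hkl.
    rewrite (_ : (fun x => _) = fun x => -1 * u l x + u k x); last first.
      by apply/funext => x; rewrite mulN1r addrC.
    by rewrite ipl // mulN1r addrC.
  have c1 : cvgn (fun k => cRe (c k i)).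
    apply: cau => e e0; have [N HN] := cb e e0; exists N => k l Nk Nl.
    by apply: le_lt_trans (HN k l Nk Nl); rewrite -cReB; exact: normc_Re.
  have c2 : cvgn (fun k => cIm (c k i)).
    apply: cau => e e0; have [N HN] := cb e e0; exists N => k l Nk Nl.
    by apply: le_lt_trans (HN k l Nk Nl); rewrite -cImB; exact: normc_Im.
  exists (limn (fun k => cRe (c k i)) +i* limn (fun k => cIm (c k i))) => e e0.
  have e2 : 0 < e / 2 by rewrite divr_gt0.
  have /cvgrPdist_lt/(_ _ e2)[N1 _ H1] := c1.
  have /cvgrPdist_lt/(_ _ e2)[N2 _ H2] := c2.
  exists (maxn N1 N2) => k; rewrite geq_max => /andP[k1 k2].
  apply: (le_lt_trans (normc_leD _)); rewrite cReB cImB /= (splitr e).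
  by apply: ltrD; rewrite distrC; [exact: H1|exact: H2].
pose l i := proj1_sig (cid (cc i)).
have lP i (e : R) : 0 < e -> exists N, forall k, (N <= k)%N -> normc (c k i - l i) < e.
  exact: (proj2_sig (cid (cc i))).
exists (comb f l); first exact: comb_mem.
move=> e e0.
have m0 : 0 < e / (m.+1%:R) by rewrite divr_gt0.
pose N i := proj1_sig (cid (lP i _ m0)).
have NP i := proj2_sig (cid (lP i _ m0)).
exists (\max_(i < m) N i)%N => k Nk.
have -> : (fun x => u k x - comb f l x) = comb f (fun i => c k i - l i).
  apply/funext => x; rewrite {1}(full (Hu k)) /comb -sumrB.
  by apply: eq_bigr => i _; rewrite mulrBl.
rewrite /ip_norm -/(sqn _) sqn_comb_orthonormal //.
rewrite -[e]ger0_norm ?ltW // -sqrtr_sqr ltr_sqrt; last by rewrite exprn_gt0.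
apply: (@le_lt_trans _ _ (\sum_(i < m) (e / m.+1%:R) ^+ 2)).
  apply: ler_sum => i _; rewrite ler_pXn2r ?nnegrE ?normc_ge0 ?ltW //.
  by apply: NP; apply: leq_trans Nk; exact: (leq_bigmax i).
rewrite sumr_const card_ord -[ltLHS]mulr_natr.
rewrite (_ : _ * m%:R = e ^+ 2 * (m%:R / m.+1%:R ^+ 2)); last first.
  by rewrite expr_div_n -[LHS]mulrA (mulrC _ m%:R).
rewrite gtr_pMr ?exprn_gt0 // ltr_pdivrMr ?exprn_gt0 // mul1r -natrX ltr_nat.
by rewrite -mulnn leq_pmulr.
Qed.

Lemma basis_rkhs : rkhs H ip.
Proof.
split; last exact: reproducing_evaluation.
split=> //; last exact: basis_complete.
split=> // g Hg g0; apply: sqn_eq0 => //.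
by rewrite /sqn g0.
Qed.

End basis.

End hilbert.

(** * Integrals of periodic functions *)

Section periodic.
Local Open Scope ereal_scope.
Context {R : realType} (n : nat).
Local Notation mR := (measurableTypeR R).
Local Notation plane := (mR * mR)%type.
Local Notation C := R[i].
Local Notation T := (n.-tuple plane).
Local Notation cT := (caratheodory_type (lebesgue_tuple n)^*%mu).
Local Notation mu := (@lebesgue_tuple R n).
Local Notation lc := (@lebesgue_Cn R n).
Variables (G L : set 'rV[C]_n) (e : nat -> 'rV[C]_n).
Hypotheses (sG : additive_subgroup G) (fd : fundamental_domain G L)
  (einj : injective e) (eG : forall g, G g <-> exists k, e k = g).
Let Lam : set cT := @tuple_Cn R n @^-1` L.
Let mL : measurable Lam := measurable_domain fd.

Lemma domain_translate_unique (z : 'rV[C]_n) :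
  exists k, L (z + e k)%R /\ forall l, L (z + e l)%R -> l = k.
Proof.
case: fd => _ cov triv; have : setT z by [].
rewrite -cov => -[g Gg [y Ly yz]].
have /eG[k Ek] := subgroupN sG Gg.
have Gn l : G (- e l)%R by apply: (subgroupN sG); apply/eG; exists l.
exists k; split; first by rewrite Ek -yz addrC addKr.
move=> l Ll; apply: einj; apply: oppr_inj; apply: triv => //.
exists z; split; first by exists (z + e l)%R => //; rewrite addrC addrK.
by exists y => //; rewrite Ek opprK.
Qed.

(** The translate of the domain is cut along the lattice and reassembled into the
domain itself: a periodic function does not see the difference. *)
Lemma ge0_integral_periodic (f : 'rV[C]_n -> R) (a : 'rV[C]_n) :
  measurable_fun setT (fun t : T => f (tuple_Cn t)) -> (forall z, (0 <= f z)%R) ->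
  (forall z g, G g -> f (z + g)%R = f z) ->
  \int[lc]_(x in Lam) (f (tuple_Cn x + a)%R)%:E = \int[lc]_(x in Lam) (f (tuple_Cn x))%:E.
Proof.
move=> mf f0 fG.
pose h (x : cT) : \bar R := (f (tuple_Cn x))%:E.
have mh : measurable_fun setT h.
  by apply: (measurable_fun_completion (m := mu)) => //; exact/measurable_EFinP.
have h0 x : 0 <= h x by rewrite lee_fin.
pose D : set cT := (shiftT (- a)%R : cT -> cT) @^-1` Lam.
have DE x : D x = L (tuple_Cn x - a)%R by rewrite /D /Lam /= tuple_Cn_shift.
have mD : measurable D.
  rewrite -[X in measurable X]setTI; exact: (preserving_shift_Cn (- a)%R).1.
have pa := preserving_shift_Cn a.
transitivity (\int[lc]_(x in D) h x).
  rewrite -(ge0_integral_preserving pa mD (measurable_funTS mh)) //.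
  have -> : (shiftT a : cT -> cT) @^-1` D = Lam.
    by apply/seteqP; split => x; rewrite /= DE tuple_Cn_shift addrK.
  by apply: eq_integral => x _; rewrite /h tuple_Cn_shift.
rewrite integral_mkcond.
have mhD : measurable_fun setT (h \_ D).
  by apply/(measurable_restrictT h mD)/measurable_funTS.
have hD0 x : 0 <= (h \_ D) x by rewrite /patch; case: ifP.
rewrite (integral_unfold fd einj eG mhD hD0).
apply: eq_integral => x _.
have [k [Lk uk]] := domain_translate_unique (tuple_Cn x - a)%R.
have shD l : D (shiftT (e l) x) = L (tuple_Cn x - a + e l)%R.
  by rewrite DE tuple_Cn_shift addrAC.
rewrite (nneseriesD1 (n := k)) // eseries0 ?adde0; last first.
  move=> l _ lk; rewrite /patch ifF //; apply/negP => /set_mem; rewrite shD => /uk lk'.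
  by rewrite lk' eqxx in lk.
rewrite /patch ifT; last by apply/mem_set; rewrite shD.
by rewrite /h tuple_Cn_shift fG //; apply/eG; exists k.
Qed.

End periodic.

Section trace.
Context {R : realType} (n : nat).
Local Notation mR := (measurableTypeR R).
Local Notation plane := (mR * mR)%type.
Local Notation C := R[i].
Local Notation T := (n.-tuple plane).
Local Notation cT := (caratheodory_type (lebesgue_tuple n)^*%mu).
Local Notation mu := (@lebesgue_tuple R n).
Local Notation lc := (@lebesgue_Cn R n).
Variables (G L : set 'rV[C]_n) (e : nat -> 'rV[C]_n).
Hypotheses (sG : additive_subgroup G) (fd : fundamental_domain G L)
  (einj : injective e) (eG : forall g, G g <-> exists k, e k = g)
  (finL : (vol L < +oo)%E).
Let Lam : set cT := @tuple_Cn R n @^-1` L.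
Let mL : measurable Lam := measurable_domain fd.

Lemma integral_periodic (f : 'rV[C]_n -> R) (M : R) (a : 'rV[C]_n) :
  measurable_fun setT (fun t : T => f (tuple_Cn t)) -> (forall z, `|f z| <= M) ->
  (forall z g, G g -> f (z + g) = f z) ->
  \int[lc]_(x in Lam) f (tuple_Cn x + a) = \int[lc]_(x in Lam) f (tuple_Cn x).
Proof.
move=> mf fM fG; have iM : lc.-integrable Lam (EFin \o (fun=> M)).
  by apply: (@integrable_Lam _ _ _ mL finL (fun=> M) `|M|).
have mfa : measurable_fun setT (fun t : T => f (tuple_Cn t + a)).
  rewrite (_ : (fun t => _) = (fun t : T => f (tuple_Cn t)) \o shiftT a).
    exact: measurableT_comp mf (preserving_shiftT a).1.
  by apply/funext => t /=; rewrite tuple_Cn_shift.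
have jf := @integrable_Lam _ _ _ mL finL f M mf fM.
have jfa := @integrable_Lam _ _ _ mL finL (fun z => f (z + a)) M mfa (fun z => fM (z + a)).
apply: (addIr (\int[lc]_(x in Lam) M)).
rewrite -[LHS](RintegralD mL jfa iM) -[RHS](RintegralD mL jf iM).
have := @ge0_integral_periodic R n G L e sG fd einj eG (fun z => f z + M) a.
rewrite /Rintegral => -> //.
- by apply: measurable_funD.
- by move=> z; have := fM z; rewrite ler_norml; lra.
- by move=> z g Gg; rewrite fG.
Qed.

Lemma integral_Cn_periodic (F : 'rV[C]_n -> C) a : cbounded F ->
  (forall z g, G g -> F (z + g) = F z) ->
  integral_Cn L (fun z => F (z + a)) = integral_Cn L F.
Proof.
move=> [[m1 m2] [M FM]] FG; apply: eqcP => /=.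
  apply: (@integral_periodic (fun z => cRe (F z)) M) => // [z|z g Gg].
    exact: le_trans (normc_Re _) (FM z).
  by rewrite FG.
apply: (@integral_periodic (fun z => cIm (F z)) M) => // [z|z g Gg].
  exact: le_trans (normc_Im _) (FM z).
by rewrite FG.
Qed.

End trace.

(** * Term-by-term integration *)

Section integral_series.
Context {R : realType} (n : nat).
Local Notation mR := (measurableTypeR R).
Local Notation plane := (mR * mR)%type.
Local Notation C := R[i].
Local Notation T := (n.-tuple plane).
Local Notation cT := (caratheodory_type (lebesgue_tuple n)^*%mu).
Variable L : set 'rV[C]_n.
Hypotheses (mL : measurable (@tuple_Cn R n @^-1` L : set cT)) (finL : (vol L < +oo)%E).
Variables (F : nat -> 'rV[C]_n -> C) (a : nat -> R).
Hypotheses (mF : forall k, cmeasurable (F k)) (Fa : forall k z, normc (F k z) <= a k)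
  (sa : cvgn (series a)).

Let a0 k : 0 <= a k. Proof. by apply: le_trans (Fa k 0); exact: normc_ge0. Qed.

Let aF z : abssum (fun k => F k z).
Proof. by apply: (abssum_le_real (K := 1) (a := a) _ a0 sa) => k; rewrite mul1r. Qed.

Lemma cbounded_csumN : cbounded (fun z => csumN (fun k => F k z)).
Proof.
split; last first.
  exists (limn (series a)) => z; apply: normc_csumN => // m.
  apply: (@le_trans _ _ (\sum_(0 <= k < m) a k)); first exact: ler_sum.
  apply: (nondecreasing_cvgn_le (u_ := series a)) => //.
  by apply: nondecreasing_series => k _ _.
split.
  apply: (@measurable_fun_cvg _ _ _ _ (fun m (t : T) => \sum_(0 <= k < m) cRe (F k (tuple_Cn t)))).
    by move=> m; apply: measurable_sum => k; exact: (mF k).1.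
  by move=> t _; exact: (@abssum_Re _ _ (@aF (tuple_Cn t))).
apply: (@measurable_fun_cvg _ _ _ _ (fun m (t : T) => \sum_(0 <= k < m) cIm (F k (tuple_Cn t)))).
  by move=> m; apply: measurable_sum => k; exact: (mF k).2.
by move=> t _; exact: (@abssum_Im _ _ (@aF (tuple_Cn t))).
Qed.

Lemma cbounded_term k : cbounded (F k).
Proof. by split=> //; exists (a k). Qed.

Let I z := csumN (fun k => F k z).
Let rest N z := I z - \sum_(0 <= k < N) F k z.

Let rest_integral N : cbounded (rest N) /\
  integral_Cn L (rest N) = integral_Cn L I - \sum_(0 <= k < N) integral_Cn L (F k).
Proof.
elim: N => [|N [[mr [M rM]] Er]].
  have -> : rest 0 = I by apply/funext => z; rewrite /rest big_geq ?subr0.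
  by split; [exact: cbounded_csumN|rewrite big_geq ?subr0].
have E : rest N.+1 = fun z => -1 * F N z + rest N z.
  by apply/funext => z; rewrite /rest big_nat_recr //= opprD addrA mulN1r addrC.
rewrite E; split.
  split; first by apply: cmeasurableD => //; apply: cmeasurableM => //; exact: cmeasurable_cst.
  exists (a N + M) => z; apply: (le_trans (le_normcD _ _)); rewrite mulN1r normcN.
  exact: lerD.
rewrite integral_Cn_linear //; try apply: cbounded_integrable => //.
- by rewrite Er big_nat_recr //=; ring.
- exact: cbounded_term.
- by split=> //; exists M.
Qed.

Let rest_bound (d : R) : 0 < d -> exists N, forall m z, (N <= m)%N -> normc (rest m z) <= d.
Proof.
move=> d0; have d2 : 0 < d / 2 by rewrite divr_gt0.
have aa : abssum (fun k => (a k)%:C : C).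
  rewrite /abssum (_ : (fun k => _) = a) //.
  by apply/funext => k; rewrite normcCE ger0_norm.
have [N HN] := csumN_tail aa d2; exists N => m z Nm.
have [N' HN'] := csumN_cvg (@aF z) d2.
have := HN' (maxn m N') (leq_maxr _ _).
rewrite normcBC (@big_cat_nat _ _ _ m) ?leq_maxl //= opprD addrA -/(rest m z) => h1.
have := le_normcD (rest m z - \sum_(m <= k < maxn m N') F k z) (\sum_(m <= k < maxn m N') F k z).
rewrite subrK => h2; apply: (le_trans h2); rewrite (splitr d); apply: lerD; first exact: ltW.
apply: (le_trans (ler_normc_sum _ _ _)).
have Nx : (N <= maxn m N')%N by rewrite (leq_trans Nm) ?leq_maxl.
apply: le_trans (ltW (HN _ Nx)).
rewrite (@big_cat_nat _ _ _ m N) ?leq_maxl //.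
apply: (@le_trans _ _ (\sum_(m <= k < maxn m N') normc ((a k)%:C : C))).
  by apply: ler_sum => k _; rewrite normcCE ger0_norm.
by rewrite lerDr; apply: sumr_ge0 => k _; exact: normc_ge0.
Qed.

(** Term-by-term integration, when the partial sums of the integrals become
stationary. *)
Lemma integral_csumN (N0 : nat) (V : C) :
  (forall N, (N0 <= N)%N -> \sum_(0 <= k < N) integral_Cn L (F k) = V) ->
  integral_Cn L (fun z => csumN (fun k => F k z)) = V.
Proof.
move=> HV; apply/eqP; rewrite -subr_eq0; apply/eqP/Normc.eq0_normc/eqP.
rewrite eq_le normc_ge0 andbT; apply/ler_addgt0Pl => d d0; rewrite addr0.
set v := fine (vol L).
have v0 : 0 <= v by rewrite fine_ge0 // measure_ge0.
have p : 0 < 2 * (v + 1) by rewrite mulr_gt0 // ltr_wpDl.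
have dp : 0 < d / (2 * (v + 1)) by rewrite divr_gt0.
have [N HN] := rest_bound dp.
have [[mr _] Er] := rest_integral (maxn N N0).
rewrite -(HV (maxn N N0) (leq_maxr _ _)) -Er.
apply: le_trans (normc_integral_Cn mL finL mr (fun z => HN _ z (leq_maxl _ _))) _.
rewrite -/v (_ : 2 * _ * v = d * (v / (v + 1))); last by field; rewrite gt_eqF // ltr_wpDl.
by rewrite ler_piMr ?(ltW d0) // ler_pdivrMr ?ltr_wpDl // mul1r lerDl.
Qed.

End integral_series.

(** * The trace of the kernel *)

Section phase.
Context {R : realType} (n : nat) (nu : R).
Local Notation C := R[i].
Implicit Types g z w : 'rV[C]_n.

Definition phase g z : C := cexp (nu%:C * (hdot z g - conjc (hdot z g))).

Lemma phaseD g z w : phase g (z + w) = phase g z * phase g w.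
Proof. by rewrite /phase -cexpD hdotDl rmorphD; congr cexp; ring. Qed.

Lemma phaseE g z : phase g z = cexp ('i * (2 * nu * omega z g)%:C).
Proof.
rewrite /phase /omega; congr cexp; case: (hdot z g) => a b.
by apply: eqcP; rewrite !cReIm /=; ring.
Qed.

Lemma normc_phase g z : normc (phase g z) = 1.
Proof. by rewrite phaseE normc_cexp cReM /= mul0r mulr0 subr0 expR0. Qed.

Lemma phase0 z : phase 0 z = 1.
Proof.
rewrite /phase (_ : hdot z 0 = 0) ?conjc0 ?subr0 ?mulr0 ?cexp0 //.
by rewrite -(subrr (0 : 'rV[C]_n)) hdotDr hdotNr addrN.
Qed.

Lemma cmeasurable_phase g : cmeasurable (phase g).
Proof.
rewrite (_ : phase g = fun z => cexp (hdot z (nu%:C *: g)) *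
    conjc (cexp (hdot z ((- nu)%:C *: g)))).
  apply: cmeasurableM; last apply: cmeasurableJ;
    by apply: cmeasurable_deriv => z; eexists; exact: cderivn_exp.
apply/funext => z; rewrite /phase -cexpJ -cexpD; congr cexp.
by rewrite !hdotZr conjcM (_ : conjc (- nu)%:C = - nu%:C) ?mulNr ?mulrBr //= opprK; congr (_ +i* _); rewrite oppr0.
Qed.

Lemma nrm2_gt0 g : g != 0 -> 0 < nrm2 g.
Proof.
move=> g0; rewrite lt_neqAle nrm2_ge0 andbT eq_sym; apply: contra_neq g0 => h.
apply/rowP => i; rewrite mxE; apply: Normc.eq0_normc; apply/eqP.
rewrite -sqrf_eq0 eq_le sqr_ge0 andbT -h /nrm2 (bigD1 i) //= lerDl.
by apply: sumr_ge0 => j _; exact: sqr_ge0.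
Qed.

Lemma phase_nontrivial g : 0 < nu -> g != 0 -> exists a, phase g a = -1.
Proof.
(* The multiple of [i g] on which [2 nu omega] takes the value pi. *)
move=> nu0 /nrm2_gt0 g0; exists (('i * (pi / (2 * nu * nrm2 g))%:C) *: g).
rewrite phaseE /omega hdotZl hdotzz -(mulrA 'i) -rmorphM.
have -> : 2 * nu * cIm ('i * (pi / (2 * nu * nrm2 g) * nrm2 g)%:C) = pi.
  by rewrite cImM /= mul0r add0r mul1r; field; rewrite !gt_eqF.
by rewrite /cexp cReM cImM /= !mul0r !mulr0 mul1r subr0 add0r expR0 mul1r cospi sinpi complexr0 rmorphN.
Qed.

End phase.

Section kernel_trace.
Context {R : realType} (n : nat) (nu : R).
Local Notation C := R[i].
Variables (G L : set 'rV[C]_n) (chi : 'rV[C]_n -> C) (e : nat -> 'rV[C]_n).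
Hypotheses (nu0 : 0 < nu) (latG : full_rank_lattice G) (pchi : pseudocharacter nu G chi)
  (fd : fundamental_domain G L)
  (einj : injective e) (eG : forall g, G g <-> exists k, e k = g).
Let sG : additive_subgroup G. Proof. by case: latG. Qed.
Let finL : (vol L < +oo)%E := vol_domain_fin latG fd einj eG.
Let mL := measurable_domain fd.
Let Ge k : G (e k). Proof. by apply/eG; exists k. Qed.

Definition kernel_density z := theta_kernel nu G chi z z * cexp (- (nu%:C * hdot z z)).

Let F k z := (chi (e k) * (expR (- (nu / 2) * nrm2 (e k)))%:C) * phase nu (e k) z.

(** On the diagonal the exponents [nu <z, z>] cancel and each term of the series is a
constant times a character. *)
Lemma kernel_densityE z :
  kernel_density z = ((nu / pi) ^+ n)%:C * csumN (fun k => F k z).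
Proof.
rewrite /kernel_density (theta_kernelE nu0 pchi fd einj eG).
have gE g : (- (nu / 2) * nrm2 g)%:C = - ((nu / 2)%:C * hdot g g) :> C.
  by rewrite hdotzz -rmorphM -rmorphN mulNr.
have -> : csumN (fun k => kernel_term nu chi z z (e k)) = csumN (fun k => F k z).
  congr csumN; apply/funext => k; by rewrite /kernel_term /F /phase -mulrA -cexp_real -cexpD gE.
have := cexpNK (nu%:C * hdot z z); set X := cexp (- _); set Y := cexp _ => XY.
by rewrite -[RHS]mul1r -XY; ring.
Qed.

Let mF k : cmeasurable (F k).
Proof. by apply: cmeasurableM; [exact: cmeasurable_cst|exact: cmeasurable_phase]. Qed.

Let Fa k z : normc (F k z) <= expR (- (nu / 2) * nrm2 (e k)).
Proof.
rewrite /F 2!Normc.normcM normc_phase mulr1 (normc_chi pchi (Ge k)) mul1r.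
by rewrite normcCE ger0_norm ?expR_ge0.
Qed.

Let sa : cvgn (series (fun k => expR (- (nu / 2) * nrm2 (e k)))).
Proof. by apply: (lattice_gauss_summable fd einj eG); rewrite divr_gt0. Qed.

Lemma integrable_kernel_density : integrable_Cn L kernel_density.
Proof.
rewrite (_ : kernel_density = fun z => ((nu / pi) ^+ n)%:C * csumN (fun k => F k z)).
  have [m [M FM]] := cbounded_csumN mF Fa sa.
  apply: (cbounded_integrable mL finL); split.
    by apply: cmeasurableM => //; exact: cmeasurable_cst.
  exists (normc ((nu / pi) ^+ n)%:C * M) => z.
  by rewrite Normc.normcM ler_wpM2l ?normc_ge0.
by apply/funext => z; exact: kernel_densityE.
Qed.

(** Translation by [a] preserves the integral of a periodic function but multiplies
[phase nu g] by [-1]. *)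
Lemma integral_phase g : G g -> g != 0 -> integral_Cn L (phase nu g) = 0.
Proof.
move=> Gg g0; have [a Ha] := phase_nontrivial nu0 g0.
have cb : cbounded (phase nu g).
  by split; [exact: cmeasurable_phase|exists 1 => z; rewrite normc_phase].
have := integral_Cn_periodic sG fd einj eG finL a cb.
rewrite (eq_integral_Cn L (H := fun z => -1 * phase nu g z)); last first.
  by move=> z; rewrite phaseD Ha mulrC.
rewrite integral_CnZ //; last exact: cbounded_integrable.
have per z h : G h -> phase nu g (z + h) = phase nu g z.
  by move=> Gh; rewrite phaseD (phaseE _ _ h) (cexp_2omega pchi Gh Gg) mulr1.
move=> /(_ per)/eqP; rewrite mulN1r eq_sym -subr_eq0 opprK -mulr2n mulrn_eq0 /=.
by move/eqP.
Qed.

(** Only the term of the lattice point 0 has a nonzero integral. *)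
Lemma integral_kernel_density :
  integral_Cn L kernel_density = ((nu / pi) ^+ n * fine (vol L))%:C.
Proof.
rewrite (eq_integral_Cn L kernel_densityE).
have cb := cbounded_csumN mF Fa sa.
rewrite integral_CnZ //; last exact: cbounded_integrable.
rewrite rmorphM; congr (_ * _).
have /eG[k0 Ek] := subgroup0 sG.
have term k : integral_Cn L (F k) = if k == k0 then (fine (vol L))%:C else 0.
  have ip g : integrable_Cn L (phase nu g).
    apply: (cbounded_integrable mL finL).
    by split; [exact: cmeasurable_phase|exists 1 => z; rewrite normc_phase].
  rewrite integral_CnZ //; case: eqP => [->|/eqP kk].
    rewrite Ek (chi0 sG pchi) (_ : nrm2 0 = 0); last first.
      by apply: big1 => i _; rewrite mxE Normc.normc0 expr0n.
    rewrite mulr0 expR0 !mul1r (eq_integral_Cn L (H := fun=> 1)); last exact: phase0.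
    by apply: eqcP; rewrite /= Rintegral_cst // ?mul1r ?mul0r.
  rewrite integral_phase ?mulr0 // -Ek (inj_eq einj) //.
apply: (@integral_csumN R n L mL finL F _ mF Fa sa k0.+1) => N kN.
rewrite (bigD1_seq k0) ?iota_uniq ?mem_index_iota //= term eqxx big1 ?addr0 // => k kk.
by rewrite term (negbTE kk).
Qed.

End kernel_trace.

Section theta_inner_product.
Context {R : realType} (n : nat) (nu : R).
Local Notation C := R[i].
Variables (G L : set 'rV[C]_n) (chi : 'rV[C]_n -> C).
Hypotheses (nu0 : 0 < nu) (latG : full_rank_lattice G) (pchi : pseudocharacter nu G chi)
  (fd : fundamental_domain G L) (finL : (vol L < +oo)%E).
Let mL := measurable_domain fd.
Local Notation O := (theta_space nu G chi).

Lemma theta_subspace : linear_subspace O.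
Proof.
split; first by split=> [|z g _]; [exact: holomorphic_cst|rewrite mulr0].
move=> a f g [hf Hf] [hg Hg]; split; first exact: holomorphic_comb.
by move=> z gam Gg; rewrite Hf // Hg //; ring.
Qed.

Lemma theta_cbounded f g : O f -> O g -> cbounded (theta_integrand nu f g).
Proof.
move=> Of Og; split; first exact: (cmeasurable_integrand Of Og).
exact: (bounded_integrand nu0 latG pchi Of Og).
Qed.

Lemma theta_integrable f g : O f -> O g -> integrable_Cn L (theta_integrand nu f g).
Proof. by move=> Of Og; apply: (cbounded_integrable mL finL); exact: theta_cbounded. Qed.

Lemma theta_productDl (a : C) f g h : O f -> O g -> O h ->
  theta_product nu L (fun x => a * f x + g x) h =
  a * theta_product nu L f h + theta_product nu L g h.
Proof.
move=> Of Og Oh; rewrite /theta_product -integral_Cn_linear //; try exact: theta_integrable.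
by apply: eq_integral_Cn => z; rewrite /theta_integrand; ring.
Qed.

Lemma theta_productC f g : O f -> O g ->
  theta_product nu L g f = conjc (theta_product nu L f g).
Proof.
move=> Of Og; rewrite /theta_product -integral_Cn_conj //; last exact: theta_integrable.
apply: eq_integral_Cn => z; rewrite !theta_integrandE.
by rewrite (conjcM (theta_weighted nu f z)) conjcK mulrC.
Qed.

Lemma theta_integrand_diag (f : 'rV[C]_n -> C) z :
  theta_integrand nu f f z = (normc (f z) ^+ 2 * expR (- nu * nrm2 z))%:C.
Proof.
rewrite /theta_integrand mulcJ_normc hdotzz.
have -> : cexp (- (nu%:C * (nrm2 z)%:C)) = (expR (- nu * nrm2 z))%:C.
  by rewrite -rmorphM -rmorphN cexp_real mulNr.
by rewrite -rmorphM.
Qed.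

Lemma theta_product_ge0 (f : 'rV[C]_n -> C) : 0 <= theta_product nu L f f.
Proof.
rewrite lecE /=; apply/andP; split.
  rewrite [X in X == _](_ : _ = 0) //.
  rewrite /Rintegral (eq_integral (cst 0%E)) ?integral0 // => x _.
  by rewrite theta_integrand_diag.
apply: Rintegral_ge0 => x _; rewrite theta_integrand_diag /=.
by rewrite mulr_ge0 ?sqr_ge0 ?expR_ge0.
Qed.

Lemma integral_Cn_sum m (F : 'I_m -> 'rV[C]_n -> C) : (forall i, cbounded (F i)) ->
  cbounded (fun z => \sum_(i < m) F i z) /\
  integral_Cn L (fun z => \sum_(i < m) F i z) = \sum_(i < m) integral_Cn L (F i).
Proof.
elim: m F => [|m IH] F bF.
  have -> : (fun z => \sum_(i < 0) F i z) = fun=> 0.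
    by apply/funext => z; rewrite big_ord0.
  rewrite big_ord0; split; last by apply: eqcP; rewrite /= /Rintegral integral0.
  by split; [exact: cmeasurable_cst|exists 0 => z; rewrite Normc.normc0].
have [[m1 [M HM]] E] := IH (fun i => F (lift ord0 i)) (fun i => bF _).
have -> : (fun z => \sum_(i < m.+1) F i z) =
    fun z => 1 * F ord0 z + \sum_(i < m) F (lift ord0 i) z.
  by apply/funext => z; rewrite big_ord_recl mul1r.
have [m0 [M0 HM0]] := bF ord0; split.
  split; first by apply: cmeasurableD => //; apply: cmeasurableM => //; exact: cmeasurable_cst.
  exists (M0 + M) => z; apply: (le_trans (le_normcD _ _)); rewrite mul1r.
  exact: lerD.
rewrite integral_Cn_linear //; try apply: (cbounded_integrable mL finL) => //.
  by rewrite mul1r E big_ord_recl.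
by split=> //; exists M.
Qed.

End theta_inner_product.

(** * The dimension *)

Section dimension.
Context {R : realType} (n : nat) (nu : R).
Local Notation C := R[i].
Variables (G L : set 'rV[C]_n) (chi : 'rV[C]_n -> C) (e : nat -> 'rV[C]_n).
Hypotheses (nu0 : 0 < nu) (latG : full_rank_lattice G) (pchi : pseudocharacter nu G chi)
  (fd : fundamental_domain G L)
  (einj : injective e) (eG : forall g, G g <-> exists k, e k = g).
Let finL : (vol L < +oo)%E := vol_domain_fin latG fd einj eG.
Let mL := measurable_domain fd.
Local Notation O := (theta_space nu G chi).
Local Notation ip := (theta_product nu L).
Local Notation K := (theta_kernel nu G chi).
Let HL : linear_subspace O := theta_subspace nu G chi.

Lemma theta_kernel_reproducing : reproducing_kernel O ip K.
Proof.
have sG : additive_subgroup G by case: latG.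
move=> w; split; first exact: (theta_space_kernel nu0 sG pchi fd einj eG).
by move=> f Of; exact: (theta_reproducing nu0 latG pchi fd einj eG w Of).
Qed.

Let HK := theta_kernel_reproducing.

Let ipl (a : C) f g h : O f -> O g -> O h ->
  ip (fun x => a * f x + g x) h = a * ip f h + ip g h.
Proof. exact: theta_productDl. Qed.

Let ipC f g : O f -> O g -> ip g f = conjc (ip f g).
Proof. exact: theta_productC. Qed.

Let ip_ge0 f : O f -> 0 <= ip f f.
Proof. by move=> _; exact: theta_product_ge0. Qed.

Lemma kernel_density_sqn z :
  kernel_density nu G chi z = (sqn ip (K^~ z) * expR (- nu * nrm2 z))%:C.
Proof.
rewrite /kernel_density (reproducing_sqn ip_ge0 HK) hdotzz.
have -> : cexp (- (nu%:C * (nrm2 z)%:C)) = (expR (- nu * nrm2 z))%:C.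
  by rewrite -rmorphM -rmorphN cexp_real mulNr.
by rewrite -rmorphM.
Qed.

Lemma orthonormal_integral m (f : 'I_m -> 'rV[C]_n -> C) : orthonormal_in O ip f ->
  integrable_Cn L (fun z => \sum_(i < m) theta_integrand nu (f i) (f i) z) /\
  integral_Cn L (fun z => \sum_(i < m) theta_integrand nu (f i) (f i) z) = m%:R.
Proof.
move=> [Of onf].
have [c E] := integral_Cn_sum fd finL (fun i => theta_cbounded nu0 latG pchi (Of i) (Of i)).
split; first exact: (cbounded_integrable mL finL).
rewrite E (eq_bigr (fun=> 1)) ?sumr_const ?card_ord // => i _.
by have := onf i i; rewrite eqxx.
Qed.

(** Bessel's inequality integrated over the domain. *)
Lemma orthonormal_size m (f : 'I_m -> 'rV[C]_n -> C) : orthonormal_in O ip f ->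
  m%:R <= (nu / pi) ^+ n * fine (vol L).
Proof.
move=> onf; have [[j1 _] E] := orthonormal_integral onf.
have [k1 _] := integrable_kernel_density nu0 latG pchi fd einj eG.
have := congr1 (@complex.Re _) E.
have := congr1 (@complex.Re _) (integral_kernel_density nu0 latG pchi fd einj eG).
have -> : cRe (m%:R : C) = m%:R by rewrite -(rmorph_nat (real_complex R)).
rewrite /= => <- <-; apply: le_Rintegral => // x _.
rewrite kernel_density_sqn /= cRe_sum.
under eq_bigr do rewrite theta_integrand_diag /=.
rewrite -mulr_suml ler_wpM2r ?expR_ge0 //.
exact: (bessel_kernel HL ipl ipC ip_ge0 HK onf).
Qed.

(** For a basis Bessel's inequality is an equality, and so is its integral. *)
Lemma orthonormal_basis_size m (f : 'I_m -> 'rV[C]_n -> C) : orthonormal_in O ip f ->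
  (forall g, O g -> g = comb f (fun i => ip g (f i))) ->
  m%:R = (nu / pi) ^+ n * fine (vol L).
Proof.
move=> onf full; have [_ E] := orthonormal_integral onf.
have T := integral_kernel_density nu0 latG pchi fd einj eG.
suff : (m%:R : C) = ((nu / pi) ^+ n * fine (vol L))%:C.
  by rewrite -(rmorph_nat (real_complex R)) => /(congr1 (@complex.Re _)).
rewrite -E -T; apply: eq_integral_Cn => z.
rewrite kernel_density_sqn (kernel_diagonal HL ipl ipC HK onf full) mulr_suml rmorph_sum.
by apply: eq_bigr => i _; rewrite theta_integrand_diag.
Qed.

End dimension.

Theorem corollary3p10 (R : realType) (n : nat) (nu : R)
    (G : set 'rV[R[i]]_n) (chi : 'rV[R[i]]_n -> R[i]) (L : set 'rV[R[i]]_n) :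
  (1 <= n)%N -> 0 < nu -> full_rank_lattice G -> pseudocharacter nu G chi ->
  fundamental_domain G L ->
  let O := theta_space nu G chi in
  [/\ exists2 g, O g & exists z, g z != 0,
      [/\ forall g1 g2, O g1 -> O g2 -> integrable_Cn L (theta_integrand nu g1 g2),
          rkhs O (theta_product nu L),
          forall z w, csummable G (kernel_term nu chi z w) &
          reproducing_kernel O (theta_product nu L) (theta_kernel nu G chi)] &
      exists2 d : nat, has_dim O d &
        (d%:R)%:E = (((nu / pi) ^+ n)%:E * vol L)%E].
Proof.
move=> n1 nu0 latG pchi fd O.
have [e einj eG] := lattice_enum latG n1.
have finL := vol_domain_fin latG fd einj eG.
have HL : linear_subspace O := theta_subspace nu G chi.
have HK : reproducing_kernel O (theta_product nu L) (theta_kernel nu G chi).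
  exact: theta_kernel_reproducing nu0 latG pchi fd einj eG.
have ipl := @theta_productDl R n nu G L chi nu0 latG pchi fd finL.
have ipC := @theta_productC R n nu G L chi nu0 latG pchi fd finL.
have ip0 f : O f -> 0 <= theta_product nu L f f by move=> _; exact: theta_product_ge0.
have [m [f [onf full]]] := orthonormal_basis HL ipl ipC ip0 HK
  (@orthonormal_size R n nu G L chi e nu0 latG pchi fd einj eG).
have mD := orthonormal_basis_size nu0 latG pchi fd einj eG onf full.
have m0 : (0 < m)%N.
  rewrite -(ltr0n R) mD mulr_gt0 ?exprn_gt0 ?divr_gt0 ?pi_gt0 //.
  by rewrite fine_gt0 // finL (vol_domain_gt0 fd einj eG).
split.
- exists (f (Ordinal m0)); first exact: onf.1.
  apply: contrapT => h; have : f (Ordinal m0) = fun=> 0.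
    apply/funext => z; apply/eqP/negPn/negP => hz; apply: h; exists z; exact: hz.
  (* The zero function does not have norm 1. *)
  have := onf.2 (Ordinal m0) (Ordinal m0); rewrite eqxx => /[swap] -> E.
  have := ipl (-1) _ _ _ HL.1 HL.1 HL.1.
  rewrite (_ : (fun x => _) = fun=> 0); last by apply/funext => z; rewrite mulr0 addr0.
  by rewrite E mulr1 addNr => /eqP; rewrite oner_eq0.
- split=> //.
  + exact: (theta_integrable nu0 latG pchi fd finL).
  + exact: (basis_rkhs HL ipl ipC ip0 HK onf full).
  + exact: csummable_kernel nu0 pchi fd einj eG.
- exists m; first exact: (basis_dim HL ipl onf full).
  by rewrite mD EFinM fineK // ge0_fin_numE ?measure_ge0.
Qed.
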